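(* Let $G$ be a finite simple connected graph on $n$ vertices with maximum degree $\Delta(G)\le 5$. Then the edge set of $G$ can be decomposed into at most $\lceil n/2\rceil$ paths, i.e. there is a collection of at most $\lceil n/2\rceil$ paths in $G$ such that every edge of $G$ belongs to exactly one of them.
   Context: A path decomposition of a graph $G$ is a collection $\mathcal{D}$ of subgraphs of $G$, each of which is a path, such that every edge of $G$ belongs to exactly one member of $\mathcal{D}$. *)

(* Defs.v *)
From mathcomp Require Import all_boot.

Set Implicit Arguments.
Unset Strict Implicit.
Unset Printing Implicit Defensive.

(* A finite simple graph is given by a symmetric irreflexive adjacency relation
   on a finType of vertices; a subgraph by a vertex set and an edge set, an edge
   being the set of its two ends. *)

Section Defs.

Variables (T : finType) (e : rel T).

Definition edges : {set {set T}} :=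
  [set f | [exists x, exists y, e x y && (f == [set x; y])]].

Definition degree (x : T) : nat := #|[set y | e x y]|.

Definition max_degree : nat := \max_(x : T) degree x.

Definition connected : Prop := forall x y : T, connect e x y.

Definition is_subgraph (H : {set T} * {set {set T}}) : Prop :=
  H.2 \subset edges /\ (forall f, f \in H.2 -> f \subset H.1).

(* A path graph: distinct vertices v_0, ..., v_k (k >= 0) with exactly the edges
   {v_i, v_(i+1)} for i < k. *)
Definition is_path (H : {set T} * {set {set T}}) : Prop :=
  exists (x : T) (p : seq T),
    [/\ uniq (x :: p),
        H.1 = [set:: x :: p] &
        H.2 = [set:: pairmap (fun a b => [set a; b]) x p]].

Definition path_decomposition (D : {set {set T} * {set {set T}}}) : Prop :=
  (forall H, H \in D -> is_subgraph H /\ is_path H) /\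
  (forall f, f \in edges -> exists! H, H \in D /\ f \in H.2).

End Defs.

(* Main.v *)
(** Call an end of a path of a decomposition a token at its end vertex; tokens and degrees have
    equal parities, and half the number of tokens is the number of paths.  The key tool [fan]
    adds missing edges at a vertex [x] without new paths, provided all neighbours of [x] hold
    tokens: cutting the paths at [x] turns this into a matching of neighbours with path segments,
    which is enlarged by augmenting paths.  It yields [n/2] paths for every graph in which the
    even vertices are independent.

    If [n] is odd, a pendant vertex is added, so [n] is even and the graph has a spanning subgraph
    [J] with all degrees odd; the existence of [J] (rather than connectedness) is the invariant
    of an induction on the number of edges.  For adjacent even vertices [u], [v] (of degree 2 or 4)
    with [uv] in [J], delete [u] and [v], lift a pair of further neighbours of each of them to an
    edge, and cover the remaining edges by one new path through [uv]; lifted edges are then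
    subdivided again.  The choice of the pairs depends on the common neighbours of [u] and [v];
    it keeps the [J]-neighbours of [u], and those of [v], connected.  The exceptions are
    near-cliques, where four vertices are deleted and two paths are added. *)

Require Import Defs.
From mathcomp Require Import all_boot.
From mathcomp Require Import zify.

Set Implicit Arguments.
Unset Strict Implicit.
Unset Printing Implicit Defensive.

(** The bound |V|/2 without rounding fails for components of odd order: a triangle needs two paths,
    a complete graph on five vertices three. A spanning subgraph with all degrees odd exists exactly
    when every component has even order, so this invariant excludes them and still lets deletions
    disconnect the graph. Taking [uv] in [J] leaves each of [u] and [v] an even number of further
    [J]-neighbours, so that the parities can be repaired on either side separately. The degree bound
    5 enters in four ways: even vertices with an edge have degree 2 or 4, so that the edge [uv], one
    edge of the new path and at most one lifted pair exhaust them; a common neighbour cannot see all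
    other neighbours of [u] and [v]; a near-clique has few edges to the rest; and for odd n not all
    degrees are 5, which leaves room for the pendant edge. *)

Ltac natlia := repeat match goal with |- context [nat_of_bool ?b] =>
  let n := fresh in generalize (nat_of_bool b) as n; intro n end; clear; lia.

(** * Path decompositions and their local modifications *)

Section Paths.
Variable T : finType.
Implicit Types (p q A B C P Q R : seq T) (D : seq (seq T)) (u v w x y z a b c d : T).

(* [ei a b] is the adjacency relation of the single edge [ab]; [ec p x y] counts the occurrences
   of the edge [xy] in [p], and [nend p x] those of [x] as an end of [p] (two if [p = [:: x]]). *)
Definition ei a b x y : bool := ((x == a) && (y == b)) || ((x == b) && (y == a)).

Fixpoint ec p x y : nat :=
  if p is a :: p' then (if p' is b :: _ then ei a b x y : nat else 0) + ec p' x y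
  else 0.

Definition nend p x : nat :=
  if p is a :: p' then (x == a) + (x == last a p') else 0.

Definition eD D x y : nat := \sum_(p <- D) ec p x y.
Definition tok D x : nat := \sum_(p <- D) nend p x.

Definition wf D : bool := all (fun p => uniq p && (0 < size p)) D.

(* Graphs are adjacency counts, so that intermediate (multi)graphs need no boolean encoding. *)
Definition dec (g : T -> T -> nat) D : Prop :=
  wf D /\ forall x y, eD D x y = g x y.

Definition deg (g : T -> T -> nat) x : nat := \sum_y g x y.

Lemma eiC a b x y : ei a b x y = ei b a x y.
Proof. by rewrite /ei orbC. Qed.
Lemma ei_sym a b x y : ei a b x y = ei a b y x.
Proof. by rewrite /ei orbC; congr (_ || _); rewrite andbC. Qed.
Lemma ei_self a b : ei a b a b.
Proof. by rewrite /ei !eqxx. Qed.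

Lemma ec_sym p x y : ec p x y = ec p y x.
Proof.
elim: p => //= a p ->; case: p => //= b p; by rewrite ei_sym.
Qed.

Lemma ec_cat p a q x y : ec (p ++ a :: q) x y = ec (rcons p a) x y + ec (a :: q) x y.
Proof.
elim: p => [|b p IH] //; rewrite cat_cons rcons_cons.
have -> : ec (b :: (p ++ a :: q)) x y =
  (if p is c :: _ then ei b c x y : nat else ei b a x y) + ec (p ++ a :: q) x y.
  by case: p {IH}.
have -> : ec (b :: rcons p a) x y =
  (if p is c :: _ then ei b c x y : nat else ei b a x y) + ec (rcons p a) x y.
  by case: p {IH}.
by rewrite IH addnA.
Qed.

Lemma ec_cons2 a b p x y : ec (a :: b :: p) x y = ei a b x y + ec (b :: p) x y.
Proof. by []. Qed.

Lemma ec_nil x y : ec [::] x y = 0.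
Proof. by []. Qed.

Lemma ec_seq1 a x y : ec [:: a] x y = 0.
Proof. by []. Qed.

Lemma ec_rcons2 p a b x y : ec (rcons (rcons p a) b) x y = ec (rcons p a) x y + ei a b x y.
Proof. by rewrite -cats1 cat_rcons ec_cat /= !addn0. Qed.

Lemma ec_rev p x y : ec (rev p) x y = ec p x y.
Proof.
elim: p => // a [|b p] IH //.
by rewrite !rev_cons ec_rcons2 -rev_cons IH /= eiC addnC.
Qed.

Lemma ec_notin p x y : x \notin p -> ec p x y = 0.
Proof.
elim: p => //= a p IH; rewrite inE negb_or => /andP[xa xp].
rewrite IH // addn0; case: p xp {IH} => // b p.
by rewrite inE negb_or /ei => /andP[xb _]; rewrite (negbTE xa) (negbTE xb).
Qed.

Lemma ec_gt0_in p x y : 0 < ec p x y -> (x \in p) && (y \in p).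
Proof.
move=> h; apply/andP; split; apply: contraTT h => h; first by rewrite ec_notin.
by rewrite ec_sym ec_notin.
Qed.

Lemma ec_diag p x : uniq p -> ec p x x = 0.
Proof.
elim: p => //= a p IH /andP[ap up]; rewrite IH // addn0; case: p ap {IH up} => // b p.
rewrite inE negb_or /ei => /andP[ab _].
by case: (eqVneq x a) => [->|_]; rewrite ?(negbTE ab) // andbF.
Qed.

Lemma nend_rev p x : nend (rev p) x = nend p x.
Proof.
case: p => // a p; case/lastP: p => [|p b] //.
by rewrite rev_cons rev_rcons /= last_rcons last_rcons addnC.
Qed.

#[global] Opaque ec.

Lemma sum_delta b (F : T -> nat) : \sum_y (y == b) * F y = F b.
Proof.
rewrite (bigD1 b) //= eqxx mul1n big1 ?addn0 // => y /negbTE ->; exact: mul0n.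
Qed.

Lemma sum_delta1 b : \sum_(y : T) (y == b : nat) = 1.
Proof.
by rewrite -[RHS](sum_delta b (fun=> 1)); apply: eq_bigr => y _; rewrite muln1.
Qed.

Lemma eiE a b x y : a != b -> ei a b x y = (x == a) * (y == b) + (x == b) * (y == a) :> nat.
Proof.
move=> ab; rewrite /ei; case: (eqVneq x a) => [->|_] /=; last by rewrite mulnb.
by rewrite (negbTE ab) mul0n mul1n addn0 orbF.
Qed.

Lemma sum_ei a b x : a != b -> \sum_y (ei a b x y : nat) = (x == a) + (x == b).
Proof.
move=> ab; under eq_bigr => y _ do rewrite eiE //.
by rewrite big_split /= -!big_distrr /= !sum_delta1 !muln1.
Qed.

(** An inner vertex has two edges of the path, an end has one, and the vertex of a one-vertex path
    none; counting the latter as two ends makes the identity uniform. It is the source of every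
    parity statement about tokens. *)
Lemma sum_ec p x : uniq p -> 0 < size p -> \sum_y ec p x y + nend p x = 2 * (x \in p).
Proof.
case: p => // a p u _; elim: p a u => [|b p IH] a u.
  by rewrite big1 /= ?inE => [|y _]; [lia | exact: ec_seq1].
move: (u); rewrite cons_uniq => /andP[abp ub].
have ab : a != b by apply: contraNneq abp => ->; rewrite mem_head.
have {IH} := IH _ ub.
have -> : \sum_y ec [:: a, b & p] x y = (x == a) + (x == b) + \sum_y ec (b :: p) x y.
  by rewrite -(sum_ei x ab) -big_split.
rewrite [x \in [:: a, b & p]]inE /nend [last a _]/=.
case: (eqVneq x a) => [->|_]; last by move: (\sum_y _) (_ \in _) => S m; lia.
by rewrite (negbTE abp) (negbTE ab); move: (\sum_y _) => S; lia.
Qed.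

Lemma sum_nend p : 0 < size p -> \sum_x nend p x = 2.
Proof. by case: p => // a p _; rewrite big_split /= !sum_delta1. Qed.

Lemma wf_cons p D : wf (p :: D) = [&& uniq p, 0 < size p & wf D].
Proof. by rewrite /wf /= andbA. Qed.

Lemma eD_cons p D x y : eD (p :: D) x y = ec p x y + eD D x y.
Proof. by rewrite /eD big_cons. Qed.
Lemma tok_cons p D x : tok (p :: D) x = nend p x + tok D x.
Proof. by rewrite /tok big_cons. Qed.

Lemma eD_sym D x y : eD D x y = eD D y x.
Proof. by apply: eq_bigr => p _; rewrite ec_sym. Qed.

Lemma sum_tok D : wf D -> \sum_x tok D x = 2 * size D.
Proof.
elim: D => [|p D IH]; first by rewrite big1 // => x _; rewrite /tok big_nil.
rewrite wf_cons => /and3P[_ sp /IH{}IH].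
under eq_bigr => x _ do rewrite tok_cons.
by rewrite big_split /= IH sum_nend //=; lia.
Qed.

Lemma dec_parity g D x : dec g D -> odd (tok D x) = odd (deg g x).
Proof.
case=> w E; rewrite /deg; under eq_bigr => y _ do rewrite -E.
elim: D w {E} => [|p D IH].
  by rewrite big1 /tok ?big_nil // => y _; rewrite /eD big_nil.
rewrite wf_cons => /and3P[up sp /IH{}IH]; rewrite tok_cons.
under eq_bigr => y _ do rewrite eD_cons.
by rewrite big_split /=; have := sum_ec x up sp; lia.
Qed.

Lemma dec_odd_tok g D x : dec g D -> odd (deg g x) -> 0 < tok D x.
Proof. by move=> /dec_parity <-; case: (tok D x). Qed.

(** Ensures that vertices isolated in [g] can be inserted into a path without repetition; one-vertex
    paths are excepted, as they may sit on isolated vertices. *)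
Lemma dec_nonisolated g D p x : dec g D -> p \in D -> 1 < size p -> x \in p ->
  exists y, 0 < g x y.
Proof.
move=> [w E] pD sp xp; apply/existsP; apply: contraT; rewrite negb_exists => /forallP z.
have {}z y : ec p x y = 0.
  have := z y; rewrite -E -eqn0Ngt => /eqP; rewrite /eD (big_rem p) //=; lia.
have /andP[up s0] := allP w _ pD.
have := sum_ec x up s0; rewrite xp big1 // add0n.
case: p up sp {pD xp z s0} => // a [|b p] // /andP[ap _] _ /=.
have [->|_] := eqVneq x a; last by case: (x == _).
by have [ab|//] := eqVneq a (last b p); rewrite ab mem_last in ap.
Qed.

Lemma tok_pick D a : wf D -> 0 < tok D a ->
  exists Q D', [/\ wf ((a :: Q) :: D'), size D = (size D').+1,
    forall x y, eD ((a :: Q) :: D') x y = eD D x y &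
    forall x, tok ((a :: Q) :: D') x = tok D x].
Proof.
move=> w t.
have [p pD np] : exists2 p, p \in D & 0 < nend p a.
  apply/hasP; apply: contraTT t => /hasPn h; rewrite -eqn0Ngt /tok big_seq big1 // => p /h.
  by rewrite -eqn0Ngt => /eqP.
have pm := perm_to_rem pD.
have : wf (p :: rem p D) by rewrite /wf -(perm_all _ pm).
have eE x y : eD (p :: rem p D) x y = eD D x y by rewrite /eD (perm_big _ pm).
have tE x : tok (p :: rem p D) x = tok D x by rewrite /tok (perm_big _ pm).
have sE : size D = (size (rem p D)).+1 by rewrite (perm_size pm).
rewrite wf_cons => /and3P[up sp wr].
case: p => // c p in up sp np pm pD eE tE sE wr *.
have [ca|ca] := eqVneq a c.
  by subst c; exists p, (rem (a :: p) D); split; rewrite // wf_cons up.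
case/lastP: p => [|p d] in up sp np pm pD eE tE sE wr *.
  by move: np; rewrite /= (negbTE ca).
have da : d = a by move: np; rewrite /= last_rcons (negbTE ca); case: eqVneq.
subst d; exists (rev (c :: p)), (rem (c :: rcons p a) D).
have -> : a :: rev (c :: p) = rev (c :: rcons p a) by rewrite -rcons_cons rev_rcons.
split=> //.
- by rewrite wf_cons rev_uniq up size_rev sp.
- by move=> x y; rewrite eD_cons ec_rev -eD_cons eE.
- by move=> x; rewrite tok_cons nend_rev -tok_cons tE.
Qed.

Lemma ec_split p a b : 0 < ec p a b ->
  exists A C, p = A ++ a :: b :: C \/ p = A ++ b :: a :: C.
Proof.
elim: p => [//|c p IH]; case: p IH => [//|d p] IH; rewrite ec_cons2.
have [E _|_] := boolP (ei c d a b); last first.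
  by move=> /IH[A [C [->|->]]]; exists (c :: A), C; [left|right].
by case/orP: E => /andP[/eqP -> /eqP ->]; exists [::], p; [left|right].
Qed.

Lemma edge_pick D a b : wf D -> 0 < eD D a b ->
  exists A C D', [/\ wf ((A ++ a :: b :: C) :: D'), size D = (size D').+1 &
    forall x y, eD ((A ++ a :: b :: C) :: D') x y = eD D x y].
Proof.
move=> w t.
have [p pD np] : exists2 p, p \in D & 0 < ec p a b.
  apply/hasP; apply: contraTT t => /hasPn h; rewrite -eqn0Ngt /eD big_seq big1 // => p /h.
  by rewrite -eqn0Ngt => /eqP.
have pm := perm_to_rem pD.
have : wf (p :: rem p D) by rewrite /wf -(perm_all _ pm).
have eE x y : eD (p :: rem p D) x y = eD D x y by rewrite /eD (perm_big _ pm).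
have sE : size D = (size (rem p D)).+1 by rewrite (perm_size pm).
rewrite wf_cons => /and3P[up sp wr].
have [A [C [pE|pE]]] := ec_split np; subst p.
  by exists A, C, (rem (A ++ a :: b :: C) D); split; rewrite ?wf_cons ?up ?sp.
exists (rev C), (rev A), (rem (A ++ b :: a :: C) D).
have -> : rev C ++ a :: b :: rev A = rev (A ++ b :: a :: C).
  by rewrite rev_cat !rev_cons -!cats1 -!catA.
split=> //.
- by rewrite wf_cons rev_uniq up size_rev sp.
- by move=> x y; rewrite eD_cons ec_rev -eD_cons eE.
Qed.

Lemma dec_add g g2 D P : dec g D -> uniq P -> 0 < size P ->
  (forall x y, g2 x y = g x y + ec P x y) -> dec g2 (P :: D).
Proof.
move=> [w E] uP sP h; split; first by rewrite wf_cons uP sP.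
by move=> x y; rewrite eD_cons E h addnC.
Qed.

(** The path through [ab] is rerouted along [a R b]; the vertices of [R] are isolated in [g], hence
    absent from it. The term [ei a b] on the left of the last hypothesis avoids a subtraction. *)
Lemma dec_sub g g2 D a b R : dec g D -> 0 < g a b -> uniq R ->
  (forall w, w \in R -> forall y, g w y = 0) ->
  (forall x y, g2 x y + ei a b x y = g x y + ec (a :: rcons R b) x y) ->
  exists2 D2, dec g2 D2 & size D2 = size D.
Proof.
move=> dD gab uR iso h; have [w E] := dD.
have : 0 < eD D a b by rewrite E.
case/(edge_pick w) => A [C [D' [w' sz eE]]].
have dD' : dec g ((A ++ a :: b :: C) :: D') by split=> // x y; rewrite eE.
move: (w'); rewrite wf_cons => /and3P[u1 s1 w1].
have nR z : z \in R -> z \notin A ++ a :: b :: C.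
  move=> zR; apply/negP => zp.
  have [] := dec_nonisolated dD' (mem_head _ _) _ zp; first by rewrite size_cat /= !addnS.
  by move=> y; rewrite iso.
have uP : uniq (A ++ a :: (R ++ b :: C)).
  have pe : perm_eq (A ++ a :: (R ++ b :: C)) (R ++ (A ++ a :: b :: C)).
    by apply/permP => z; rewrite !count_cat /= !count_cat /=; natlia.
  rewrite (perm_uniq pe) cat_uniq uR u1 andbT /=.
  by apply/hasPn => z zp; apply: contraL zp => /nR.
exists ((A ++ a :: (R ++ b :: C)) :: D'); last by rewrite sz.
split; first by rewrite wf_cons uP w1 size_cat /= addnS.
move=> x y; apply/eqP; rewrite -(eqn_add2r (ei a b x y)) h -E -eE !eD_cons; apply/eqP.
rewrite ec_cat (ec_cat A a (b :: C)) ec_cons2 -cat_cons (ec_cat (a :: R)) rcons_cons; natlia.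
Qed.

Lemma dec_ext g g2 D a R : dec g D -> 0 < tok D a -> uniq R -> a \notin R ->
  (forall w, w \in R -> forall y, g w y = 0) ->
  (forall x y, g2 x y = g x y + ec (a :: R) x y) ->
  exists2 D2, dec g2 D2 & size D2 = size D.
Proof.
move=> [w E] ta uR aR iso h; have [Q [D' [w' sz eE tE]]] := tok_pick w ta.
have dD' : dec g ((a :: Q) :: D') by split=> // x y; rewrite eE.
move: (w'); rewrite wf_cons => /and3P[u1 s1 w1].
have nR z : z \in R -> z \notin a :: Q.
  (* A one-vertex path is treated apart, since it may lie on an isolated vertex; here it is [a]
     itself, which is not in [R]. *)
  move=> zR; apply/negP => zp; case: Q => [|c Q] in w' sz eE tE dD' u1 s1 zp *.
    by move: zp; rewrite inE => /eqP za; rewrite za (negbTE aR) in zR.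
  have [] := dec_nonisolated dD' (mem_head _ _) _ zp => // y.
  by rewrite iso.
exists ((rev R ++ a :: Q) :: D'); last by rewrite sz.
split.
  rewrite wf_cons w1 size_cat /= addnS /= andbT cat_uniq rev_uniq uR u1 !andbT.
  by apply/hasPn => z zp /=; rewrite mem_rev; apply: contraL zp => /nR.
move=> x y; rewrite h -E -eE !eD_cons ec_cat -[rcons _ _]revK rev_rcons revK ec_rev; natlia.
Qed.

(* Let [Q] end at [z]. If [Q] misses [u] (or [v]) it can be prolonged by [zu] (or [zv]) and the
   other two sides of the triangle form a new path; if [Q = z A u B v C], then
   [A^-1 z u v C] and [a u B v z], with [a] the last vertex of [A], do the job. *)
Lemma dec_triangle g g2 D u v z : dec g D -> 0 < tok D z -> uniq [:: u; v; z] ->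
  g u z = 0 -> g v z = 0 ->
  (forall x y, g2 x y = g x y + ei u v x y + ei u z x y + ei v z x y) ->
  exists2 D2, dec g2 D2 & size D2 = (size D).+1.
Proof.
move=> [w E] tz uniq3 guz gvz h; have [Q [D' [w' sz eE tE]]] := tok_pick w tz.
move: (w'); rewrite wf_cons => /and3P[u1 s1 w1].
have [uv uz vz] : [/\ u != v, u != z & v != z].
  by move: uniq3; rewrite /= !inE negb_or; case/and3P => /andP[].
have [uQ|uQ] := boolP (u \in Q); last first.
  exists ((u :: z :: Q) :: [:: u; v; z] :: D'); last by rewrite sz.
  split; first by rewrite !wf_cons w1 uniq3 cons_uniq inE negb_or uz uQ u1.
  by move=> x y; rewrite h -E -eE !eD_cons !ec_cons2 ?ec_seq1; natlia.
have [vQ|vQ] := boolP (v \in Q); last first.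
  exists ((v :: z :: Q) :: [:: v; u; z] :: D'); last by rewrite sz.
  have u2 : uniq [:: v; u; z] by rewrite /= !inE negb_or eq_sym uv vz uz.
  split; first by rewrite !wf_cons w1 u2 cons_uniq inE negb_or vz vQ u1.
  by move=> x y; rewrite h -E -eE !eD_cons !ec_cons2 ?ec_seq1 (eiC v u); natlia.
have main a b A B C : [/\ a != b, a != z & b != z] -> Q = A ++ a :: B ++ b :: C ->
    g a z = 0 -> (forall x y, g2 x y = g x y + ei a b x y + ei a z x y + ei b z x y) ->
    exists2 D2, dec g2 D2 & size D2 = (size D).+1.
  move=> [ab az bz] QE gaz {}h; subst Q.
  (* [A] cannot be empty: the path would start with the edge [za], which [g] does not contain. *)
  case/lastP: A => [|A c] in w' eE tE u1 s1 uQ vQ *.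
    by have := eE z a; rewrite eD_cons ec_cons2 ei_self [eD D z a]eD_sym E gaz.
  exists ((rev (z :: rcons A c) ++ a :: b :: C) :: (c :: a :: B ++ [:: b; z]) :: D');
    last by rewrite sz.
  have eqc : (z :: rcons A c ++ a :: B ++ b :: C) = ((z :: rcons A c) ++ a :: B ++ b :: C) by [].
  split.
    move: (u1); rewrite eqc => u1'.
    have sub1 : uniq (rev (z :: rcons A c) ++ a :: b :: C).
      have pe : perm_eq ((z :: rcons A c) ++ a :: B ++ b :: C)
                        ((rev (z :: rcons A c) ++ a :: b :: C) ++ B).
        apply/permP => t; rewrite !count_cat /= !count_cat /= count_rev /= -!cats1 !count_cat /=.
        natlia.
      by move: u1'; rewrite (perm_uniq pe) cat_uniq => /andP[].
    have sub2 : uniq (c :: a :: B ++ [:: b; z]).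
      have pe : perm_eq ((z :: rcons A c) ++ a :: B ++ b :: C)
                        ((c :: a :: B ++ [:: b; z]) ++ (A ++ C)).
        apply/permP => t; rewrite !count_cat /= !count_cat /= -!cats1 !count_cat /=.
        natlia.
      by move: u1'; rewrite (perm_uniq pe) cat_uniq => /andP[].
    by rewrite !wf_cons sub1 sub2 w1 size_cat addnS.
  move=> x y; rewrite h -E -eE !eD_cons eqc !ec_cat.
  have e1 : ec (rcons (rev (z :: rcons A c)) a) x y = ei a z x y + ec (z :: rcons A c) x y.
    by rewrite -[rcons _ a]revK rev_rcons revK ec_rev ec_cons2.
  have e2 : ec (rcons (z :: rcons A c) a) x y = ec (z :: rcons A c) x y + ei c a x y.
    by rewrite -!rcons_cons ec_rcons2.
  rewrite e1 e2 !ec_cons2 -!cat_cons !ec_cat !ec_cons2 ?ec_seq1 (eiC b z); natlia.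
case/splitPr: Q / uQ vQ w' eE tE u1 s1 main => A B; rewrite mem_cat inE eq_sym (negbTE uv) /=.
case/orP=> vAB w' eE tE u1 s1 main.
  case/splitPr: A / vAB w' eE tE u1 s1 main => A1 A2 w' eE tE u1 s1 main.
  apply: (main v u A1 A2 B) => //; first by rewrite eq_sym uv vz uz.
    by rewrite -catA.
  by move=> x y; rewrite h (eiC v u); natlia.
case/splitPr: B / vAB w' eE tE u1 s1 main => B1 B2 w' eE tE u1 s1 main.
by apply: (main u v A B1 B2).
Qed.
End Paths.

(** * Adding edges at a vertex *)

Section Matching.
Variables (I T : finType) (sl : I -> T -> nat).
Implicit Types (M : I -> option T) (u y z : T) (i j : I).

Definition cov M y : bool := [exists i, M i == Some y].
(** Elements of [I] stand for path segments; [sl i y] counts the ends (slots) of segment [i] at [y],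
    and [M i] is the end by which segment [i] is attached to the centre. *)
Definition matching M : Prop :=
  (forall i y, M i = Some y -> 0 < sl i y) /\
  (forall i j y, M i = Some y -> M j = Some y -> i = j).
(** An arc from [y] to [z] means that [y] is an end of a segment now assigned to [z], so [y] could
    take it over if [z] found another one. *)
Definition altr M : rel T := [rel y z | [exists i, (0 < sl i y) && (M i == Some z)]].

Lemma covP M y : reflect (exists i, M i = Some y) (cov M y).
Proof. by apply: (iffP existsP) => -[i /eqP]; exists i => //; apply/eqP. Qed.

Lemma augment_path p M u j : matching M -> ~~ cov M u -> path (altr M) u p ->
  uniq (u :: p) -> 0 < sl j (last u p) -> M j = None ->
  exists M', [/\ matching M', forall i, M' i = None -> M i = None /\ i != j
               & forall y, cov M' y = cov M y || (y == u)].
Proof.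
elim/last_ind: p M j => [|p z IH] M j [M1 M2] cu.
  move=> _ _ /= sj Mj; exists (fun i => if i == j then Some u else M i); split.
  - split=> [i y|i k y].
      by case: eqP => [-> [<-]|_ /M1].
    case: (eqVneq i j) => [->|_]; case: (eqVneq k j) => [->|_] //; last exact: M2.
      by move=> [<-] Mk; case/negP: cu; apply/covP; exists k.
    by move=> /[swap] -[<-] Mk; case/negP: cu; apply/covP; exists i.
  - by move=> i; case: eqP.
  - move=> y; apply/covP/orP => [[i]|].
      case: eqP => [_ [->]|_ Mi]; [by right|by left; apply/covP; exists i].
    case=> [/covP[i Mi]|/eqP->]; last by exists j; rewrite eqxx.
    by exists i; case: eqP Mi => // ->; rewrite Mj.
rewrite rcons_path last_rcons -rcons_cons rcons_uniq => /andP[up /existsP[i /andP[sli /eqP Mi]]].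
move=> /andP[znp unp] sj Mj.
have ij : i != j by apply: contraPneq Mi => ->; rewrite Mj.
pose M' k := if k == j then Some z else if k == i then None else M k.
have mM' : matching M'.
  split=> [k y|k l y]; rewrite /M'.
    by case: eqP => [-> [<-]|_] //; case: eqP => // _ /M1.
  case: (eqVneq k j) => [->|kj]; case: (eqVneq l j) => [->|lj] //.
  - by case: (eqVneq l i) => // li [<-] Ml; rewrite (M2 _ _ _ Ml Mi) eqxx in li.
  - by case: (eqVneq k i) => // ki /[swap] -[<-] Mk; rewrite (M2 _ _ _ Mk Mi) eqxx in ki.
  - by case: (eqVneq k i) => // _; case: (eqVneq l i) => // _; apply: M2.
have cM' y : cov M' y = cov M y.
  apply/covP/covP => -[k]; rewrite /M'.
    case: eqP => [_ [<-]|_]; first by exists i.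
    by case: eqP => // _ Mk; exists k.
  case: (eqVneq y z) => [->|yz] Mk; first by exists j; rewrite eqxx.
  exists k; case: eqP Mk => [->|_]; first by rewrite Mj.
  by case: eqP => // ->; rewrite Mi => -[/eqP]; rewrite eq_sym (negbTE yz).
have pM' : path (altr M') u p.
  apply/(pathP u) => k kp; have /existsP[l /andP[s1 /eqP s2]] := pathP u up k kp.
  apply/existsP; exists l; rewrite s1 /M' /=.
  case: (eqVneq l j) s2 => [->|_]; first by rewrite Mj.
  case: (eqVneq l i) => [->|_ ->]; rewrite ?eqxx // Mi => -[ez].
  by case/negP: znp; rewrite ez inE mem_nth ?orbT.
have [||N [N1 N2 N3]] := IH M' i mM' _ pM' unp sli.
- by rewrite cM'.
- by rewrite /M' (negbTE ij) eqxx.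
exists N; split=> // [k /N2[]|y]; last by rewrite N3 cM'.
by rewrite /M'; case: eqP => // _; case: eqP.
Qed.

Hypothesis sl2 : forall i, \sum_y sl i y <= 2.

(* If no augmenting path starts in [U], every segment touching the set [Z] reachable from [U]
   is matched inside [Z], so the slots on [Z] number at most [2 #|Z :\: U|]. *)
Lemma augment M (U Hn : {set T}) : matching M -> (forall y, y \in U -> ~~ cov M y) ->
  (forall y, y \in U -> 0 < \sum_i sl i y) -> #|Hn| < #|U| ->
  (forall y, cov M y -> 2 <= \sum_i sl i y + (y \in Hn)) ->
  exists u M', [/\ u \in U, matching M', forall i, M' i = None -> M i = None
               & forall y, cov M' y = cov M y || (y == u)].
Proof.
move=> mM dU sU cHU s2; have [M1 M2] := mM.
pose Z := [set y | [exists u in U, connect (altr M) u y]].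
have [/existsP[[y j] /= /and3P[yZ sy /eqP Mj]]|] :=
  boolP [exists q : T * I, [&& q.1 \in Z, 0 < sl q.2 q.1 & M q.2 == None]].
  move: yZ; rewrite inE => /existsP[u /andP[uU /connectP[p pu yE]]].
  case/shortenP: pu yE => p' pp' up' _ yE; rewrite yE in sy.
  have [M' [m1 m2 m3]] := augment_path mM (dU _ uU) pp' up' sy Mj.
  by exists u, M'; split=> // i /m2[].
rewrite negb_exists => /forallP no.
have UZ : U \subset Z by apply/subsetP => u uU; rewrite inE; apply/existsP; exists u; rewrite uU connect0.
have cZ y : y \in Z -> y \notin U -> cov M y.
  rewrite inE => /existsP[u /andP[uU /connectP[p]]]; case/lastP: p => [_ -> /=|p z].
    by rewrite uU.
  rewrite rcons_path last_rcons => /andP[_ /existsP[i /andP[_ Mi]]] -> _.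
  by apply/existsP; exists i.
have inZ i y : y \in Z -> 0 < sl i y -> exists2 z, M i = Some z & z \in Z.
  move=> yZ sy; have := no (y, i); rewrite yZ sy /=.
  case Mi: (M i) => [z|] // _; exists z => //; move: yZ; rewrite !inE.
  case/existsP => u /andP[uU cu]; apply/existsP; exists u; rewrite uU.
  by apply: connect_trans cu (connect1 _); apply/existsP; exists i; rewrite sy Mi eqxx.
have up : \sum_(y in Z) \sum_i sl i y <= 2 * #|Z :\: U|.
  rewrite exchange_big /=.
  have b i : \sum_(y in Z) sl i y <= 2 * \sum_(z in Z :\: U) (M i == Some z).
    have [/existsP[y /andP[yZ sy]]|] := boolP [exists y, (y \in Z) && (0 < sl i y)].
      have [z Mi zZ] := inZ i y yZ sy.
      have zU : z \notin U by apply/negP => /dU/negP; apply; apply/covP; exists i.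
      have zD : z \in Z :\: U by rewrite in_setD zU.
      rewrite [X in _ <= 2 * X](bigD1 z) //= Mi eqxx; apply: leq_trans (_ : 2 <= _); last by lia.
      apply: leq_trans (sl2 i); rewrite [leqRHS](bigID [in Z]) /=; exact: leq_addr.
    rewrite negb_exists => /forallP n0; rewrite big1 // => y yZ.
    by have := n0 y; rewrite yZ /= -eqn0Ngt => /eqP.
  apply: (@leq_trans (\sum_i 2 * \sum_(z in Z :\: U) (M i == Some z))); first by apply: leq_sum => i _; apply: b.
  rewrite -big_distrr /= leq_mul2l /= exchange_big /= -sum1_card leq_sum // => z _.
  have [/existsP[i /eqP Mi]|] := boolP (cov M z).
    rewrite (bigD1 i) //= Mi eqxx big1 // => k ki.
    by case: eqP => // /M2 /(_ Mi) kE; rewrite kE eqxx in ki.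
  by rewrite negb_exists => /forallP n0; rewrite big1 // => i _; rewrite (negbTE (n0 i)).
(* Vertices of [U] have a slot each; those of [Z] outside [U] are covered and have two, with one
   possibly missing on [Hn]. As [Hn] is smaller than [U], this contradicts the bound [up]. *)
have : 2 * #|Z :\: U| + #|U| <= \sum_(y in Z) \sum_i sl i y + #|Hn|.
  rewrite (big_setID U) /= (setIidPr UZ).
  have l1 : #|U| <= \sum_(y in U) \sum_i sl i y by rewrite -sum1_card leq_sum.
  have l2 : 2 * #|Z :\: U| <= \sum_(y in Z :\: U) \sum_i sl i y + #|Hn|.
    apply: (@leq_trans (\sum_(y in Z :\: U) (\sum_i sl i y + (y \in Hn)))).
      rewrite -sum1_card big_distrr /= leq_sum // => y; rewrite inE => /andP[yU yZ].
      by apply: s2; apply: cZ.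
    rewrite big_split /= leq_add2l -sum1_card.
    rewrite [leqRHS]big_mkcond [leqLHS]big_mkcond leq_sum //= => y _.
    by case: (_ \in Hn); case: ifP.
  lia.
lia.
Qed.

(** Vertices added on the way may have a single slot and play the role of [Hn] in [augment]. The
    step from [k] to [k + 1] needs [k] to be less than the number of vertices of [W] still missing,
    which is what [uphalf] expresses. *)
Lemma augment_many M (W : {set T}) k : matching M -> (forall y, y \in W -> ~~ cov M y) ->
  (forall y, y \in W -> 0 < \sum_i sl i y) -> (forall y, cov M y -> 2 <= \sum_i sl i y) ->
  k <= uphalf #|W| ->
  exists M' (W' : {set T}), [/\ W' \subset W, #|W'| = k, matching M',
    forall i, M' i = None -> M i = None & forall y, cov M' y = cov M y || (y \in W')].
Proof.
move=> mM dW sW s2; elim: k => [_|k IH kW].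
  by exists M, set0; rewrite sub0set cards0; split=> // y; rewrite inE orbF.
have [M' [W' [W'W cW' mM' dM' cM']]] := IH (ltnW kW).
have cD : #|W :\: W'| = #|W| - k by rewrite cardsD (setIidPr W'W) cW'.
have [||||u [N [uD mN dN cN]]] := @augment M' (W :\: W') W' mM'.
- by move=> y; rewrite inE cM' negb_or => /andP[yW' /dW ->].
- by move=> y; rewrite inE => /andP[_ /sW].
- by rewrite cD cW'; lia.
- move=> y; rewrite cM' => /orP[/s2|yW']; first by move=> h; apply: leq_trans h (leq_addr _ _).
  by rewrite yW' addn1 ltnS sW // (subsetP W'W).
move: uD; rewrite inE => /andP[uW' uW]; exists N, (u |: W'); split=> //.
- by rewrite subUset sub1set uW.
- by rewrite cardsU1 uW' cW'.
- by move=> i /dN/dM'.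
- by move=> y; rewrite cN cM' !inE orbA orbAC.
Qed.
End Matching.

(** * Cutting paths at a vertex and joining them again *)

Section Fan.
Variable T : finType.
Variable x : T.
Implicit Types (p q s : seq T) (D : seq (seq T)) (y z : T) (m : bool -> option T).

(* The two parts of [p] around [x], both read from [x] outwards; a path missing [x] is its own
   first part. *)
Definition piece p (b : bool) : seq T :=
  if x \in p then (if b then drop (index x p).+1 p else rev (take (index x p) p))
  else (if b then [::] else p).

Definition turn (o : option T) s : seq T :=
  if o is Some y then (if ohead s == Some y then s else rev s) else s.

Definition rejoin m p : seq T :=
  if x \in p then rev (turn (m false) (piece p false)) ++ x :: turn (m true) (piece p true)
  else if m false is Some _ then x :: turn (m false) p else p.

Definition hits m y : nat := (m false == Some y) + (m true == Some y).

(** A path missing [x] may stay unattached, but a nonempty piece of a path through [x] must be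
    attached, as otherwise the path would fall apart. *)
Definition fits p m : Prop :=
  (forall b y, m b = Some y -> 0 < nend (piece p b) y) /\
  (x \in p -> forall b, piece p b != [::] -> m b != None).

Lemma nend_in s y : 0 < nend s y -> y \in s.
Proof.
case: s => //= a s; case: eqP => [-> _|_]; first exact: mem_head.
by case: eqP => // -> _; apply: mem_last.
Qed.

Lemma turn_perm o s : perm_eq (turn o s) s.
Proof. by rewrite /turn; case: o => // y; case: ifP => // _; rewrite perm_rev. Qed.

Lemma turn_ec o s y z : ec (turn o s) y z = ec s y z.
Proof. by rewrite /turn; case: o => // t; case: ifP => // _; rewrite ec_rev. Qed.

Lemma turn_head o s y : o = Some y -> 0 < nend s y -> exists s', turn o s = y :: s'.
Proof.
move=> ->; rewrite /turn; case: s => // a s /=.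
have [-> _|ne] := eqVneq y a; first by exists s; rewrite eqxx.
rewrite [_ == Some y](_ : _ = false); last by apply/eqP => -[ay]; rewrite ay eqxx in ne.
case: eqP => // -> _; case/lastP: s {ne} => [|s b]; first by exists [::].
by rewrite last_rcons -rcons_cons rev_rcons; eexists.
Qed.

Lemma turn_nend o s y : nend (turn o s) y = nend s y.
Proof. by rewrite /turn; case: o => // t; case: ifP => // _; rewrite nend_rev. Qed.

Lemma pieceE p : x \in p -> p = rev (piece p false) ++ x :: piece p true.
Proof.
by rewrite /piece => xp; rewrite xp revK -drop_index // cat_take_drop.
Qed.

Lemma piece_notin p b : uniq p -> x \notin piece p b.
Proof.
case: (boolP (x \in p)) => xp up; last by rewrite /piece (negbTE xp); case: b.
have := up; rewrite {1}(pieceE xp) cat_uniq /= mem_rev rev_uniq.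
by case/and3P => _ /norP[xf _] /andP[xt _]; case: b.
Qed.

Definition oei (o : option T) y z : nat := if o is Some t then ei x t y z else 0.

Lemma ec_turn o s y z : (forall t, o = Some t -> 0 < nend s t) ->
  (s != [::] -> o != None) -> ec (x :: turn o s) y z = ec s y z + oei o y z.
Proof.
move=> h1 h2; case: o h1 h2 => [t|] h1 h2; last first.
  by case: s h2 {h1} => [|a s h2] //=; have := h2 isT.
have [s' E] := turn_head erefl (h1 t erefl).
by rewrite -(turn_ec (Some t) s) E ec_cons2 /= addnC.
Qed.

Lemma nend_turn o s y : y != x -> (forall t, o = Some t -> 0 < nend s t) ->
  (s != [::] -> o != None) -> (y == last x (turn o s)) + (o == Some y) = nend s y.
Proof.
move=> yx h1 h2; case: o h1 h2 => [t|] h1 h2; last first.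
  by case: s h2 {h1} => [_|a s h2] /=; [rewrite (negbTE yx) | have := h2 isT].
have [s' E] := turn_head erefl (h1 t erefl).
rewrite -(turn_nend (Some t) s) E /= addnC; congr (nat_of_bool _ + _).
by apply/eqP/eqP => [[->]|->].
Qed.

Lemma nend_mid s s' y : nend (rev s ++ x :: s') y = (y == last x s) + (y == last x s').
Proof.
by case/lastP: s => [|s a] //; rewrite rev_rcons /= last_cat /= last_rcons.
Qed.

Lemma rejoin_ec m p y z : fits p m ->
  ec (rejoin m p) y z = ec (piece p false) y z + ec (piece p true) y z
                        + (oei (m false) y z + oei (m true) y z).
Proof.
move=> [f1 f2]; rewrite /rejoin; case: ifP => xp.
  rewrite ec_cat -[rcons _ _]revK rev_rcons revK ec_rev.
  rewrite !ec_turn; try by [apply: f1 | apply: f2]; natlia.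
have := f1 true; rewrite /piece xp; case: (m true) => [t /(_ t erefl) //|_].
have := f1 false; rewrite /piece xp; case E: (m false) => [t|] /= h; last by rewrite !addn0.
rewrite ec_nil !addn0; apply: (@ec_turn (Some t)) => // t' [<-]; exact: h.
Qed.

Lemma rejoin_nend m p y : y != x -> fits p m ->
  nend (rejoin m p) y + hits m y = nend (piece p false) y + nend (piece p true) y.
Proof.
move=> yx [f1 f2]; rewrite /rejoin /hits; case: ifP => xp.
  rewrite nend_mid -!(@nend_turn _ _ y yx (f1 _) (f2 xp _)); natlia.
have := f1 true; rewrite /piece xp; case: (m true) => [t /(_ t erefl) //|_].
have := f1 false; rewrite /piece xp; case E: (m false) => [t|] /= h; last by rewrite !addn0.
rewrite !addn0 (negbTE yx) add0n; apply: (@nend_turn (Some t)) => // t' [<-]; exact: h.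
Qed.

Lemma rejoin_wf m p : uniq p && (0 < size p) ->
  uniq (rejoin m p) && (0 < size (rejoin m p)).
Proof.
move=> /andP[up sp]; rewrite /rejoin; case: ifP => xp.
  have pe : perm_eq (rev (turn (m false) (piece p false)) ++ x :: turn (m true) (piece p true)) p.
    rewrite [in X in perm_eq _ X](pieceE xp); apply: perm_cat.
      by rewrite perm_rev (perm_trans (turn_perm _ _)) // perm_sym perm_rev.
    by rewrite perm_cons turn_perm.
  by rewrite (perm_uniq pe) (perm_size pe) up.
case E: (m false) => [t|]; last by rewrite up.
have pe := turn_perm (Some t) p.
by rewrite cons_uniq (perm_uniq pe) up (perm_mem pe) xp.
Qed.

(** The assignment induced by the decomposition itself, from which the augmentation starts. *)
Definition given p (b : bool) : option T := if x \in p then ohead (piece p b) else None.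

Lemma given_fits p : fits p (given p).
Proof.
split=> [b y|xp b]; rewrite /given; last by rewrite xp; case: (piece p b).
by case: ifP => // _; case: (piece p b) => //= a s [->]; rewrite eqxx.
Qed.

Lemma rejoin_given p : rejoin (given p) p = p.
Proof.
rewrite /rejoin /given; case xp: (x \in p) => //.
have h b : turn (ohead (piece p b)) (piece p b) = piece p b.
  by rewrite /turn; case: (piece p b) => //= a s; rewrite eqxx.
by rewrite !h -pieceE.
Qed.

(** All pieces are kept and only their attachments to [x] change, hence neither the number of paths
    nor the edges off [x] change. The augmentation decides which [k] vertices of [W] are reached; a
    prescribed edge is added by taking a singleton for [W]. The bound [g x y <= 1] makes the initial
    assignment a matching. *)
Lemma fan (g : T -> T -> nat) D (W : {set T}) k : dec g D -> (forall y, g x y <= 1) ->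
  x \notin W -> (forall y, y \in W -> g x y = 0 /\ 0 < tok D y) ->
  (forall y, 0 < g x y -> 0 < tok D y) -> k <= uphalf #|W| ->
  exists (W' : {set T}) D', [/\ W' \subset W, #|W'| = k,
    dec (fun y z => g y z + ((y == x) * (z \in W') + (z == x) * (y \in W'))) D',
    size D' = size D & forall y, tok D' y + (y \in W') = tok D y + (y == x) * k].
Proof.
move=> dD g1 xW hW hN kW; have [wD eE] := dD.
pose I := ('I_(size D) * bool)%type.
pose q (j : 'I_(size D)) := nth [::] D j.
have qP j : uniq (q j) && (0 < size (q j)) by apply: (allP wD); rewrite mem_nth.
have sumD (F : seq T -> nat) : \sum_(p <- D) F p = \sum_j F (q j).
  by rewrite (big_nth [::]) big_mkord.
have sumI (F : I -> nat) : \sum_i F i = \sum_j (F (j, false) + F (j, true)).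
  rewrite (eq_bigr (fun i => F (i.1, i.2))) => [|[]//].
  rewrite -(pair_bigA _ (fun j b => F (j, b))) /=.
  by apply: eq_bigr => j _; rewrite big_bool /= addnC.
pose sl (i : I) y := nend (piece (q i.1) i.2) y.
pose new (M : I -> option T) := [seq rejoin (fun b => M (j, b)) (q j) | j : 'I_(size D)].
have sumN M (F : seq T -> nat) :
    \sum_(p <- new M) F p = \sum_j F (rejoin (fun b => M (j, b)) (q j)).
  by rewrite big_map big_enum.
pose M0 (i : I) := given (q i.1) i.2.
have nM0 : new M0 = D.
  apply: (@eq_from_nth _ [::]) => [|i]; rewrite size_map -?enumT size_enum_ord // => iD.
  rewrite (nth_map (Ordinal iD)) ?size_enum_ord //; set j := nth _ _ i; have jE : j = i :> nat by exact: nth_enum_ord.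
  by transitivity (q j); [exact: rejoin_given | rewrite /q jE].
pose goodM M := forall j, fits (q j) (fun b => M (j, b)).
have good0 : goodM M0 by move=> j; apply: given_fits.
have ecM M y z : goodM M -> eD (new M) y z =
    \sum_j (ec (piece (q j) false) y z + ec (piece (q j) true) y z) + \sum_i oei (M i) y z.
  move=> gM; rewrite /eD sumN sumI -big_split /=; apply: eq_bigr => j _.
  by rewrite rejoin_ec.
have tokM M y : goodM M -> y != x ->
    tok (new M) y + \sum_i (M i == Some y) = \sum_i sl i y.
  move=> gM yx; rewrite /tok sumN !sumI -big_split /=; apply: eq_bigr => j _.
  by rewrite -(rejoin_nend yx (gM j)).
have oei_x M y : goodM M -> y != x -> \sum_i oei (M i) x y = \sum_i (M i == Some y).
  move=> gM yx; apply: eq_bigr => -[j b] _; case Mi: (M (j, b)) => [t|] //=.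
  have tx : t != x.
    have := piece_notin b (proj1 (andP (qP j))).
    by apply: contraNneq => <-; apply: nend_in; apply: (gM j).1.
  rewrite /ei eqxx (eq_sym x t) (negbTE tx) /= orbF; congr (nat_of_bool _).
  by apply/eqP/eqP => [->|[]].
have ec_piece j b y : ec (piece (q j) b) x y = 0.
  by apply: ec_notin; apply: piece_notin; case/andP: (qP j).
have e_x M y : goodM M -> y != x -> eD (new M) x y = \sum_i (M i == Some y).
  move=> gM yx; rewrite ecM // oei_x // big1 ?add0n // => j _.
  by rewrite !ec_piece.
have c0 y : y != x -> \sum_i (M0 i == Some y) = g x y by move=> yx; rewrite -e_x // nM0 eE.
have M0x i y : M0 i = Some y -> y != x.
  case: i => j b Mi; have := piece_notin b (proj1 (andP (qP j))).
  by apply: contraNneq => <-; apply: nend_in; apply: (good0 j).1.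
have mm0 : matching sl M0.
  split=> [[j b] y|i j y Mi Mj]; first exact: (good0 j).1.
  apply/eqP; apply: contraT => ij; have := g1 y; rewrite -c0 ?(M0x i) //.
  by rewrite (bigD1 i) //= (bigD1 j) 1?eq_sym //= Mi Mj eqxx.
have cov0 y : y != x -> cov M0 y = (0 < g x y).
  move=> yx; rewrite -c0 // lt0n sum_nat_eq0 negb_forall.
  by apply: eq_existsb => i; rewrite eqb0 negbK.
have sl2 i : \sum_y sl i y <= 2.
  rewrite /sl; case: (piece _ _) => [|a s]; first by rewrite big1.
  by rewrite sum_nend.
(* Each edge [xy] turns [y] into an end of a piece, so a neighbour of [x] that holds a token has the
   two slots required of a covered vertex. *)
have slE y : y != x -> \sum_i sl i y = tok D y + g x y.
  by move=> yx; rewrite -(tokM M0) // nM0 c0.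
have Wx y : y \in W -> y != x by apply: contraTneq => ->.
have [||||M [W' [W'W cW' mM dM cM]]] := @augment_many _ _ sl sl2 M0 W k mm0.
- by move=> y yW; rewrite cov0 ?Wx // (hW y yW).1.
- by move=> y yW; rewrite slE ?Wx // ltn_addr // (hW y yW).2.
- move=> y /[dup] /covP[i /M0x yx]; rewrite cov0 // => gy; rewrite slE //.
  by have := hN _ gy; move: (tok _ _) (g x y) gy; clear; lia.
- by [].
have gM : goodM M.
  move=> j; split=> [b y|xq b pb]; first exact: mM.1.
  apply/eqP => /dM; move: pb; rewrite /M0 /given xq.
  by case: (piece _ _).
have hitM y : \sum_i (M i == Some y) = cov M y.
  have [/covP[i Mi]|] := boolP (cov M y).
    rewrite (bigD1 i) //= Mi eqxx big1 // => j ji.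
    by case: eqP => // Mj; rewrite (mM.2 _ _ _ Mj Mi) eqxx in ji.
  by rewrite negb_exists => /forallP h; rewrite big1 // => i _; rewrite (negbTE (h i)).
have W'g y : y \in W' -> g x y = 0 by move=> /(subsetP W'W)/hW[].
have covE y : y != x -> cov M y = g x y + (y \in W') :> nat.
  move=> yx; rewrite cM cov0 //; have := g1 y; have := @W'g y.
  by case: (y \in W'); case: (g x y) => [|[]] // /(_ isT).
have newwf : wf (new M).
  by apply/allP => p /mapP[j _ ->]; apply: rejoin_wf.
have gxx : g x x = 0.
  by rewrite -eE /eD big_seq big1 // => p pD; rewrite ec_diag //; case/andP: (allP wD p pD).
have xW' : x \notin W' by apply: contra xW; apply: (subsetP W'W).
have tE y : y != x -> tok (new M) y + (y \in W') = tok D y.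
  move=> yx; apply/eqP; rewrite -(eqn_add2r (g x y)) -addnA [(y \in W') + _]addnC -covE //.
  by rewrite -hitM tokM // slE.
have szN : size (new M) = size D by rewrite size_map size_enum_ord.
exists W', (new M); split=> //.
- split=> // y z.
  have sx w : eD (new M) x w = g x w + (w \in W').
    have [->|wx] := eqVneq w x; last by rewrite e_x // hitM covE.
    rewrite gxx (negbTE xW') /eD big_seq big1 // => p /mapP[j _ ->].
    by apply: ec_diag; case/andP: (rejoin_wf (fun b => M (j, b)) (qP j)).
  have [->|yx] := eqVneq y x.
    by rewrite sx mul1n (negbTE xW') muln0 addn0.
  have [->|zx] := eqVneq z x.
    by rewrite eD_sym sx -!eE [eD D y x]eD_sym mul1n mul0n.
  rewrite !mul0n !addn0 -eE -[in RHS]nM0 !ecM //; congr (_ + _).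
  have z0 N : \sum_i oei (N i) y z = 0.
    rewrite big1 // => i _; case: (N i) => //= t.
    by rewrite /ei (negbTE yx) (negbTE zx) andbF.
  by rewrite !z0.
- move=> y; have [->|yx] := eqVneq y x; last by rewrite mul0n addn0 tE.
  rewrite (negbTE xW') mul1n addn0.
  (* [rejoin_nend] is silent on [x]; the tokens there are obtained from the total, twice the number
     of paths. *)
  have := sum_tok newwf; rewrite szN -(sum_tok wD) (bigD1 x) //= [in RHS](bigD1 x) //=.
  have -> : \sum_(i | i != x) tok D i = \sum_(i | i != x) tok (new M) i + k.
    rewrite -cW' -sum1_card; under eq_bigr => i ix do rewrite -tE //.
    rewrite big_split /=; congr (_ + _).
    rewrite [in RHS](big_mkcond (fun i => i \in W')) [in LHS]big_mkcond /=.
    apply: eq_bigr => i _; case: eqVneq => [->|_]; first by rewrite (negbTE xW').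
    by case: (_ \in _).
  by move: (\sum_(i | _) _) (tok _ _) (tok _ _) => S t1 t2; clear; lia.
Qed.
End Fan.

(** * Graphs with independent even vertices *)

Section Sparse.
Variable T : finType.
Implicit Types (e : rel T) (p : seq T) (D : seq (seq T)) (a b u v w x y z : T).

Definition nrel e x y : nat := e x y.

Lemma dec_eq (g g2 : T -> T -> nat) D : dec g D -> (forall x y, g2 x y = g x y) -> dec g2 D.
Proof. by move=> [w E] h; split=> // x y; rewrite h. Qed.

Lemma deg_gt0 e x y : e x y -> 0 < deg (nrel e) x.
Proof. by move=> exy; rewrite /deg (bigD1 y) //= /nrel exy. Qed.

Lemma deg_add (g g2 g3 : T -> T -> nat) x :
  (forall y, g x y = g2 x y + g3 x y) -> deg g x = deg g2 x + deg g3 x.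
Proof. by move=> h; rewrite /deg -big_split; apply: eq_bigr. Qed.

Lemma deg_star (W : {set T}) x a :
  deg (fun y z => (y == x) * (z \in W) + (z == x) * (y \in W)) a = (a == x) * #|W| + (a \in W).
Proof.
rewrite /deg big_split /= -big_distrr /= sum_delta -sum1_card [in RHS]big_mkcond.
by congr (_ * _ + _); apply: eq_bigr => y _; case: ifP.
Qed.

(** One-vertex paths carry two tokens each; without them isolated vertices hold none, and tokens can
    be counted over the support. *)
Lemma dec_filter g D : dec g D -> exists D', [/\ dec g D', size D' <= size D,
  forall x, tok D' x <= tok D x & forall x, (forall y, g x y = 0) -> tok D' x = 0].
Proof.
move=> [w E]; exists [seq p <- D | 1 < size p].
have eE x y : eD [seq p <- D | 1 < size p] x y = eD D x y.
  rewrite /eD big_filter [in RHS](bigID (fun p => 1 < size p)) /= [X in _ + X]big1 ?addn0 //.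
  by case=> [|a [|b p]].
have w' : wf [seq p <- D | 1 < size p].
  by apply/allP => p; rewrite mem_filter => /andP[_ /(allP w)].
split=> [||x|x gx].
- by split=> // x y; rewrite eE.
- by rewrite size_filter count_size.
- by rewrite /tok big_filter [leqRHS](bigID (fun p => 1 < size p)) leq_addr.
- rewrite /tok big_seq big1 // => p pD; apply/eqP; rewrite eqn0Ngt; apply/negP => /nend_in xp.
  have dD : dec g [seq p <- D | 1 < size p] by split=> // y z; rewrite eE.
  have sp : 1 < size p by move: pD; rewrite mem_filter => /andP[].
  by have [y] := dec_nonisolated dD pD sp xp; rewrite gx.
Qed.

Definition cut_star e x (W : {set T}) : rel T :=
  fun a b => e a b && ~~ (((a == x) && (b \in W)) || ((b == x) && (a \in W))).

Lemma cut_starE e x (W : {set T}) a b : symmetric e -> x \notin W -> (forall w, w \in W -> e x w) ->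
  nrel e a b = nrel (cut_star e x W) a b + ((a == x) * (b \in W) + (b == x) * (a \in W)).
Proof.
move=> es xW h; rewrite /nrel /cut_star.
have [->|ax] := eqVneq a x; have [->|bx] := eqVneq b x; rewrite ?(negbTE xW) ?andbF ?orbF ?andbT //=.
- by rewrite !addn0.
- by have := @h b; case: (b \in W) => [->|_] //=; rewrite andbT !addn0.
- by have := @h a; rewrite es; case: (a \in W) => [->|_] //=; rewrite andbT !addn0.
by rewrite !addn0.
Qed.

(** The edges from [x] to [R] are restored one at a time by fans centred at the vertices [w] of [R],
    each taking a token from [x] and giving one to [w]. The neighbours of [w] in the cut graph are
    odd with unchanged degree, hence hold tokens. One token of [x] is left at the end, which
    explains [#|R|.+1]. *)
Lemma star_back e x (W R : {set T}) D : symmetric e -> x \notin W ->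
  (forall w, w \in W -> e x w /\ (forall y, e w y -> odd (deg (nrel e) y))) ->
  (forall w, w \in W -> ~~ odd (deg (nrel e) w)) ->
  R \subset W -> dec (nrel (cut_star e x R)) D -> tok D x = #|R|.+1 ->
  (forall w, w \in R -> tok D w = 1) -> (forall y, y != x -> tok D y <= 2) ->
  exists D', [/\ dec (nrel e) D', size D' = size D & forall y, tok D' y <= 2].
Proof.
move=> es xW hW eW; move: {2}#|R| (erefl #|R|) => n; elim: n R D => [|n IH] R D cR RW dD tx tR t2.
  exists D; split=> // [|y]; last by have [->|/t2//] := eqVneq y x; rewrite tx cR.
  apply: dec_eq dD _ => a b; rewrite /nrel /cut_star (cards0_eq cR) !inE !andbF.
  by rewrite andbT.
have /card_gt0P[w wR] : 0 < #|R| by rewrite cR.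
have wW := subsetP RW _ wR; have [xw nw] := hW _ wW.
have wx : w != x by apply: contraTneq wW => ->.
have xR : x \notin R by apply: contra xW; apply: (subsetP RW).
have RE a b : nrel e a b = nrel (cut_star e x R) a b + ((a == x) * (b \in R) + (b == x) * (a \in R)).
  by apply: cut_starE => // y /(subsetP RW)/hW[].
have [|||||W1 [D1 [W1x cW1 dD1 sD1 tD1]]] := @fan _ w (nrel (cut_star e x R)) D [set x] 1 dD.
- by move=> y; rewrite /nrel; case: (cut_star _ _ _ _ _).
- by rewrite inE.
- move=> y; rewrite inE => /eqP ->; rewrite tx; split=> //.
  by rewrite /nrel /cut_star eqxx wR orbT andbF.
- move=> y h; have ewy : e w y by move: h; rewrite /nrel /cut_star; case: (e w y).
  have yx : y != x by apply: contraTneq h => ->; rewrite /nrel /cut_star eqxx wR orbT andbF.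
  have yo := nw _ ewy.
  have yR : y \notin R by apply: contraL yo => /(subsetP RW)/eW.
  apply: (dec_odd_tok dD); have := @deg_add (nrel e) _ (fun a b => (a == x) * (b \in R) + (b == x) * (a \in R)) y (RE y).
  by rewrite (deg_star R x) (negbTE yx) (negbTE yR) addn0 => <-.
- by rewrite cards1.
have W1E : W1 = [set x].
  by apply/eqP; rewrite eqEcard W1x cards1 cW1.
have [||||||D2 [d2 s2 t2']] := IH (R :\ w) D1.
- by rewrite (cardsD1 w) wR in cR; case: cR.
- by apply: subset_trans RW; apply: subD1set.
- apply: dec_eq dD1 _ => a b; rewrite W1E !inE.
  have := RE a b; rewrite /nrel /cut_star !inE.
  have [->|ax] := eqVneq a x; have [->|bx] := eqVneq b x;
    rewrite ?(negbTE xR) ?(eq_sym x w) ?(negbTE wx) ?andbF ?andbT ?orbF ?muln0 ?addn0 //=.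
  - by have [->|bw] := eqVneq b w; rewrite ?wR /= ?xw ?andbF ?andbT ?addn0 //=; case: (e x w).
  - by have [->|aw] := eqVneq a w; rewrite ?wR /= ?[e w x]es ?xw ?andbF ?andbT ?addn0 //=.
- have := tD1 x; rewrite W1E set11 tx eq_sym (negbTE wx) mul0n.
  by move: cR; rewrite (cardsD1 w) wR; lia.
- move=> y; rewrite !inE => /andP[yw yR]; have := tD1 y; rewrite W1E inE tR // (negbTE yw).
  have -> : (y == x) = false by apply: contraNF xR => /eqP <-.
  by rewrite !addn0.
- move=> y yx; have := tD1 y; rewrite W1E inE (negbTE yx) addn0 => ->.
  have [->|yw] := eqVneq y w; first by rewrite tR.
  by rewrite mul0n addn0 t2.
by exists D2; split=> //; rewrite s2.
Qed.

Definition esize e : nat := \sum_x deg (nrel e) x.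
Definition support e : {set T} := [set x | 0 < deg (nrel e) x].

Lemma esize_lt e e' x : (forall y, deg (nrel e') y <= deg (nrel e) y) ->
  deg (nrel e') x < deg (nrel e) x -> esize e' < esize e.
Proof.
move=> le lt; rewrite /esize (bigD1 x) //= [ltnRHS](bigD1 x) //=.
by rewrite -addSn leq_add // leq_sum.
Qed.

(** The bound of two tokens per vertex is the strengthening that carries the induction: with parity
    it gives exactly one token at odd vertices and none or two at even ones, so the tokens needed by
    the fans are known. *)
Theorem independent_even_dec e : symmetric e -> irreflexive e ->
  (forall x y, e x y -> odd (deg (nrel e) x) || odd (deg (nrel e) y)) ->
  exists D, [/\ dec (nrel e) D, forall x, tok D x <= 2 & 2 * size D <= #|support e|].
Proof.
move: {2}(esize e).+1 (ltnSn (esize e)) => n; elim: n e => // n IH e en es ei0 indep.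
have [/existsP[x /existsP[w0 /andP[exw0 ew0]]]|] :=
  boolP [exists x, exists w, e x w && ~~ odd (deg (nrel e) w)].
  have xo : odd (deg (nrel e) x) by have := indep _ _ exw0; rewrite (negbTE ew0) orbF.
  pose W := [set w | e x w && ~~ odd (deg (nrel e) w)].
  have xW : x \notin W by rewrite inE ei0.
  have w0W : w0 \in W by rewrite inE exw0.
  have eE a b := @cut_starE e x W a b es xW (fun w wW => proj1 (andP (eq_ind _ is_true wW _ (in_set _ w)))).
  pose e' := cut_star e x W.
  have dE a : deg (nrel e) a = deg (nrel e') a + ((a == x) * #|W| + (a \in W)).
    by rewrite -(deg_star W x a); apply: deg_add => y; apply: eE.
  have es' : symmetric e' by move=> a b; rewrite /e' /cut_star es orbC.
  have sW : 0 < #|W| by apply/card_gt0P; exists w0.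
  have lt' : esize e' < esize e.
    apply: (@esize_lt _ _ x) => [y|]; first by rewrite (dE y) leq_addr.
    by rewrite (dE x) eqxx; move: (#|W|) sW; clear; lia.
  have [|||D' [dD' t2 sz]] := IH e' _ es'.
  - by apply: leq_trans lt' _; rewrite -ltnS.
  - by move=> a; rewrite /e' /cut_star ei0.
  (* Cutting makes the vertices of [W] odd; [x] may become even, but all its remaining neighbours
     are odd. *)
  - move=> a b /andP[eab nW].
    have nodd c : c \in W -> odd (deg (nrel e') c).
      move=> /[dup] cW; rewrite inE => /andP[_].
      have cx : c != x by apply: contraTneq cW => ->.
      by rewrite (dE c) (negbTE cx) cW mul0n addn1 /= negbK.
    have out c : c != x -> c \notin W -> odd (deg (nrel e) c) -> odd (deg (nrel e') c).
      by move=> cx cW; rewrite (dE c) (negbTE cx) (negbTE cW) addn0.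
    have [/nodd->//|aW] := boolP (a \in W); have [/nodd->|bW] := boolP (b \in W); first by rewrite orbT.
    have [ax|ax] := eqVneq a x.
      subst a; have bx : b != x by apply: contraTneq eab => ->; rewrite ei0.
      by rewrite (out b) ?orbT //; move: bW; rewrite inE eab negbK.
    have [bx|bx] := eqVneq b x.
      by subst b; rewrite (out a) //; move: aW; rewrite inE es eab negbK.
    by case/orP: (indep _ _ eab) => h; rewrite (out _ _ _ h) ?orbT.
  have par : odd (tok D' x) = odd #|W|.+1.
    rewrite (dec_parity x dD'); move: xo; rewrite (dE x) eqxx (negbTE xW).
    by move: (deg _ _) (#|W|); clear; lia.
  (* The fan at [x] restores [k] edges and leaves [tok D' x + k] tokens there; [star_back] asks for
     one more than the [#|W| - k] edges still missing, and this determines [k]. *)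
  pose k := (#|W| + 1 - tok D' x) %/ 2.
  have tx2 := t2 x.
  have kE : 2 * k + tok D' x = #|W| + 1.
    by move: par sW tx2; rewrite /k; move: (tok _ _) (#|W|); clear; lia.
  have W1 w : w \in W -> tok D' w = 1.
    move=> wW; have := t2 w; have := dec_parity w dD'.
    have wx : w != x by apply: contraTneq wW => ->.
    have := wW; rewrite inE => /andP[_]; rewrite (dE w) (negbTE wx) wW mul0n addn1 /= negbK => ->.
    by case: (tok _ _) => [|[|[]]].
  have [||||W' [D1 [W'W cW' dD1 sD1 tD1]]] := @fan _ x (nrel e') D' W k dD' _ xW.
  - by move=> y; rewrite /nrel; case: (e' _ _).
  - by move=> w wW; rewrite W1 // /nrel /e' /cut_star eqxx wW andbF.
  - move=> y; rewrite /nrel /e' /cut_star => h.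
    have [yW|yW] := boolP (y \in W); first by rewrite W1.
    have exy : e x y by case: (e x y) h.
    have yx : y != x by apply: contraTneq exy => ->; rewrite ei0.
    apply: (dec_odd_tok dD'); have := yW; rewrite inE exy negbK.
    by rewrite (dE y) (negbTE yx) (negbTE yW) addn0.
  - by move: kE; move: (tok _ _) (#|W|); clear; lia.
  have cR : #|W :\: W'| = #|W| - k by rewrite cardsD (setIidPr W'W) cW'.
  have xW' : x \notin W' by apply: contra xW; apply: (subsetP W'W).
  have [|||||||D2 [dD2 s2 t2']] := @star_back e x W (W :\: W') D1 es xW.
  - move=> w; rewrite inE => /andP[exw ow]; split=> // y ewy.
    by have := indep _ _ ewy; rewrite (negbTE ow).
  - by move=> w; rewrite inE => /andP[].
  - exact: subsetDl.
  - apply: dec_eq dD1 _ => a b; rewrite /nrel /e' /cut_star !inE.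
    have [->|ax] := eqVneq a x; have [->|bx] := eqVneq b x;
      rewrite ?(negbTE xW) ?(negbTE xW') ?ei0 ?andbF ?orbF ?andbT ?muln0 ?addn0 //=.
    - have [bW'|bW'] := boolP (b \in W'); last by rewrite /= addn0.
      by have := subsetP W'W _ bW'; rewrite inE => /andP[-> ->].
    - have [aW'|aW'] := boolP (a \in W'); last by rewrite /= addn0.
      by have := subsetP W'W _ aW'; rewrite inE [e a x]es => /andP[-> ->].
  - have := tD1 x; rewrite (negbTE xW') eqxx mul1n addn0 => ->; rewrite cR.
    by move: kE tx2 sW; move: (tok _ _) (#|W|); clear; lia.
  - move=> w; rewrite inE => /andP[wW' wW]; have := tD1 w; rewrite (negbTE wW') addn0 W1 //.
    by have -> : (w == x) = false by apply: contraNF xW => /eqP <-.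
  - move=> y yx; have := tD1 y; rewrite (negbTE yx) mul0n addn0 => h.
    by apply: leq_trans (t2 y); rewrite -h leq_addr.
  exists D2; split=> //; rewrite s2 sD1; apply: leq_trans sz _; apply: subset_leq_card.
  by apply/subsetP => y; rewrite !inE (dE y); apply: ltn_addr.
(* From here on every vertex with an edge is odd; one edge [xy] is deleted, which makes its two ends
   even. *)
rewrite negb_exists => /forallP allodd.
have ao x y : e x y -> odd (deg (nrel e) y).
  by move=> exy; have := allodd x; rewrite negb_exists => /forallP/(_ y); rewrite exy negbK.
have [/existsP[x /existsP[y exy]]|] := boolP [exists x, exists y, e x y]; last first.
  rewrite negb_exists => /forallP none; exists [::]; split=> //.
    split=> // x y; rewrite /eD big_nil /nrel.
    by have := none x; rewrite negb_exists => /forallP/(_ y)/negbTE ->.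
  by move=> x; rewrite /tok big_nil.
have xy : x != y by apply: contraTneq exy => ->; rewrite ei0.
pose e' : rel T := fun a b => e a b && ~~ ei x y a b.
have eE a b : nrel e a b = nrel e' a b + ei x y a b.
  rewrite /nrel /e'; have [|_] := boolP (ei x y a b); last by rewrite andbT addn0.
  by case/orP=> /andP[/eqP-> /eqP->]; rewrite ?[e y x]es exy.
have dE a : deg (nrel e) a = deg (nrel e') a + ((a == x) + (a == y)).
  by rewrite -(sum_ei a xy); apply: (@deg_add _ _ (fun a b => ei x y a b)) => b; apply: eE.
have es' : symmetric e' by move=> a b; rewrite /e' es ei_sym.
have lt' : esize e' < esize e.
  apply: (@esize_lt _ _ x) => [z|]; first by rewrite (dE z) leq_addr.
  by rewrite (dE x) eqxx; clear; lia.
have [|||D0 [d0 t0 sz0]] := IH e' _ es'.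
- by apply: leq_trans lt' _; rewrite -ltnS.
- by move=> a; rewrite /e' ei0.
- move=> a b /andP[eab nxy]; have ha := dE a; have hb := dE b.
  have oa : odd (deg (nrel e) a) by apply: (ao b); rewrite es.
  have ob := ao _ _ eab.
  rewrite ha in oa; rewrite hb in ob; move: oa ob nxy; rewrite /ei.
  have ab : a != b by apply: contraTneq eab => ->; rewrite ei0.
  have [ax|ax] := eqVneq a x; have [ay|ay] := eqVneq a y; have [bx|bx] := eqVneq b x;
    have [bY|bY] := eqVneq b y; move=> h1 h2 h3;
    first [by subst; rewrite eqxx in xy | by subst; rewrite eqxx in ab
       |by move: h1 h2 h3; move: (deg _ _) (deg _ _); clear; lia].
have [D' [dD' sD' tD' iso]] := dec_filter d0.
have t2 z : tok D' z <= 2 by apply: leq_trans (tD' z) (t0 z).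
have sz : 2 * size D' <= #|support e|.
  apply: leq_trans (_ : 2 * size D0 <= _); first by rewrite leq_mul2l.
  apply: leq_trans sz0 _; apply: subset_leq_card.
  by apply/subsetP => z; rewrite !inE (dE z); apply: ltn_addr.
have xS : x \in support e by rewrite inE (deg_gt0 exy).
have yS : y \in support e by rewrite inE (@deg_gt0 _ _ x) // es.
have odd1 z : z != x -> z != y -> z \in support e -> tok D' z = 1.
  rewrite inE => zx zy zS; have [c ezc] : exists c, e z c.
    apply/existsP; apply: contraTT zS; rewrite negb_exists => /forallP h.
    by rewrite -eqn0Ngt /deg big1 // => c _; rewrite /nrel (negbTE (h c)).
  have : odd (deg (nrel e) z) by apply: (ao c); rewrite es.
  rewrite (dE z) (negbTE zx) (negbTE zy) addn0 -(dec_parity z dD').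
  by have := t2 z; case: (tok _ _) => [|[|[]]].
have out z : z \notin support e -> tok D' z = 0.
  rewrite inE -eqn0Ngt => /eqP z0; apply: iso => c; have := dE z; rewrite z0.
  rewrite /deg (bigD1 c) //=; move: (nrel e' z c) => q; clear; lia.
(* Vertices of the support other than [x] and [y] hold exactly one token, those outside none. The
   support is that of [e], which contains [x] and [y] even if they are isolated in [e']. *)
have total : 2 * size D' + 2 = tok D' x + tok D' y + #|support e|.
  rewrite -(sum_tok (proj1 dD')) (bigD1 x) //= (bigD1 y) 1?eq_sym //=.
  have -> : \sum_(i | (i != x) && (i != y)) tok D' i = #|support e| - 2.
    rewrite (cardsD1 x) xS (cardsD1 y) !inE eq_sym xy (@deg_gt0 _ _ x) 1?es //=.
    rewrite -sum1_card [in RHS]big_mkcond [in LHS]big_mkcond /= add1n add1n subn2 /=.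
    apply: eq_bigr => z _; rewrite !inE.
    have [zx|zx] := eqVneq z x; have [zy|zy] := eqVneq z y => //=.
    case: ifP => zS; first by rewrite odd1 // inE.
    by rewrite out // inE zS.
  have : 2 <= #|support e|.
    by rewrite (cardsD1 x) xS (cardsD1 y) !inE eq_sym xy (@deg_gt0 _ _ x) 1?es.
  by move: (tok _ x) (tok _ y) (#|_|); clear; lia.
have ev z : (z == x) || (z == y) -> ~~ odd (tok D' z).
  move=> h; rewrite (dec_parity z dD').
  have : odd (deg (nrel e) z) by case/orP: h => /eqP->; [apply: (ao y); rewrite es | apply: ao exy].
  rewrite (dE z); have [zx|zx] := eqVneq z x; have [zy|zy] := eqVneq z y => //=.
  - by rewrite -zx zy eqxx in xy.
  - by move: (deg _ _); clear; lia.
  - by move: (deg _ _); clear; lia.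
  by rewrite (negbTE zx) (negbTE zy) in h.
have finish u v : ei x y u v -> tok D' u = 0 -> tok D' v = 2 ->
    exists D, [/\ dec (nrel e) D, forall x, tok D x <= 2 & 2 * size D <= #|support e|].
  move=> uvE tu tv.
  have uv : u != v.
    by apply: contraTneq uvE => ->; rewrite /ei; apply/negP => /orP[] /andP[/eqP h1 /eqP h2];
      rewrite -h1 -h2 eqxx in xy.
  have eiuv a b : ei u v a b = ei x y a b.
    by case/orP: uvE => /andP[/eqP-> /eqP->] //; rewrite eiC.
  have [|||||W' [D2 [W'W cW' dD2 sD2 tD2]]] := @fan _ u (nrel e') D' [set v] 1 dD' _ _.
  - by move=> z; rewrite /nrel; case: (e' _ _).
  - by rewrite inE.
  - by move=> z; rewrite inE => /eqP->; rewrite tv /nrel /e' uvE andbF.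
  - move=> z; rewrite /nrel => h.
    have [euz nuz] : e u z /\ ~~ ei x y u z by move: h; rewrite /e'; case: (e u z) => //; case: ei.
    have zu : z != u by apply: contraTneq euz => ->; rewrite ei0.
    have zv : z != v by apply: contraNneq nuz => ->.
    have [zx zy] : z != x /\ z != y.
      by case/orP: uvE => /andP[/eqP uE /eqP vE]; rewrite -uE -vE.
    by rewrite odd1 // inE (@deg_gt0 _ _ u) // es.
  - by rewrite cards1.
  have W'E : W' = [set v] by apply/eqP; rewrite eqEcard W'W cards1 cW'.
  exists D2; split=> [|z|]; last by rewrite sD2.
    apply: dec_eq dD2 _ => a b; rewrite eE -eiuv W'E !inE eiE //; congr (_ + (_ + _)).
    exact: mulnC.
  have := tD2 z; rewrite W'E inE; have [->|zu] := eqVneq z u.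
    by rewrite (negbTE uv) tu addn0 => ->.
  by rewrite mul0n addn0 => h; apply: leq_trans (t2 z); rewrite -h leq_addr.
have ex : ~~ odd (tok D' x) by apply: ev; rewrite eqxx.
have ey : ~~ odd (tok D' y) by apply: ev; rewrite eqxx orbT.
have cases n2 : n2 <= 2 -> ~~ odd n2 -> n2 = 0 \/ n2 = 2.
  by case: n2 => [|[|[|]]] //; [left|right].
(* With no tokens at [x] and [y] the total leaves room for the path [xy]. With 0 and 2, the fan at
   the vertex without tokens uses a token of the other. Two tokens at both would exceed the bound on
   the number of paths. *)
have [tx|tx] := cases _ (t2 x) ex; have [ty|ty] := cases _ (t2 y) ey.
- exists ([:: x; y] :: D'); split=> [|z|].
  + apply: (dec_add dD') => //=; first by rewrite inE xy.
    by move=> a b; rewrite eE ec_cons2 ec_seq1 addn0.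
  + rewrite tok_cons /=; have [->|zx] := eqVneq z x; first by rewrite tx; case: (_ == _).
    by have [->|zy] := eqVneq z y; [rewrite ty|apply: t2].
  + by move: total; rewrite tx ty /=; move: (size D') (#|_|); clear; lia.
- by apply: (finish x y); rewrite ?ei_self.
- by apply: (finish y x); rewrite // eiC ei_self.
by move: total sz; rewrite tx ty; move: (size D') (#|_|); clear; lia.
Qed.
End Sparse.

(** * Joins *)

Section Joins.
Variable T : finType.
Implicit Types (e J : rel T) (p : seq T) (D : seq (seq T)) (a b c d u v w x y z : T).
Implicit Types (B : T -> bool) (V S : {set T}).

(* A [B]-join: [B] is exactly the set of vertices of odd degree of [J]. *)
Definition join_of e B J : Prop :=
  [/\ symmetric J, subrel J e & forall x, odd (deg (nrel J) x) = B x].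
Definition fill e B : Prop := exists J, join_of e B J.

Lemma fill_ext e B B' : fill e B -> (forall x, B' x = B x) -> fill e B'.
Proof. by move=> [J [s i o]] h; exists J; split=> // x; rewrite h. Qed.

Lemma odd_deg_xor J J' x :
  odd (deg (nrel (fun x y => J x y (+) J' x y)) x) = odd (deg (nrel J) x) (+) odd (deg (nrel J') x).
Proof.
have : deg (nrel (fun x y => J x y (+) J' x y)) x + 2 * deg (nrel (fun x y => J x y && J' x y)) x
       = deg (nrel J) x + deg (nrel J') x.
  rewrite /deg big_distrr /= -!big_split /=; apply: eq_bigr => y _; rewrite /nrel.
  by case: (J x y); case: (J' x y).
by move: (deg _ _) (deg _ _) (deg _ _) (deg _ _); clear; lia.
Qed.

Lemma fill_xor e B B' : fill e B -> fill e B' -> fill e (fun x => B x (+) B' x).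
Proof.
move=> [J [s i o]] [J' [s' i' o']]; exists (fun x y => J x y (+) J' x y); split.
- by move=> x y; rewrite s s'.
- by move=> x y; case Jxy: (J x y) => /= h; [apply: i | apply: i'].
- by move=> x; rewrite odd_deg_xor o o'.
Qed.

Lemma fill0 e : fill e (fun=> false).
Proof. by exists (fun _ _ => false); split=> // x; rewrite /deg big1. Qed.

Lemma fill_edge e a b : symmetric e -> irreflexive e -> e a b ->
  fill e (fun x => (x == a) (+) (x == b)).
Proof.
move=> es ir eab; have ab : a != b by apply: contraTneq eab => ->; rewrite ir.
exists (ei a b); split=> [x y|x y|x]; first exact: ei_sym.
  by case/orP=> /andP[/eqP-> /eqP->] //; rewrite es.
by rewrite /deg sum_ei // oddD !oddb.
Qed.

Lemma fill_connect_pair e a b : symmetric e -> irreflexive e -> connect e a b ->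
  fill e (fun x => (x == a) (+) (x == b)).
Proof.
move=> es ir /connectP[p]; elim: p a => [|c p IH] a /=.
  by move=> _ ->; apply: fill_ext (fill0 e) _ => x; rewrite addbb.
case/andP=> eac pp bE.
apply: fill_ext (fill_xor (fill_edge es ir eac) (IH _ pp bE)) _ => x.
by rewrite -addbA (addbA (x == c)) addbb.
Qed.

Lemma deg_set0 J x : (forall y, ~~ J x y) -> deg (nrel J) x = 0.
Proof. by move=> h; rewrite /deg big1 // => y _; rewrite /nrel (negbTE (h y)). Qed.

(** Each edge of [J], which need not lie in [e], is replaced by a path of [e] between its ends, and
    the paths are added modulo 2; only the parities of [J] survive. *)
Lemma fill_connect e J : symmetric e -> irreflexive e -> symmetric J -> irreflexive J ->
  (forall x y, J x y -> connect e x y) -> fill e (fun x => odd (deg (nrel J) x)).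
Proof.
move=> es ei0; move: {2}(esize J).+1 (ltnSn (esize J)) => n; elim: n J => // n IH J Jn Js J0 h.
have [/existsP[a /existsP[b Jab]]|] := boolP [exists a, exists b, J a b]; last first.
  rewrite negb_exists => /forallP none; apply: fill_ext (fill0 e) _ => x.
  by rewrite deg_set0 // => y; have := none x; rewrite negb_exists => /forallP.
have ab : a != b by apply: contraTneq Jab => ->; rewrite J0.
pose J' : rel T := fun x y => J x y && ~~ ei a b x y.
have JE x y : nrel J x y = nrel J' x y + ei a b x y.
  rewrite /nrel /J'; have [|_] := boolP (ei a b x y); last by rewrite andbT addn0.
  by case/orP=> /andP[/eqP-> /eqP->]; rewrite ?[J b a]Js Jab.
have dE x : deg (nrel J) x = deg (nrel J') x + ((x == a) + (x == b)).
  by rewrite -(sum_ei x ab); apply: (@deg_add _ _ _ (fun x y => ei a b x y)) => y; apply: JE.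
have f1 : fill e (fun x => odd (deg (nrel J') x)).
  apply: IH => [|x y|x|x y /andP[/h]//]; last 2 first.
  - by rewrite /J' Js ei_sym.
  - by rewrite /J' J0.
  rewrite -ltnS; apply: leq_trans Jn; rewrite ltnS; apply: (@esize_lt _ _ _ a) => [x|].
    by rewrite dE leq_addr.
  by rewrite dE eqxx; clear; lia.
apply: fill_ext (fill_xor f1 (fill_connect_pair es ei0 (h _ _ Jab))) _ => x.
by rewrite dE !oddD !oddb.
Qed.

Lemma handshake J (s : seq T) : symmetric J -> irreflexive J ->
  ~~ odd (\sum_(x <- s) \sum_(y <- s) J x y).
Proof.
move=> Js J0; elim: s => [|a s IH]; first by rewrite big_nil.
rewrite big_cons big_cons J0 add0n.
under [X in _ + X]eq_bigr => x _ do rewrite big_cons Js.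
by rewrite big_split /= addnA oddD addnn odd_double.
Qed.

(* Joining completely the [J]-neighbours outside [S] that see [S] an odd number of times
   repairs the parities destroyed by the deletion of [S]. *)
Lemma fill_delete e e' V S J : join_of e (fun x => x \in V) J -> irreflexive e ->
  symmetric e' -> irreflexive e' -> S \subset V -> ~~ odd #|S| ->
  (forall x y, J x y -> x \notin S -> y \notin S -> connect e' x y) ->
  (forall s t x y, s \in S -> t \in S -> J s x -> J t y -> x \notin S -> y \notin S ->
    connect e' x y) ->
  fill e' (fun x => (x \in V) && (x \notin S)).
Proof.
move=> [Js Je Jo] ei0 e's e'0 SV oS c1 c2.
have J0 x : J x x = false by apply/negP => /Je; rewrite ei0.
pose n x := \sum_(s in S) J s x.
pose B := [set x | (x \notin S) && odd (n x)].
have nP x : odd (n x) -> exists2 s, s \in S & J s x.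
  move=> on; have [/existsP[s /andP[]]|] := boolP [exists s in S, J s x]; first by exists s.
  rewrite negb_exists => /forallP no; rewrite /n big1 // in on => s sS.
  by have := no s; rewrite sS /= => /negbTE ->.
(* Degrees in [J] are odd on [S] and [S] has even size, so an even number of edges of [J] leave [S].
   Hence [B] has even size, and the complete graph [K] on it has odd degree at each of its
   vertices. *)
have oB : ~~ odd #|B|.
  have e1 : \sum_(s in S) deg (nrel J) s = \sum_(s in S) \sum_(y in S) J s y + \sum_(y in ~: S) n y.
    rewrite [X in _ + X]exchange_big -big_split /=; apply: eq_bigr => s _.
    rewrite /deg (bigID [in S]) /=; congr (_ + _).
    by apply: eq_bigl => y; rewrite inE.
  have h1 : ~~ odd (\sum_(s in S) \sum_(y in S) J s y).
    have := handshake (enum S) Js J0; rewrite big_enum /=.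
    by under eq_bigr => x _ do rewrite big_enum.
  have par (F : T -> nat) (A : {set T}) : odd (\sum_(y in A) F y) = odd (\sum_(y in A) odd (F y)).
    elim/big_rec2: _ => // y q r _ h; rewrite !oddD h oddb; done.
  have h2 : odd (\sum_(s in S) deg (nrel J) s) = odd #|S|.
    rewrite par -sum1_card; congr odd; apply: eq_bigr => s sS.
    by rewrite Jo (subsetP SV).
  have h3 : odd (\sum_(y in ~: S) n y) = odd #|B|.
    rewrite par -sum1_card; congr odd; rewrite big_mkcond [RHS]big_mkcond.
    by apply: eq_bigr => y _; rewrite !inE; case: (y \in S) => //=; case: odd.
  by move: h2; rewrite e1 oddD h3 (negbTE h1) (negbTE oS) /= => ->.
pose H : rel T := fun x y => [&& J x y, x \notin S & y \notin S].
pose K : rel T := fun x y => [&& x \in B, y \in B & x != y].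
have K0 x : K x x = false by rewrite /K eqxx !andbF.
have Ks : symmetric K by move=> x y; rewrite /K andbCA eq_sym.
have Hs : symmetric H by move=> x y; rewrite /H Js [(x \notin S) && _]andbC.
have oK x : odd (deg (nrel K) x) = (x \in B).
  have [xB|xB] := boolP (x \in B); last first.
    by rewrite deg_set0 // => y; rewrite /K (negbTE xB).
  have : #|B| = deg (nrel K) x + 1.
    rewrite -(sum_delta1 x) -big_split /= -sum1_card big_mkcond; apply: eq_bigr => y _.
    rewrite /nrel /K xB eq_sym; have [->|_] := eqVneq y x; first by rewrite xB andbF.
    by rewrite andbT addn0; case: ifP.
  by move: oB => /[swap] ->; rewrite addn1 /= negbK.
have oH x : x \notin S -> odd (deg (nrel H) x) = (x \in V) (+) odd (n x).
  move=> xS; rewrite -Jo; have -> : deg (nrel J) x = deg (nrel H) x + n x.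
    rewrite /n big_mkcond -big_split; apply: eq_bigr => y _; rewrite /nrel /H xS Js /=.
    by case: (y \in S); rewrite ?andbF ?addn0 ?andbT.
  by rewrite oddD -addbA addbb addbF.
apply: fill_ext (fill_connect e's e'0 (J := fun x y => H x y (+) K x y) _ _ _) _.
- by move=> x y; rewrite Hs Ks.
- by move=> x; rewrite /H J0 K0.
- move=> x y; case Hxy: (H x y) => /=; first by move=> _; case/and3P: Hxy; apply: c1.
  rewrite /K !inE => /and3P[/andP[xS /nP[s sS Jsx]] /andP[yS /nP[t tS Jty]] _].
  exact: (c2 s t).
move=> x; rewrite odd_deg_xor oK inE.
have [xS|xS] := boolP (x \in S); last by rewrite oH //= andbT -addbA addbb addbF.
by rewrite andbF deg_set0 // => y; rewrite /H xS andbF.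
Qed.

(** As [uv] is in [J], each of [u] and [v] has an even number of further [J]-neighbours. The
    complete graph on either of these two sets changes the parity exactly at its members, so each
    set only has to be connected within itself, unlike in [fill_delete]. *)
Lemma fill_delete_edge e e' V u v J : join_of e (fun x => x \in V) J -> irreflexive e ->
  symmetric e' -> irreflexive e' -> J u v -> u \in V -> v \in V ->
  (forall x y, J x y -> x \notin [:: u; v] -> y \notin [:: u; v] -> connect e' x y) ->
  (forall x y, J u x -> J u y -> x != v -> y != v -> connect e' x y) ->
  (forall x y, J v x -> J v y -> x != u -> y != u -> connect e' x y) ->
  fill e' (fun x => x \in V :\: [set u; v]).
Proof.
move=> [Js Je Jo] ei0 e's e'0 Juv uV vV c1 cu cv.
have J0 x : J x x = false by apply/negP => /Je; rewrite ei0.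
have uv : u != v by apply: contraTneq Juv => ->; rewrite J0.
pose H : rel T := fun x y => [&& J x y, x \notin [:: u; v] & y \notin [:: u; v]].
pose K w w' : rel T := fun x y => [&& J w x, J w y, x != w', y != w' & x != y].
have K0 w w' x : K w w' x x = false by rewrite /K eqxx !andbF.
have Ks w w' : symmetric (K w w').
  move=> x y; rewrite /K (eq_sym x y).
  by case: (J w x); case: (J w y); case: (x == w'); case: (y == w').
have Hs : symmetric H by move=> x y; rewrite /H Js [(x \notin _) && _]andbC.
have oK w w' x : J w w' -> w \in V -> odd (deg (nrel (K w w')) x) = J w x && (x != w').
  move=> Jww wV; have [/andP[Jwx xw']|] := boolP (J w x && (x != w')); last first.
    by move=> h; rewrite deg_set0 // => y; apply: contra h => /and5P[-> _ ->].
  have := Jo w; rewrite wV.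
  have -> : deg (nrel J) w = deg (nrel (K w w')) x + (1 + 1).
    rewrite -{1}(sum_delta1 x) -(sum_delta1 w') -!big_split /=; apply: eq_bigr => y _.
    rewrite /nrel /K Jwx xw' /= (eq_sym x y).
    have [->|yx] := eqVneq y x; first by rewrite Jwx (negbTE xw') !andbF.
    have [->|yw] := eqVneq y w'; first by rewrite Jww.
    by rewrite !andbT !addn0.
  by rewrite oddD addbF.
apply: fill_ext (fill_connect e's e'0 (J := fun x y => H x y (+) K u v x y (+) K v u x y) _ _ _) _.
- by move=> x y; rewrite Hs Ks (Ks v).
- by move=> x; rewrite /H J0 !K0.
- move=> x y; case Hxy: (H x y).
    by move=> _; case/and3P: Hxy => /c1.
  case Kxy: (K u v x y) => /=; first by case/and5P: Kxy => ux uy xv yv _ _; apply: cu.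
  by case/and5P => vx vy xu yu _; apply: cv.
move=> x; rewrite !odd_deg_xor oK // oK // 1?Js // in_setD in_set2.
have [->|xu] := eqVneq x u.
  rewrite J0 /= andbF deg_set0 // => y; by rewrite /H mem_head andbF.
have [->|xv] := eqVneq x v.
  rewrite J0 /= andbF deg_set0 // => y; by rewrite /H !inE eqxx orbT andbF.
rewrite /= !andbT -Jo.
have -> : deg (nrel J) x = deg (nrel H) x + (J x u + J x v).
  rewrite -[X in _ + (X + _)](sum_delta u (fun y => J x y)).
  rewrite -[X in _ + (_ + X)](sum_delta v (fun y => J x y)) -!big_split /=.
  apply: eq_bigr => y _; rewrite /nrel /H !inE (negbTE xu) (negbTE xv) /=.
  have [->|yu] := eqVneq y u; first by rewrite (negbTE uv) andbF mul1n mul0n addn0.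
  have [->|yv] := eqVneq y v; first by rewrite andbF mul1n mul0n.
  by rewrite andbT !mul0n !addn0.
rewrite !oddD !oddb !(Js x).
by case: odd; case: (J u x); case: (J v x).
Qed.

Lemma join_deg e B J u s : join_of e B J -> uniq s -> (forall y, e u y = (y \in s)) ->
  deg (nrel J) u = \sum_(y <- s) J u y.
Proof.
move=> [_ Je _] us h; rewrite /deg (bigID [in s]) /= [X in _ + X]big1 => [|y ys].
  by rewrite addn0 -big_uniq.
by rewrite /nrel; case Juy: (J u y) => //; have := Je _ _ Juy; rewrite h (negbTE ys).
Qed.
End Joins.

(** * Deleting two adjacent even vertices *)

Section Core.
Variable T : finType.
Implicit Types (p : seq T) (D : seq (seq T)) (a b c d u v w x y z : T).

(** Deletions keep the type [T] and shrink [V], which serves as the vertex set both for the join and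
    for the number of paths. *)
Definition joinable (e : rel T) (V : {set T}) : Prop :=
  [/\ symmetric e, irreflexive e, forall x, deg (nrel e) x <= 5,
      forall x y, e x y -> x \in V & fill e (fun x => x \in V)].
Definition halvable (e : rel T) (V : {set T}) : Prop :=
  exists2 D, dec (nrel e) D & 2 * size D <= #|V|.

Variables (e : rel T) (V : {set T}).
Hypothesis clsV : joinable e V.
Hypothesis IH : forall (e' : rel T) (V' : {set T}), esize e' < esize e -> joinable e' V' -> halvable e' V'.

Let es : symmetric e. Proof. by case: clsV. Qed.
Let e0 : irreflexive e. Proof. by case: clsV. Qed.
Let edg x : deg (nrel e) x <= 5. Proof. by case: clsV. Qed.
Let eV x y : e x y -> x \in V. Proof. by case: clsV => _ _ _ h _; apply: h. Qed.

(* An edge [uv] lies in a [V]-join, or else [e - uv] still has one; in [e - uv] a path ends at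
   the (now odd) vertex [u], and it can be prolonged by [uv] unless it closes a cycle through
   [uv], along which the join can be switched. *)
Lemma join_through u v : e u v -> ~~ odd (deg (nrel e) u) ->
  halvable e V \/ exists2 J, join_of e (fun x => x \in V) J & J u v.
Proof.
move=> euv du; have [_ _ _ _ [J [Js Je Jo]]] := clsV.
have [Juv|nJ] := boolP (J u v); first by right; exists J.
have uv : u != v by apply: contraTneq euv => ->; rewrite e0.
pose e' : rel T := fun x y => e x y && ~~ ei u v x y.
have eE x y : nrel e x y = nrel e' x y + ei u v x y.
  rewrite /nrel /e'; have [|_] := boolP (ei u v x y); last by rewrite andbT addn0.
  by case/orP=> /andP[/eqP-> /eqP->]; rewrite ?[e v u]es euv.
have dE x : deg (nrel e) x = deg (nrel e') x + ((x == u) + (x == v)).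
  by rewrite -(sum_ei x uv); apply: (@deg_add _ _ _ (fun x y => ei u v x y)) => y; apply: eE.
have es' : symmetric e' by move=> a b; rewrite /e' es ei_sym.
have e0' : irreflexive e' by move=> a; rewrite /e' e0.
have c' : joinable e' V.
  split=> // [x|x y /andP[/eV]//|]; first by apply: leq_trans (edg x); rewrite dE leq_addr.
  exists J; split=> // x y Jxy; rewrite /e' Je //=; apply: contra nJ.
  by case/orP=> /andP[/eqP <- /eqP <-] //; rewrite Js.
have lt' : esize e' < esize e.
  apply: (@esize_lt _ _ _ u) => [z|]; first by rewrite (dE z) leq_addr.
  by rewrite (dE u) eqxx; clear; lia.
have [D dD sz] := IH lt' c'.
have tu : 0 < tok D u.
  apply: (dec_odd_tok dD); move: du; rewrite (dE u) eqxx (negbTE uv) /= addn0 addn1 /=.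
  by rewrite negbK.
have [Q [D' [w' sz' eE' tE']]] := tok_pick (proj1 dD) tu.
have [vQ|vQ] := boolP (v \in u :: Q); last first.
  left; exists ((v :: u :: Q) :: D'); last by rewrite /= -sz'.
  split; first by move: w'; rewrite !wf_cons => /and3P[u1 _ ->]; rewrite cons_uniq vQ u1.
  by move=> x y; rewrite eD_cons ec_cons2 -addnA -eD_cons eE' (proj2 dD) eE addnC eiC.
right; have path_conn : forall p a, (forall x y, 0 < ec (a :: p) x y -> e' x y) ->
    {in a :: p, forall x, connect e' a x}.
  elim=> [|b p IHp] a h x; first by rewrite inE => /eqP->.
  rewrite inE => /predU1P[->|xp]; first exact: connect0.
  apply: connect_trans (connect1 _) (IHp _ _ _ xp).
    by apply: h; rewrite ec_cons2 ei_self.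
  move=> y z yz; by apply: h; rewrite ec_cons2 addn_gt0 yz orbT.
have cuv : connect e' u v.
  apply: path_conn vQ => x y h; have := proj2 dD x y; rewrite -eE' eD_cons /nrel.
  by case: (e' x y) => // /eqP; rewrite addn_eq0 => /andP[/eqP h0]; rewrite h0 in h.
have fV' : fill e' (fun x => x \in V) by case: c'.
have [J' [Js' Je' Jo']] := fill_xor fV' (fill_connect_pair es' e0' cuv).
have nJ' : ~~ J' u v by apply/negP => /Je'; rewrite /e' ei_self andbF.
exists (fun x y => J' x y (+) ei u v x y); last by rewrite ei_self (negbTE nJ').
split=> [x y|x y|x].
- by rewrite Js' ei_sym.
- case J'xy: (J' x y) => /=; first by move=> _; case/andP: (Je' _ _ J'xy).
  by case/orP=> /andP[/eqP-> /eqP->]; rewrite // es.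
- rewrite odd_deg_xor Jo' /deg sum_ei // oddD !oddb.
  by case: (x == u); case: (x == v); case: (x \in V).
Qed.

(** * Deleting the ends of a join edge and lifting a pair at each *)

Section Delete.
Variables (u v : T) (J : rel T).
Hypotheses (HJ : join_of e (fun x => x \in V) J) (Juv : J u v).

Let Js : symmetric J. Proof. by case: HJ. Qed.
Let Je : subrel J e. Proof. by case: HJ. Qed.
Let euv : e u v. Proof. exact: Je. Qed.
Let uv : u != v. Proof. by apply: contraTneq euv => ->; rewrite e0. Qed.

Variables (su sv : option (T * T)) (k : rel T).

Definition oedge (o : option (T * T)) x y : bool := if o is Some (a, b) then ei a b x y else false.
Definition opath w (o : option (T * T)) x y : nat :=
  if o is Some (a, b) then ei a w x y + ei w b x y else 0.
Definition oin (o : option (T * T)) y : bool := if o is Some (a, b) then (y == a) || (y == b) else false.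
Definition liftable w (o : option (T * T)) : Prop :=
  if o is Some (a, b) then [/\ a != b, a \notin [:: u; v], b \notin [:: u; v], e w a & e w b]
  else True.

(** [k] holds the edges set aside for the new path; [su] and [sv] are the lifted pairs, [None] at a
    vertex of degree 2. *)
Definition kept : rel T :=
  fun x y => [&& e x y, x \notin [:: u; v], y \notin [:: u; v] & ~~ k x y].
Definition lifted : rel T := fun x y => [|| kept x y, oedge su x y | oedge sv x y].

Hypotheses (ks : symmetric k) (lsu : liftable u su) (lsv : liftable v sv).
Hypotheses (dsu : forall x y, oedge su x y -> ~~ kept x y)
           (dsv : forall x y, oedge sv x y -> ~~ kept x y)
           (dsuv : forall x y, oedge su x y -> ~~ oedge sv x y).

(* The conditions that make the join survive, phrased for any equivalence relation [L]
   containing the reduced graph. *)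
Definition linked : Prop := forall L : T -> T -> Prop,
  (forall x, L x x) -> (forall x y, L x y -> L y x) -> (forall x y z, L x y -> L y z -> L x z) ->
  (forall x y, kept x y -> L x y) -> (forall x y, oedge su x y -> L x y) ->
  (forall x y, oedge sv x y -> L x y) ->
  [/\ forall x y, e x y -> x \notin [:: u; v] -> y \notin [:: u; v] -> k x y -> L x y,
      forall x y, J u x -> J u y -> x != v -> y != v -> L x y &
      forall x y, J v x -> J v y -> x != u -> y != u -> L x y].

Hypothesis Hlink : linked.

Lemma oedge_sym o x y : oedge o x y = oedge o y x.
Proof. by case: o => //= -[a b]; apply: ei_sym. Qed.

Let kept_sym : symmetric kept.
Proof. by move=> x y; rewrite /kept es ks; congr (_ && _); rewrite andbCA. Qed.

Let out_uv w (o : option (T * T)) x y : liftable w o -> oedge o x y -> x \notin [:: u; v].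
Proof.
by case: o => //= -[a b] [_ a1 b1 _ _] /orP[] /andP[/eqP-> _].
Qed.

Let deg_oedge w (o : option (T * T)) x : liftable w o -> deg (fun x y => oedge o x y) x <= e x w.
Proof.
case: o => [[a b]|]; last by rewrite /deg big1.
move=> /= [ab _ _ ea eb]; rewrite /deg sum_ei //.
have [->|_] := eqVneq x a; first by rewrite (negbTE ab) es ea.
by have [->|_] := eqVneq x b; first by rewrite es eb.
Qed.

(** A lifted edge replaces, at each of its ends, an edge to [u] or [v]; so degrees do not grow and
    the induction hypothesis applies. The lifted edges are then subdivided by [u] and [v] in turn,
    each being isolated at that moment. The two deleted vertices pay for one more path, hence the
    [+ 2]. *)
Lemma lift_core : exists2 D, dec (fun x y => kept x y + opath u su x y + opath v sv x y) D &
  2 * size D + 2 <= #|V|.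
Proof.
have liftE x y : nrel lifted x y = kept x y + oedge su x y + oedge sv x y.
  rewrite /nrel /lifted; have := @dsu x y; have := @dsv x y; have := @dsuv x y.
  case: (kept x y); case: (oedge su x y); case: (oedge sv x y) => //= h1 h2 h3;
    first [by have := h1 isT | by have := h2 isT | by have := h3 isT].
have ls : symmetric lifted by move=> x y; rewrite /lifted kept_sym !(oedge_sym _ x).
have l0 : irreflexive lifted.
  move=> x; rewrite /lifted /kept e0 /=.
  have h w o : liftable w o -> oedge o x x = false.
    case: o => //= -[a b] [ab _ _ _ _]; rewrite /ei andbC orbb.
    by apply/negP => /andP[/eqP xb /eqP xa]; rewrite -xb -xa eqxx in ab.
  by rewrite (h u) // (h v).
have dle x : deg (nrel lifted) x + (x \in [:: u; v]) * deg (nrel e) x <= deg (nrel e) x.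
  have [xuv|xuv] := boolP (x \in [:: u; v]).
    rewrite deg_set0 ?mul1n // => y; rewrite /lifted /kept xuv andbF /=.
    apply/norP; split; apply/negP => /out_uv h.
      by have := h u lsu; rewrite xuv.
    by have := h v lsv; rewrite xuv.
  rewrite mul0n addn0.
  have -> : deg (nrel lifted) x = deg (fun x y => kept x y) x + deg (fun x y => oedge su x y) x
                                  + deg (fun x y => oedge sv x y) x.
    by rewrite /deg -!big_split; apply: eq_bigr => y _; apply: liftE.
  apply: (@leq_trans (deg (fun x y => kept x y) x + e x u + e x v)).
    by rewrite leq_add ?leq_add ?deg_oedge.
  rewrite -{1}(sum_delta u (fun y => e x y)) -(sum_delta v (fun y => e x y)) -!big_split /=.
  apply: leq_sum => y _; rewrite /nrel /kept !inE.
  have [->|yu] := eqVneq y u; first by rewrite (negbTE uv) !andbF mul1n mul0n addn0.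
  have [->|yv] := eqVneq y v; first by rewrite !andbF mul1n mul0n.
  by rewrite !mul0n !addn0; case: (e x y) => //; apply: leq_b1.
have uV : u \in V by apply: eV euv.
have vV : v \in V by apply: (@eV v u); rewrite es.
have cV : #|V :\: [set u; v]| + 2 = #|V|.
  rewrite -(cardsID [set u; v] V) addnC; congr (_ + _).
  have -> : V :&: [set u; v] = [set u; v].
    by apply/setIidPr/subsetP => x; rewrite !inE => /orP[] /eqP->.
  by rewrite cards2 uv.
have cl : joinable lifted (V :\: [set u; v]).
  split=> // [x|x y|].
  - by apply: leq_trans (edg x); apply: leq_trans (dle x); rewrite leq_addr.
  - rewrite !inE => /or3P[/and4P[exy xuv _ _]|xy|xy].
    + by rewrite (eV exy) andbT; move: xuv; rewrite !inE.
    + have := out_uv lsu xy; rewrite !inE => -> /=.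
      case: su lsu xy => //= -[a b] [_ _ _ ea eb] /orP[] /andP[/eqP-> _].
        by apply: (@eV a u); rewrite es.
      by apply: (@eV b u); rewrite es.
    + have := out_uv lsv xy; rewrite !inE => -> /=.
      case: sv lsv xy => //= -[a b] [_ _ _ ea eb] /orP[] /andP[/eqP-> _].
        by apply: (@eV a v); rewrite es.
      by apply: (@eV b v); rewrite es.
  - have cs : connect_sym lifted by apply: sym_connect_sym.
    have [||||||l1 l2 l3] := @Hlink (connect lifted).
    + exact: connect0.
    + by move=> x y; rewrite cs.
    + by move=> x y z; apply: connect_trans.
    + by move=> x y h; apply: connect1; rewrite /lifted h.
    + by move=> x y h; apply: connect1; rewrite /lifted h orbT.
    + by move=> x y h; apply: connect1; rewrite /lifted h !orbT.
    apply: (fill_delete_edge HJ) => // x y Jxy xuv yuv.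
    have [kxy|kxy] := boolP (k x y); first by apply: l1 => //; apply: Je.
    by apply: connect1; rewrite /lifted /kept Je //= xuv yuv kxy.
have lt : esize lifted < esize e.
  apply: (@esize_lt _ _ _ u) => [y|].
    by apply: leq_trans (dle y); rewrite leq_addr.
  apply: leq_trans (dle u); rewrite mem_head mul1n -addn1 leq_add2l.
  exact: deg_gt0 euv.
have [D dD sz] := IH lt cl.
have step w (o : option (T * T)) (f : T -> T -> nat) D1 :
    liftable w o -> dec (fun x y => f x y + oedge o x y) D1 ->
    (forall y, f w y = 0) -> w \in [:: u; v] ->
    exists2 D2, dec (fun x y => f x y + opath w o x y) D2 & size D2 = size D1.
  case: o => [[a b]|] /=; last by move=> _ d1 _ _; exists D1.
  move=> [ab auv buv ea eb] d1 fw wuv.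
  have wa : w != a by apply: contraNneq auv => <-.
  have wb : w != b by apply: contraNneq buv => <-.
  apply: (@dec_sub _ _ _ D1 a b [:: w] d1) => //.
  - by rewrite ei_self addn1.
  - move=> z; rewrite inE => /eqP-> y; rewrite fw /ei (negbTE wa) (negbTE wb) //.
  - by move=> x y; rewrite /= !ec_cons2 ec_seq1; natlia.
have dD1 : dec (fun x y => kept x y + oedge sv x y + oedge su x y) D.
  by apply: dec_eq dD _ => x y; rewrite liftE; natlia.
have [||D1 d1 s1] := step u su _ D lsu dD1.
- move=> y; rewrite /kept mem_head andbF /=.
  by case E: (oedge sv u y) => //; have := out_uv lsv E; rewrite mem_head.
- exact: mem_head.
have d1' : dec (fun x y => (kept x y + opath u su x y) + oedge sv x y) D1.
  by apply: dec_eq d1 _ => x y; natlia.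
have [||D2 d2 s2] := step v sv _ D1 lsv d1'.
- move=> y; rewrite /kept !inE eqxx orbT andbF /=.
  case: su lsu => //= -[a b] [_ a1 b1 _ _]; rewrite /ei.
  have va : v == a = false by apply: contraNF a1 => /eqP <-; rewrite !inE eqxx orbT.
  have vb : v == b = false by apply: contraNF b1 => /eqP <-; rewrite !inE eqxx orbT.
  have vu : v == u = false by rewrite eq_sym (negbTE uv).
  by rewrite va vb vu.
- by rewrite !inE eqxx orbT.
exists D2 => //; rewrite s2 s1 -cV leq_add2r; exact: sz.
Qed.
End Delete.
End Core.

(** * The path or triangle that covers the remaining edges *)

Section Reductions.
Variable T : finType.
Implicit Types (p A B P : seq T) (D : seq (seq T)) (a b c d r s u v w x y z : T).
Variables (e : rel T) (V : {set T}).
Hypothesis clsV : joinable e V.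
Hypothesis IH : forall (e' : rel T) (V' : {set T}), esize e' < esize e -> joinable e' V' -> halvable e' V'.

Let es : symmetric e. Proof. by case: clsV. Qed.
Let e0 : irreflexive e. Proof. by case: clsV. Qed.

Lemma ec_le1 P x y : uniq P -> ec P x y <= 1.
Proof.
elim: P => // a [|b q] IHq // uq; rewrite ec_cons2; have [aq uq'] := andP uq.
have := IHq uq'; case E: (ei a b x y) => //= _.
by case/orP: E => /andP[/eqP-> /eqP->]; rewrite ?[ec _ b a]ec_sym ec_notin.
Qed.

Lemma sorted_ec P x y : sorted e P -> 0 < ec P x y -> e x y.
Proof.
elim: P => // a [|b P] IHP //; rewrite ec_cons2 /= => /andP[eab pP].
case E: (ei a b x y); last exact: IHP.
by case/orP: E => /andP[/eqP-> /eqP->] _; rewrite // es.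
Qed.

Section Pair.
Variables (u v : T) (J : rel T).
Hypotheses (HJ : join_of e (fun x => x \in V) J) (Juv : J u v).

Let Js : symmetric J. Proof. by case: HJ. Qed.
Let Je : subrel J e. Proof. by case: HJ. Qed.
Let euv : e u v. Proof. exact: Je. Qed.
Let uv : u != v. Proof. by apply: contraTneq euv => ->; rewrite e0. Qed.

(** [w] and [w'] are the two deleted vertices, [r] is the neighbour by which the new path or the
    triangle leaves [w], and [o] is the pair to be lifted at [w]. *)
Definition onbr (o : option (T * T)) w w' r : Prop :=
  [/\ forall y, e w y = [|| y == w', y == r | oin o y], r != w', ~~ oin o w', ~~ oin o r &
      if o is Some (a, b) then a != b else true].

Lemma onbr_liftable o w w' r : onbr o w w' r -> [:: w; w'] =i [:: u; v] -> liftable e u v w o.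
Proof.
case: o => //= -[a b] [h rw nw nr ab] eqs.
have wa : e w a by rewrite h /= eqxx !orbT.
have wb : e w b by rewrite h /= eqxx !orbT.
have aw : a != w by apply: contraTneq wa => ->; rewrite e0.
have bw : b != w by apply: contraTneq wb => ->; rewrite e0.
move: nw; rewrite /= negb_or => /andP[aw' bw'].
by split; rewrite // -eqs !inE negb_or ?aw ?bw /= eq_sym.
Qed.

Lemma opathE o w w' r y : onbr o w w' r -> w != w' -> opath w o w y = oin o y.
Proof.
case: o => //= -[a b] [h rw nw nr ab] ww.
have wa : e w a by rewrite h /= eqxx !orbT.
have wb : e w b by rewrite h /= eqxx !orbT.
have aw : w == a = false by apply: contraTF wa => /eqP <-; rewrite e0.
have bw : w == b = false by apply: contraTF wb => /eqP <-; rewrite e0.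
rewrite /ei aw bw eqxx /= orbF; have [->|_] := eqVneq y a; first by rewrite (negbTE ab).
by [].
Qed.

Lemma opath0 o w x y : ~~ oin o x -> x != w -> opath w o x y = 0.
Proof.
case: o => //= -[a b]; rewrite negb_or /ei => /andP[/negbTE xa /negbTE xb] /negbTE xw.
by rewrite xa xb xw.
Qed.

Lemma opath_sym o w x y : opath w o x y = opath w o y x.
Proof. by case: o => //= -[a b]; rewrite !(ei_sym _ _ x). Qed.

(** The edges at [u] and [v] are split between the lifted pairs and the new path [P], whose other
    edges form [k]. A lifted pair may already be adjacent if that edge lies on [P]; otherwise the
    reduced graph would have a double edge. *)
Lemma path_reduction su sv r r' A B :
  let P := A ++ r :: u :: v :: r' :: B in let k : rel T := fun x y => 0 < ec P x y in
  onbr su u v r -> onbr sv v u r' -> uniq P -> sorted e P ->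
  (forall x y, oedge su x y -> e x y -> k x y) ->
  (forall x y, oedge sv x y -> e x y -> k x y) ->
  (forall x y, oedge su x y -> ~~ oedge sv x y) ->
  linked e u v J su sv k -> halvable e V.
Proof.
move=> P k nu nv uP sP hsu hsv hd hl.
have ks : symmetric k by move=> x y; rewrite /k ec_sym.
have lu : liftable e u v u su by apply: onbr_liftable nu _.
have lv : liftable e u v v sv by apply: onbr_liftable nv _ => x; rewrite !inE orbC.
have nk o : (forall x y, oedge o x y -> e x y -> k x y) ->
    forall x y, oedge o x y -> ~~ kept e u v k x y.
  by move=> h x y /h hx; rewrite /kept; apply/negP => /and4P[/hx ->].
have [D dD sz] := lift_core clsV IH HJ Juv ks lu lv (nk _ hsu) (nk _ hsv) hd hl.
have vu : v != u by rewrite eq_sym.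
have uPn : [/\ u \notin A, u \notin r' :: B, v \notin rcons A r & v \notin B].
  move: uP; rewrite /P cat_uniq => /and3P[_ /hasPn hA].
  have hu := hA u; have hv := hA v; move: hu hv; rewrite !inE !eqxx !orbT => /(_ isT) hu /(_ isT) hv.
  rewrite /= !inE !negb_or => /and5P[/and4P[_ rv _ _] /and3P[_ ur' uB] /andP[vr' vB] _ _].
  split; [exact: hu | by rewrite ur' | | exact: vB].
  by rewrite mem_rcons inE negb_or eq_sym rv.
case: uPn => uA urB vAr vB.
have PE x y : ec P x y = ec (rcons A r) x y + ei r u x y + ei u v x y + ei v r' x y + ec (r' :: B) x y.
  by rewrite /P ec_cat !ec_cons2; natlia.
have [hu rv nsuv nsur absu] := nu; have [hv r'u nsvu nsvr' absv] := nv.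
have ru : r != u by have := hu r; rewrite eqxx orbT; apply: contraPneq => ->; rewrite e0.
exists (P :: D); last by rewrite /= mulnS addnC; exact: sz.
apply: (dec_add dD uP); first by rewrite size_cat /= addnS.
have r'v : r' != v by have := hv r'; rewrite eqxx orbT; apply: contraPneq => ->; rewrite e0.
have usu : ~~ oin su u by apply: contraFN (e0 u) => h; rewrite hu h !orbT.
have vsv : ~~ oin sv v by apply: contraFN (e0 v) => h; rewrite hv h !orbT.
have urA : u \notin rcons A r by rewrite mem_rcons inE negb_or eq_sym ru.
have vrB : v \notin r' :: B by rewrite inE negb_or eq_sym r'v.
have rowu y : nrel e u y = kept e u v k u y + opath u su u y + opath v sv u y + ec P u y.
  rewrite /kept mem_head andbF (opathE _ nu) // (opath0 _ nsvu) // PE.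
  rewrite (ec_notin _ urA) (ec_notin _ urB) /nrel hu /ei eqxx (eq_sym u r) (negbTE ru).
  rewrite (negbTE uv) (eq_sym u r') (negbTE r'u) /= !orbF.
  have [->|yv] := eqVneq y v; first by rewrite (negbTE nsuv) eq_sym (negbTE rv).
  have [->|yr] := eqVneq y r; first by rewrite (negbTE nsur).
  by rewrite !addn0.
have rowv y : nrel e v y = kept e u v k v y + opath u su v y + opath v sv v y + ec P v y.
  rewrite /kept !inE eqxx orbT andbF (opathE _ nv) // (opath0 _ nsuv) // PE.
  rewrite (ec_notin _ vAr) (ec_notin _ vrB) /nrel hv /ei eqxx (eq_sym v r) (negbTE rv).
  rewrite (negbTE vu) (eq_sym v r') (negbTE r'v) /= !orbF.
  have [->|yu] := eqVneq y u; first by rewrite (negbTE nsvu) eq_sym (negbTE r'u).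
  have [->|yr] := eqVneq y r'; first by rewrite (negbTE nsvr').
  by rewrite !addn0.
have sym0 x y : kept e u v k x y = kept e u v k y x.
  by rewrite /kept es ks; congr (_ && _); rewrite andbCA.
move=> x y.
have [->|xu] := eqVneq x u; first exact: rowu.
have [->|xv] := eqVneq x v; first exact: rowv.
have [->|yu] := eqVneq y u; first by rewrite /nrel es sym0 !(opath_sym _ _ x) ec_sym; exact: rowu.
have [->|yv] := eqVneq y v; first by rewrite /nrel es sym0 !(opath_sym _ _ x) ec_sym; exact: rowv.
have op0 w o : x != w -> y != w -> opath w o x y = 0.
  by case: o => //= -[a b] xw yw; rewrite /ei (negbTE xw) (negbTE yw) !andbF.
rewrite !op0 // /kept !inE !negb_or xu xv yu yv /= !addn0 /nrel /k.
have := @sorted_ec P x y sP; have := ec_le1 x y uP.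
by case: (ec P x y) => [|[]] //= _ h; rewrite ?andbT ?addn0 // h.
Qed.

(** When both ends leave through the same vertex [z], the remaining edges form a triangle. Without
    it [z] has lost just two edges, so it is still odd and holds the token that [dec_triangle]
    requires. *)
Lemma triangle_reduction su sv z : let k : rel T := fun _ _ => false in
  onbr su u v z -> onbr sv v u z -> odd (deg (nrel e) z) ->
  (forall x y, oedge su x y -> ~~ e x y) -> (forall x y, oedge sv x y -> ~~ e x y) ->
  (forall x y, oedge su x y -> ~~ oedge sv x y) ->
  linked e u v J su sv k -> halvable e V.
Proof.
move=> k nu nv oz hsu hsv hd hl.
have ks : symmetric k by [].
have lu : liftable e u v u su by apply: onbr_liftable nu _.
have lv : liftable e u v v sv by apply: onbr_liftable nv _ => x; rewrite !inE orbC.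
have nk o : (forall x y, oedge o x y -> ~~ e x y) ->
    forall x y, oedge o x y -> ~~ kept e u v k x y.
  by move=> h x y /h hx; rewrite /kept (negbTE hx).
have [D dD sz] := lift_core clsV IH HJ Juv ks lu lv (nk _ hsu) (nk _ hsv) hd hl.
have vu : v != u by rewrite eq_sym.
have [hu zv nsuv nsuz absu] := nu; have [hv zu nsvu nsvz absv] := nv.
have usu : ~~ oin su u by apply: contraFN (e0 u) => h; rewrite hu h !orbT.
have vsv : ~~ oin sv v by apply: contraFN (e0 v) => h; rewrite hv h !orbT.
pose g x y := kept e u v k x y + opath u su x y + opath v sv x y.
have sym0 x y : kept e u v k x y = kept e u v k y x.
  by rewrite /kept es; congr (_ && _); rewrite andbCA.
have rowu y : nrel e u y = g u y + ei u v u y + ei u z u y + ei v z u y.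
  rewrite /g /kept mem_head andbF (opathE _ nu) // (opath0 _ nsvu) //.
  rewrite /nrel hu /ei eqxx (eq_sym u z) (negbTE zu) (negbTE uv) /= !orbF.
  have [->|yv] := eqVneq y v; first by rewrite (negbTE nsuv) eq_sym (negbTE zv).
  have [->|yr] := eqVneq y z; first by rewrite (negbTE nsuz).
  by rewrite !addn0.
have rowv y : nrel e v y = g v y + ei u v v y + ei u z v y + ei v z v y.
  rewrite /g /kept !inE eqxx orbT andbF (opathE _ nv) // (opath0 _ nsuv) //.
  rewrite /nrel hv /ei eqxx (eq_sym v z) (negbTE zv) (negbTE vu) /= !orbF.
  have [->|yu] := eqVneq y u; first by rewrite (negbTE nsvu) eq_sym (negbTE zu).
  have [->|yr] := eqVneq y z; first by rewrite (negbTE nsvz).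
  by rewrite !addn0.
have gs x y : g x y = g y x by rewrite /g sym0 !(opath_sym _ _ x).
have gE x y : nrel e x y = g x y + ei u v x y + ei u z x y + ei v z x y.
  have [->|xu] := eqVneq x u; first exact: rowu.
  have [->|xv] := eqVneq x v; first exact: rowv.
  have [->|yu] := eqVneq y u; first by rewrite /nrel es gs !(ei_sym _ _ x); exact: rowu.
  have [->|yv] := eqVneq y v; first by rewrite /nrel es gs !(ei_sym _ _ x); exact: rowv.
  have op0 w o : x != w -> y != w -> opath w o x y = 0.
    by case: o => //= -[a b] xw yw; rewrite /ei (negbTE xw) (negbTE yw) !andbF.
  rewrite /g !op0 // /kept !inE !negb_or xu xv yu yv /= !addn0 /nrel /k.
  by rewrite /ei (negbTE xu) (negbTE xv) (negbTE yu) (negbTE yv) !andbF !addn0 !andbT.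
have tz : 0 < tok D z.
  apply: (dec_odd_tok dD); move: oz.
  have -> : deg (nrel e) z = deg g z + 2.
    have s1 : deg (fun x y => ei u v x y + ei u z x y + ei v z x y) z = 2.
      have uz : u != z by rewrite eq_sym.
      have vz : v != z by rewrite eq_sym.
      rewrite /deg !big_split /= !sum_ei // (negbTE zu) (negbTE zv) eqxx.
      by [].
    by rewrite -[X in _ + X]s1; apply: deg_add => y; rewrite gE !addnA.
  by rewrite oddD addbF.
have g0 w : w = u \/ w = v -> g w z = 0.
  case=> ->.
    rewrite /g /kept mem_head andbF (opathE _ nu) // (opath0 _ nsvu) //.
    by rewrite (negbTE nsuz).
  rewrite /g /kept !inE eqxx orbT andbF (opathE _ nv) // (opath0 _ nsuv) //.
  by rewrite (negbTE nsvz).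
have [|||D2 d2 s2] := @dec_triangle _ g (nrel e) D u v z dD tz _ _ _ gE.
- by rewrite /= !inE negb_or uv !(eq_sym _ z) zu zv.
- by apply: g0; left.
- by apply: g0; right.
exists D2 => //; rewrite s2 mulnS addnC; exact: sz.
Qed.
End Pair.
End Reductions.

Ltac split_ands := repeat match goal with H : is_true (_ && _) |- _ =>
  let H1 := fresh "neq_" in let H2 := fresh "neq_" in case/andP: H => H1 H2 end.
Ltac use_neq := repeat match goal with
  | H : is_true (?x != ?y) |- context [?x == ?y] => rewrite (negbTE H)
  | H : is_true (?x != ?y) |- context [?y == ?x] => rewrite [y == x]eq_sym (negbTE H)
  end.
Ltac local := rewrite ?ec_cons2 ?ec_seq1 /ei /= ?inE ?eqxx; use_neq; rewrite ?eqxx ?orbT ?andbF //=.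
Ltac perm_tac := by apply/permP => ?; rewrite /=; natlia.
Ltac get_neq H := move: (H); rewrite /= ?inE ?negb_or => ?; split_ands.

(** * Reductions for explicitly listed neighbourhoods *)

Section Wrappers.
Variable T : finType.
Implicit Types (p A B P s : seq T) (D : seq (seq T)) (a b c d r u v w x y z : T).
Variables (e : rel T) (V : {set T}).
Hypothesis clsV : joinable e V.
Hypothesis IH : forall (e' : rel T) (V' : {set T}), esize e' < esize e -> joinable e' V' -> halvable e' V'.

Let es : symmetric e. Proof. by case: clsV. Qed.
Let e0 : irreflexive e. Proof. by case: clsV. Qed.
Let eV x y : e x y -> x \in V. Proof. by case: clsV => _ _ _ h _; apply: h. Qed.

Definition nbrs w s : Prop := uniq s /\ forall y, e w y = (y \in s).

Definition eqrel (L : T -> T -> Prop) : Prop :=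
  [/\ forall x, L x x, forall x y, L x y -> L y x & forall x y z, L x y -> L y z -> L x z].

Fixpoint chain (L : T -> T -> Prop) s : Prop :=
  if s is a :: s' then (if s' is b :: _ then L a b else True) /\ chain L s' else True.

Lemma chain_ec L s x y : eqrel L -> chain L s -> 0 < ec s x y -> L x y.
Proof.
move=> [_ Ls _]; elim: s => // a [|b s] IHs // [Lab cs]; rewrite ec_cons2.
case E: (ei a b x y); last exact: IHs.
by case/orP: E => /andP[/eqP-> /eqP->] _ //; apply: Ls.
Qed.

Lemma nbrs_perm w s s' : perm_eq s s' -> nbrs w s -> nbrs w s'.
Proof.
by move=> h [us hs]; split=> [|y]; rewrite -?(perm_uniq h) // hs (perm_mem h).
Qed.

Lemma nbrs_onbr w w' r a b : nbrs w [:: w'; r; a; b] -> onbr e (Some (a, b)) w w' r.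
Proof.
move=> [us hs]; move: us; rewrite /= !inE !negb_or => us; split_ands.
by split; rewrite //= ?negb_or; try (move=> y; rewrite hs !inE); use_neq.
Qed.

Lemma nbrs_onbr0 w w' r : nbrs w [:: w'; r] -> onbr e None w w' r.
Proof.
move=> [us hs]; move: us; rewrite /= !inE => us; split_ands.
by split; rewrite //= 1?eq_sym // => y; rewrite hs !inE orbF.
Qed.

Section Pair.
Variables (u v : T) (J : rel T).
Hypotheses (HJ : join_of e (fun x => x \in V) J) (Juv : J u v).

Let Js : symmetric J. Proof. by case: HJ. Qed.
Let Je : subrel J e. Proof. by case: HJ. Qed.
Let euv : e u v. Proof. exact: Je. Qed.

(** The [J]-degree of [w] is odd and [ww'] contributes one, so an even number of the other three
    edges lie in [J]. *)
Lemma join_parity w w' r a b : nbrs w [:: w'; r; a; b] -> J w w' -> J w r (+) J w a (+) J w b = false.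
Proof.
move=> [us hs] Jww; have wV : w \in V by apply: (@eV w w'); apply: Je.
have := join_deg HJ us hs; have [_ _ Jo] := HJ; move: (Jo w); rewrite wV => /[swap] ->.
by rewrite !big_cons big_nil Jww; case: (J w r); case: (J w a); case: (J w b).
Qed.

(** The lifted edge links [a] with [b], so only [r] has to be compared with them. *)
Definition pair_linked (L : T -> T -> Prop) w r a b : Prop :=
  (J w r -> J w a -> L r a) /\ (J w r -> J w b -> L r b).

Lemma pair_linkedP L w w' r a b x y : eqrel L -> nbrs w [:: w'; r; a; b] -> L a b ->
  pair_linked L w r a b -> J w x -> J w y -> x != w' -> y != w' -> L x y.
Proof.
move=> [Lr Ls Lt] [_ hs] Lab [h1 h2] Jx Jy xw yw.
have := Je Jx; have := Je Jy; rewrite !hs !inE (negbTE xw) (negbTE yw) /=.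
move=> /or3P[] /eqP yE /or3P[] /eqP xE; subst x y; auto.
Qed.

(** The edges of [P] along [A] and [B] are absent from the reduced graph although [J] may use them,
    whence the two [chain] conditions; edges off [u] and [v] and off [P] may be used to prove
    them. *)
Lemma reduce44 r a b r' c d A B : let P := A ++ r :: u :: v :: r' :: B in
  nbrs u [:: v; r; a; b] -> nbrs v [:: u; r'; c; d] -> uniq P -> sorted e P ->
  (e a b -> 0 < ec P a b) -> (e c d -> 0 < ec P c d) -> ~~ ei a b c d ->
  (forall L, eqrel L -> L a b -> L c d ->
    (forall x y, e x y -> x \notin [:: u; v] -> y \notin [:: u; v] ->
      ec (rcons A r) x y = 0 -> ec (r' :: B) x y = 0 -> L x y) ->
    [/\ chain L (rcons A r), chain L (r' :: B), pair_linked L u r a b & pair_linked L v r' c d]) ->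
  halvable e V.
Proof.
move=> P nu nv uP sP hab hcd dis hL.
have PE x y : ec P x y = ec (rcons A r) x y + ei r u x y + ei u v x y + ei v r' x y + ec (r' :: B) x y.
  by rewrite /P ec_cat !ec_cons2; natlia.
apply: (path_reduction clsV IH HJ Juv (nbrs_onbr nu) (nbrs_onbr nv) uP sP).
- by move=> x y /orP[] /andP[/eqP-> /eqP->] //; rewrite es ec_sym.
- by move=> x y /orP[] /andP[/eqP-> /eqP->] //; rewrite es ec_sym.
- move=> x y /= h; apply: contra dis => h'; move: h h'; rewrite /ei.
  by move=> /orP[] /andP[/eqP-> /eqP->] /orP[] /andP[/eqP-> /eqP->]; rewrite !eqxx ?orbT.
move=> L Lr Ls Lt Lk Lsu Lsv; have eqL : eqrel L by [].
have Lab : L a b by apply: Lsu; apply: ei_self.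
have Lcd : L c d by apply: Lsv; apply: ei_self.
have out x y : x \notin [:: u; v] -> y \notin [:: u; v] ->
    ec P x y = ec (rcons A r) x y + ec (r' :: B) x y.
  rewrite !inE !negb_or PE /ei => /andP[/negbTE-> /negbTE->] /andP[/negbTE-> /negbTE->].
  by rewrite !andbF !addn0.
have [|c1 c2 l1 l2] := hL L eqL Lab Lcd.
  move=> x y exy xuv yuv h1 h2; apply: Lk.
  by rewrite /kept exy xuv yuv out // h1 h2.
split=> [x y exy xuv yuv|x y|x y]; last 2 first.
- exact: (pair_linkedP eqL nu).
- exact: (pair_linkedP eqL nv).
by rewrite out // addn_gt0 => /orP[]; apply: chain_ec.
Qed.

(** The new path is just [r u v r']; no edge off [u] and [v] is set aside, so the lifted pairs have
    to be non-adjacent. *)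
Lemma reduce44s r a b r' c d :
  nbrs u [:: v; r; a; b] -> nbrs v [:: u; r'; c; d] -> r != r' ->
  ~~ e a b -> ~~ e c d -> ~~ ei a b c d ->
  (forall L, eqrel L -> L a b -> L c d ->
    (forall x y, e x y -> x \notin [:: u; v] -> y \notin [:: u; v] -> L x y) ->
    pair_linked L u r a b /\ pair_linked L v r' c d) ->
  halvable e V.
Proof.
move=> nu nv rr ab cd dis hL.
have [uu hu] := nu; have [uvq hv] := nv.
have ur : e u r by rewrite hu !inE eqxx orbT.
have vr : e v r' by rewrite hv !inE eqxx orbT.
apply: (@reduce44 r a b r' c d [::] [::]) => //.
- have uv : u != v by apply: contraTneq euv => ->; rewrite e0.
  have ru : r != u by apply: contraTneq ur => ->; rewrite e0.
  have r'v : r' != v by apply: contraTneq vr => ->; rewrite e0.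
  move: uu uvq; rewrite /= !inE !negb_or => u1 u2; split_ands.
  by use_neq.
- by rewrite /= es ur euv vr.
- by rewrite (negbTE ab).
- by rewrite (negbTE cd).
move=> L eqL Lab Lcd Le; have [|l1 l2] := hL L eqL Lab Lcd.
  by move=> x y *; apply: Le => //=; rewrite ec_seq1.
by split=> //=.
Qed.

Lemma reduce24 r r' c d A B : let P := A ++ r :: u :: v :: r' :: B in
  nbrs u [:: v; r] -> nbrs v [:: u; r'; c; d] -> uniq P -> sorted e P ->
  (e c d -> 0 < ec P c d) ->
  (forall L, eqrel L -> L c d ->
    (forall x y, e x y -> x \notin [:: u; v] -> y \notin [:: u; v] ->
      ec (rcons A r) x y = 0 -> ec (r' :: B) x y = 0 -> L x y) ->
    [/\ chain L (rcons A r), chain L (r' :: B) & pair_linked L v r' c d]) ->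
  halvable e V.
Proof.
move=> P nu nv uP sP hcd hL.
have PE x y : ec P x y = ec (rcons A r) x y + ei r u x y + ei u v x y + ei v r' x y + ec (r' :: B) x y.
  by rewrite /P ec_cat !ec_cons2; natlia.
apply: (path_reduction clsV IH HJ Juv (nbrs_onbr0 nu) (nbrs_onbr nv) uP sP) => //.
- by move=> x y /orP[] /andP[/eqP-> /eqP->] //; rewrite es ec_sym.
move=> L Lr Ls Lt Lk _ Lsv; have eqL : eqrel L by [].
have Lcd : L c d by apply: Lsv; apply: ei_self.
have out x y : x \notin [:: u; v] -> y \notin [:: u; v] ->
    ec P x y = ec (rcons A r) x y + ec (r' :: B) x y.
  rewrite !inE !negb_or PE /ei => /andP[/negbTE-> /negbTE->] /andP[/negbTE-> /negbTE->].
  by rewrite !andbF !addn0.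
have [|c1 c2 l2] := hL L eqL Lcd.
  move=> x y exy xuv yuv h1 h2; apply: Lk.
  by rewrite /kept exy xuv yuv out // h1 h2.
split=> [x y exy xuv yuv|x y Jx Jy xv yv|x y]; last 2 first.
- have := Je Jx; have := Je Jy; rewrite !nu.2 !inE (negbTE xv) (negbTE yv) /=.
  by move=> /eqP-> /eqP->.
- exact: (pair_linkedP eqL nv).
by rewrite out // addn_gt0 => /orP[]; apply: chain_ec.
Qed.

Lemma reduce22 r r' : nbrs u [:: v; r] -> nbrs v [:: u; r'] -> r != r' -> halvable e V.
Proof.
move=> nu nv rr.
have ur : e u r by rewrite nu.2 !inE eqxx orbT.
have vr : e v r' by rewrite nv.2 !inE eqxx orbT.
have uv : u != v by apply: contraTneq euv => ->; rewrite e0.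
have ru : r != u by apply: contraTneq ur => ->; rewrite e0.
have r'v : r' != v by apply: contraTneq vr => ->; rewrite e0.
have := nu.1; have := nv.1; rewrite /= !inE ?negb_or => u1 u2; split_ands.
apply: (@path_reduction _ _ _ clsV IH _ _ _ HJ Juv _ _ r r' [::] [::] (nbrs_onbr0 nu) (nbrs_onbr0 nv)) => //.
- by rewrite /= !inE !negb_or; use_neq.
- by rewrite /= es ur euv vr.
move=> L Lr Ls Lt Lk _ _; split=> [x y exy xuv yuv|x y Jx Jy xv yv|x y Jx Jy xv yv].
- move: xuv yuv; rewrite !inE !negb_or /= !ec_cons2 ec_seq1 /ei.
  by move=> /andP[/negbTE-> /negbTE->] /andP[/negbTE-> /negbTE->]; rewrite !andbF.
- have := Je Jx; have := Je Jy; rewrite !nu.2 !inE (negbTE xv) (negbTE yv) /=.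
  by move=> /eqP-> /eqP->.
- have := Je Jx; have := Je Jy; rewrite !nv.2 !inE (negbTE xv) (negbTE yv) /=.
  by move=> /eqP-> /eqP->.
Qed.

(** With [uz] and [vz] outside [J], the further [J]-neighbours of [u] and of [v] lie in the lifted
    pairs and are linked by them. *)
Lemma triangle44 z a b c d : nbrs u [:: v; z; a; b] -> nbrs v [:: u; z; c; d] ->
  odd (deg (nrel e) z) -> ~~ e a b -> ~~ e c d -> ~~ ei a b c d -> ~~ J u z -> ~~ J v z ->
  halvable e V.
Proof.
move=> nu nv oz ab cd dis Juz Jvz.
apply: (triangle_reduction clsV IH HJ Juv (nbrs_onbr nu) (nbrs_onbr nv) oz).
- by move=> x y /orP[] /andP[/eqP-> /eqP->] //; rewrite es.
- by move=> x y /orP[] /andP[/eqP-> /eqP->] //; rewrite es.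
- move=> x y /= h; apply: contra dis => h'; move: h h'; rewrite /ei.
  by move=> /orP[] /andP[/eqP-> /eqP->] /orP[] /andP[/eqP-> /eqP->]; rewrite !eqxx ?orbT.
move=> L Lr Ls Lt Lk Lsu Lsv; have eqL : eqrel L by [].
have Lab : L a b by apply: Lsu; apply: ei_self.
have Lcd : L c d by apply: Lsv; apply: ei_self.
split=> [//|x y|x y].
- by apply: (pair_linkedP eqL nu) => //; split=> h; rewrite h in Juz.
- by apply: (pair_linkedP eqL nv) => //; split=> h; rewrite h in Jvz.
Qed.

Lemma triangle24 z c d : nbrs u [:: v; z] -> nbrs v [:: u; z; c; d] ->
  odd (deg (nrel e) z) -> ~~ e c d -> ~~ J v z -> halvable e V.
Proof.
move=> nu nv oz cd Jvz.
apply: (triangle_reduction clsV IH HJ Juv (nbrs_onbr0 nu) (nbrs_onbr nv) oz) => //.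
- by move=> x y /orP[] /andP[/eqP-> /eqP->] //; rewrite es.
move=> L Lr Ls Lt Lk _ Lsv; have eqL : eqrel L by [].
have Lcd : L c d by apply: Lsv; apply: ei_self.
split=> [//|x y Jx Jy xv yv|x y].
- have := Je Jx; have := Je Jy; rewrite !nu.2 !inE (negbTE xv) (negbTE yv) /=.
  by move=> /eqP-> /eqP->.
- by apply: (pair_linkedP eqL nv) => //; split=> h; rewrite h in Jvz.
Qed.

Lemma triangle22 z : nbrs u [:: v; z] -> nbrs v [:: u; z] -> odd (deg (nrel e) z) -> halvable e V.
Proof.
move=> nu nv oz.
apply: (triangle_reduction clsV IH HJ Juv (nbrs_onbr0 nu) (nbrs_onbr0 nv) oz) => //.
move=> L Lr Ls Lt Lk _ _; split=> [//|x y Jx Jy xv yv|x y Jx Jy xv yv].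
- have := Je Jx; have := Je Jy; rewrite !nu.2 !inE (negbTE xv) (negbTE yv) /=.
  by move=> /eqP-> /eqP->.
- have := Je Jx; have := Je Jy; rewrite !nv.2 !inE (negbTE xv) (negbTE yv) /=.
  by move=> /eqP-> /eqP->.
Qed.
End Pair.
End Wrappers.

(** * Configurations around two adjacent even vertices *)

Section Configurations.
Variable T : finType.
Implicit Types (A B P R : seq T) (D : seq (seq T)) (J : rel T).
Implicit Types (a b c d p q r s t u v w x y z : T).
Variables (e : rel T) (V : {set T}).
Hypothesis clsV : joinable e V.
Hypothesis IH : forall (e' : rel T) (V' : {set T}), esize e' < esize e -> joinable e' V' -> halvable e' V'.

Let es : symmetric e. Proof. by case: clsV. Qed.
Let e0 : irreflexive e. Proof. by case: clsV. Qed.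
Let eV x y : e x y -> x \in V. Proof. by case: clsV => _ _ _ h _; apply: h. Qed.

Notation nbrs := (nbrs e).
Notation join J := (join_of e (fun x => x \in V) J).

Lemma edge_neq x y : e x y -> x != y.
Proof. by apply: contraTneq => ->; rewrite e0. Qed.

Lemma nbrs_extend w (s : seq T) : uniq s -> all (e w) s ->
  exists2 t, nbrs w (s ++ t) & size (s ++ t) = deg (nrel e) w.
Proof.
move=> us as_; pose t := enum [pred y | e w y && (y \notin s)].
have nt : nbrs w (s ++ t).
  split=> [|y]; last first.
    rewrite mem_cat mem_enum inE; case ys: (y \in s); last by rewrite andbT.
    exact: (allP as_).
  rewrite cat_uniq us enum_uniq andbT /=; apply/hasPn => y; rewrite mem_enum => /andP[_ ys].
  exact: ys.
exists t => //; have [ut ht] := nt; rewrite /deg -sum1_size (big_uniq _ ut) /= [LHS]big_mkcond.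
by apply: eq_bigr => y _; rewrite /nrel ht; case: ifP.
Qed.

Lemma nbrs_deg w (s : seq T) : nbrs w s -> deg (nrel e) w = size s.
Proof.
move=> [us hs]; rewrite /deg -sum1_size (big_uniq _ us) /= [RHS]big_mkcond.
by apply: eq_bigr => y _; rewrite /nrel hs; case: ifP.
Qed.

Lemma nbrs_in w (s : seq T) y : nbrs w s -> y \in s -> e w y.
Proof. by move=> [_ ->]. Qed.

(** A triangle has even degree at every vertex, so the symmetric difference with it preserves all
    parities. *)
Lemma join_toggle J u v z : join J -> e u v -> e v z -> e u z ->
  join (fun x y => J x y (+) ei u v x y (+) ei v z x y (+) ei u z x y).
Proof.
move=> [Js Je Jo] uv vz uz; split=> [x y|x y|x].
- by rewrite Js !(ei_sym _ _ x).
- have h a b : e a b -> ei a b x y -> e x y.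
    by move=> eab /orP[] /andP[/eqP-> /eqP->]; rewrite // es.
  case Jxy: (J x y); first by move=> _; apply: Je.
  case E1: (ei u v x y); first by move=> _; apply: h uv E1.
  case E2: (ei v z x y); first by move=> _; apply: h vz E2.
  exact: h uz.
- rewrite !odd_deg_xor Jo; have h a b : e a b -> odd (deg (nrel (ei a b)) x) = (x == a) (+) (x == b).
    by move=> /edge_neq ab; rewrite /deg sum_ei // oddD !oddb.
  by rewrite !h //; case: (x == u); case: (x == v); case: (x == z); case: (x \in V).
Qed.

Lemma even_deg w y : e w y -> ~~ odd (deg (nrel e) w) -> deg (nrel e) w = 2 \/ deg (nrel e) w = 4.
Proof.
move=> ewy; have := deg_gt0 ewy; have [_ _ h _ _] := clsV; have := h w.
by case: (deg _ _) => [|[|[|[|[|[|]]]]]] //; [left|right].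
Qed.

(* Switching [J] along the triangle [u v z] makes [uz] a usable pair when [z] is even. *)
Lemma even_common J u v z : join J -> J u v -> e u z -> e v z -> ~~ J u z -> ~~ J v z ->
  ~~ odd (deg (nrel e) z) ->
  exists J' a b, [/\ join J', nbrs z [:: u; v; a; b], J' u z, J' z a (+) J' z b &
    forall w, w != v -> w != z -> J' u w = J u w].
Proof.
move=> HJ Juv uz vz Juz Jvz ez; have [Js Je Jo] := HJ.
have uv := edge_neq (Je _ _ Juv); have uz' := edge_neq uz; have vz' := edge_neq vz.
have zV : z \in V by apply: (@eV z u); rewrite es.
have [||t nt st] := @nbrs_extend z [:: u; v].
- by rewrite /= inE uv.
- by rewrite /= es uz es vz.
have dJ := Jo z; rewrite zV (join_deg HJ nt.1 nt.2) in dJ.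
have zu : e z u by rewrite es.
have [d2|d4] := even_deg zu ez.
  rewrite d2 in st; case: t st nt dJ => // _ nt; rewrite /= !big_cons big_nil !(Js z).
  by rewrite (negbTE Juz) (negbTE Jvz).
rewrite d4 in st; case: t st nt dJ => [|a [|b []]] // _ nt dJ.
have [ut _] := nt; get_neq ut.
exists (fun x y => J x y (+) ei u v x y (+) ei v z x y (+) ei u z x y), a, b; split=> //.
- by apply: join_toggle => //; apply: Je.
- by rewrite (negbTE Juz); local.
- move: dJ; rewrite /= !big_cons big_nil !(Js z u) !(Js z v) (negbTE Juz) (negbTE Jvz).
  local; rewrite !addbF.
  by case: (J z a); case: (J z b).
- by move=> w wv wz; local; rewrite !addbF.
Qed.

(* Either two neighbours can be lifted, or all three are adjacent and [b a r] starts the new path. *)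
Lemma choose_side (j : T -> bool) x1 x2 x3 : j x1 (+) j x2 (+) j x3 = false ->
  exists r a b, perm_eq [:: x1; x2; x3] [:: r; a; b] /\
   ([/\ ~~ e a b, j r -> j a -> e r a & j r -> j b -> e r b] \/ [/\ e a b, e a r & e b r]).
Proof.
move=> h.
have try r a b : perm_eq [:: x1; x2; x3] [:: r; a; b] ->
   ([&& ~~ e a b, j r ==> j a ==> e r a & j r ==> j b ==> e r b] || [&& e a b, e a r & e b r]) ->
  exists r a b, perm_eq [:: x1; x2; x3] [:: r; a; b] /\
   ([/\ ~~ e a b, j r -> j a -> e r a & j r -> j b -> e r b] \/ [/\ e a b, e a r & e b r]).
  move=> pe /orP hh; exists r, a, b; split=> //; case: hh => /and3P[h1 h2 h3]; [left|by right].
  by split=> // jr ja; [move: h2 | move: h3]; rewrite jr ja.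
(* Parity marks two vertices or none. Without marks any non-adjacent pair will do. Two non-adjacent
   marked vertices form the pair; if they are adjacent, one of them becomes [r] and the other is
   paired with the third vertex, unless that vertex is adjacent to both. *)
have t1 := @try x1 x2 x3 _; have t2 := @try x2 x1 x3 _; have t3 := @try x3 x1 x2 _.
have {}t1 := t1 (perm_refl _); have {}t2 := t2 ltac:(perm_tac); have {}t3 := t3 ltac:(perm_tac).
move: h t1 t2 t3; rewrite !(es x2 x1) !(es x3 x1) !(es x3 x2).
case: (j x1); case: (j x2); case: (j x3) => // _; case: (e x1 x2); case: (e x1 x3);
  case: (e x2 x3) => /= t1 t2 t3; first [exact: t1 | exact: t2 | exact: t3].
Qed.

(** If the further neighbours of [v] are pairwise adjacent, the new path [x u v r c d] takes up the
    edge [cd], which is thereby free to be lifted; the kept edge [rd] links [r] with both. *)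
Lemma case24_out J u v x y1 y2 y3 : join J -> J u v -> nbrs u [:: v; x] ->
  nbrs v [:: u; y1; y2; y3] -> x \notin [:: y1; y2; y3] -> halvable e V.
Proof.
move=> HJ Juv nu nv xY; have [Js Je Jo] := HJ; have [r [c [d [pe sd]]]] :=
  choose_side (join_parity clsV HJ nv (etrans (Js v u) Juv)).
have {}nv : nbrs v [:: u; r; c; d] by apply: nbrs_perm nv; rewrite perm_cons.
rewrite (perm_mem pe) in xY; have [uu _] := nu; have [uvv _] := nv.
have euv := Je _ _ Juv; have ux : e u x by apply: nbrs_in nu _; local.
have vr : e v r by apply: nbrs_in nv _; local.
have vc : e v c by apply: nbrs_in nv _; local.
have vd : e v d by apply: nbrs_in nv _; local.
have n1 := edge_neq euv; have n2 := edge_neq ux; have n3 := edge_neq vr; have n4 := edge_neq vc.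
have n5 := edge_neq vd; get_neq uu; get_neq uvv; get_neq xY.
case: sd => [[cd h1 h2]|[cd cr dr]].
  apply: (@reduce24 _ _ _ clsV IH u v J HJ Juv x r c d [::] [::] nu nv) => //.
  - by local.
  - by rewrite /= es ux euv vr.
  - by rewrite (negbTE cd).
  move=> L [Lr Ls Lt] Lcd Le; split=> //=; split=> Jr Jc.
    by apply: Le; [apply: h1 | local | local | local | local].
  by apply: Le; [apply: h2 | local | local | local | local].
apply: (@reduce24 _ _ _ clsV IH u v J HJ Juv x r c d [::] [:: c; d] nu nv) => //.
- by local.
- by rewrite /= es ux euv vr es cr cd.
- by local.
move=> L [Lr Ls Lt] Lcd Le.
have Lrd : L r d by apply: Le; [rewrite es | local | local | local | local].
have Lrc : L r c by apply: Lt Lrd _; apply: Ls.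
by split=> //=; split.
Qed.

(** The path leaves [u] by [x], so it leaves [v] by [c], and [xd] is lifted; if [xd] is an edge, the
    path starts with it. After a possible exchange of [c] and [d], the vertices [c] and [x] are not
    both [J]-neighbours of [v], and the last hypothesis links [c] with [d] where needed. *)
Lemma case24_in J u v x c d : join J -> J u v -> nbrs u [:: v; x] -> nbrs v [:: u; x; c; d] ->
  (J v c -> J v d -> e c d) -> halvable e V.
Proof.
move=> HJ Juv nu; have [Js Je Jo] := HJ.
wlog h : c d / ~~ (J v c && J v x) => [hw nv cd|nv cd].
  have [h|h] := boolP (J v c && J v x); last exact: hw h nv cd.
  apply: (hw d c) => //; last by move=> *; rewrite es; apply: cd.
    case/andP: h => h1 h2; have := join_parity clsV HJ nv (etrans (Js v u) Juv).
    by rewrite h1 h2 /= => ->.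
  apply: nbrs_perm nv; perm_tac.
have [uu _] := nu; have [uvv _] := nv.
have euv := Je _ _ Juv; have ux : e u x by apply: nbrs_in nu _; local.
have vr : e v x by apply: nbrs_in nv _; local.
have vc : e v c by apply: nbrs_in nv _; local.
have vd : e v d by apply: nbrs_in nv _; local.
have n1 := edge_neq euv; have n2 := edge_neq ux; have n3 := edge_neq vr; have n4 := edge_neq vc.
have n5 := edge_neq vd; get_neq uu; get_neq uvv.
have {}nv : nbrs v [:: u; c; x; d] by apply: nbrs_perm nv; perm_tac.
have [xd|xd] := boolP (e x d); last first.
  apply: (@reduce24 _ _ _ clsV IH u v J HJ Juv x c x d [::] [::] nu nv) => //.
  - by local.
  - by rewrite /= es ux euv vc.
  - by rewrite (negbTE xd).
  move=> L [Lr Ls Lt] Lcd Le; split=> //=; split=> J1 J2.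
    by rewrite J1 J2 in h.
  by apply: Le; [apply: cd | local | local | local | local].
apply: (@reduce24 _ _ _ clsV IH u v J HJ Juv x c x d [:: d] [::] nu nv) => //.
- by local.
- by rewrite /= es xd es ux euv vc.
- by local.
move=> L [Lr Ls Lt] Lcd Le; split=> //=; first by split; [apply: Ls|].
split=> J1 J2; first by rewrite J1 J2 in h.
by apply: Le; [apply: cd | local | local | local | local].
Qed.

(** The hard case has [x] common, [c] and [d] non-adjacent and both joined to [v] in [J], hence [vx]
    outside [J]. For odd [x] the triangle works. For even [x] the join is switched and [ux] replaces
    [uv]; exactly one of the two further neighbours of [x] is then joined to it, so [case24_in]
    applies. *)
Lemma case24 J u v x y1 y2 y3 : join J -> J u v -> nbrs u [:: v; x] ->
  nbrs v [:: u; y1; y2; y3] -> halvable e V.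
Proof.
move=> HJ Juv nu nv; have [xY|xY] := boolP (x \in [:: y1; y2; y3]); last exact: (case24_out HJ Juv nu nv xY).
have [c [d {}nv]] : exists c d, nbrs v [:: u; x; c; d].
  move: xY; rewrite !inE => /or3P[] /eqP xE; subst x.
  - by exists y2, y3.
  - exists y1, y3; apply: nbrs_perm nv; perm_tac.
  - exists y1, y2; apply: nbrs_perm nv; perm_tac.
have [/and3P[Jc Jd cd]|h] := boolP [&& J v c, J v d & ~~ e c d]; last first.
  by apply: case24_in HJ Juv nu nv _ => Jc Jd; move: h; rewrite Jc Jd negbK.
have [Js Je Jo] := HJ; have Jvx : ~~ J v x.
  have := join_parity clsV HJ nv (etrans (Js v u) Juv); rewrite Jc Jd.
  by case: (J v x).
have [ox|ex] := boolP (odd (deg (nrel e) x)).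
  exact: (triangle24 clsV IH HJ Juv nu nv).
have ux : e u x by apply: nbrs_in nu _; local.
have vx : e v x by apply: nbrs_in nv _; local.
have Jux : ~~ J u x.
  have := Jo u; rewrite (eV ux) (join_deg HJ nu.1 nu.2) !big_cons big_nil Juv.
  by case: (J u x).
have [J' [a [b [HJ' nx Jux' par _]]]] := even_common HJ Juv ux vx Jux Jvx ex.
apply: (case24_in HJ' Jux' _ nx); last by move=> h1 h2; rewrite h1 h2 in par.
apply: nbrs_perm nu; perm_tac.
Qed.

(** Only an even common neighbour is a problem; switching along the triangle makes [ux] a usable
    edge between degrees 2 and 4. *)
Lemma case22 J u v x y : join J -> J u v -> nbrs u [:: v; x] -> nbrs v [:: u; y] -> halvable e V.
Proof.
move=> HJ Juv nu nv; have [xy|xy] := eqVneq x y; last exact: (reduce22 clsV IH HJ Juv nu nv xy).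
subst y; have [ox|ex] := boolP (odd (deg (nrel e) x)); first exact: (triangle22 clsV IH HJ Juv nu nv).
have [Js Je Jo] := HJ.
have ux : e u x by apply: nbrs_in nu _; local.
have vx : e v x by apply: nbrs_in nv _; local.
have Jux : ~~ J u x.
  have := Jo u; rewrite (eV ux) (join_deg HJ nu.1 nu.2) !big_cons big_nil Juv.
  by case: (J u x).
have Jvx : ~~ J v x.
  have := Jo v; rewrite (eV vx) (join_deg HJ nv.1 nv.2) !big_cons big_nil Js Juv.
  by case: (J v x).
have [J' [a [b [HJ' nx Jux' par _]]]] := even_common HJ Juv ux vx Jux Jvx ex.
apply: (case24_in HJ' Jux' _ nx); last by move=> h1 h2; rewrite h1 h2 in par.
apply: nbrs_perm nu; perm_tac.
Qed.

(** * Two adjacent vertices of degree four *)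

Lemma uniq_perm_eq (s t : seq T) : perm_eq s t -> uniq s -> uniq t.
Proof. by move=> /perm_uniq ->. Qed.

(* The last index of [case44_*] is the number of common neighbours of [u] and [v]. *)
Lemma case44_0 J u v x1 x2 x3 y1 y2 y3 : join J -> J u v ->
  nbrs u [:: v; x1; x2; x3] -> nbrs v [:: u; y1; y2; y3] ->
  uniq [:: u; v; x1; x2; x3; y1; y2; y3] -> halvable e V.
Proof.
move=> HJ Juv nu nv U; have [Js Je Jo] := HJ.
have [r [a [b [pe sd]]]] := choose_side (join_parity clsV HJ nu Juv).
have [r' [c [d [pe' sd']]]] := choose_side (join_parity clsV HJ nv (etrans (Js v u) Juv)).
have {}nu : nbrs u [:: v; r; a; b] by apply: nbrs_perm nu; rewrite perm_cons.
have {}nv : nbrs v [:: u; r'; c; d] by apply: nbrs_perm nv; rewrite perm_cons.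
have {}U : uniq [:: u; v; r; a; b; r'; c; d].
  have pU : perm_eq ([:: u; v] ++ [:: x1; x2; x3] ++ [:: y1; y2; y3])
                    ([:: u; v] ++ [:: r; a; b] ++ [:: r'; c; d]) by rewrite perm_cat2l perm_cat.
  exact: (uniq_perm_eq pU).
have euv := Je _ _ Juv; have ur : e u r by apply: nbrs_in nu _; local.
have vr : e v r' by apply: nbrs_in nv _; local.
get_neq U.
(* The further neighbourhoods are disjoint, so the sides are independent: a side with three adjacent
   vertices prolongs the new path by two of them, which frees the edge to be lifted. *)
case: sd => [[ab h1 h2]|[ab ar br]]; case: sd' => [[cd h1' h2']|[cd cr dr]].
- apply: (@reduce44s _ _ _ clsV IH u v J HJ Juv r a b r' c d nu nv) => //; first by local.
  move=> L [Lr Ls Lt] Lab Lcd Le; split; split=> J1 J2.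
  + by apply: Le; [apply: h1 | local | local].
  + by apply: Le; [apply: h2 | local | local].
  + by apply: Le; [apply: h1' | local | local].
  + by apply: Le; [apply: h2' | local | local].
- apply: (@reduce44 _ _ _ clsV IH u v J HJ Juv r a b r' c d [::] [:: c; d] nu nv).
  + by local.
  + by rewrite /= es ur euv vr es cr cd.
  + by rewrite (negbTE ab).
  + by local.
  + by local.
  move=> L [Lr Ls Lt] Lab Lcd Le.
  have Lrd : L r' d by apply: Le; [rewrite es | local | local | local | local].
  have Lrc : L r' c by apply: Lt Lrd _; apply: Ls.
  split=> //=; split=> // J1 J2.
  + by apply: Le; [apply: h1 | local | local | local | local].
  + by apply: Le; [apply: h2 | local | local | local | local].
- apply: (@reduce44 _ _ _ clsV IH u v J HJ Juv r a b r' c d [:: b; a] [::] nu nv).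
  + by local.
  + by rewrite /= (es b a) ab ar es ur euv vr.
  + by local.
  + by rewrite (negbTE cd).
  + by local.
  move=> L [Lr Ls Lt] Lab Lcd Le.
  have Lrb : L r b by apply: Le; [rewrite es | local | local | local | local].
  have Lra : L r a by apply: Lt Lrb _; apply: Ls.
  split=> //=; first by split; [apply: Ls | split; [apply: Ls|]].
  split=> // J1 J2.
  + by apply: Le; [apply: h1' | local | local | local | local].
  + by apply: Le; [apply: h2' | local | local | local | local].
- apply: (@reduce44 _ _ _ clsV IH u v J HJ Juv r a b r' c d [:: b; a] [:: c; d] nu nv).
  + by local.
  + by rewrite /= (es b a) ab ar es ur euv vr es cr cd.
  + by local.
  + by local.
  + by local.
  move=> L [Lr Ls Lt] Lab Lcd Le.
  have Lrb : L r b by apply: Le; [rewrite es | local | local | local | local].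
  have Lra : L r a by apply: Lt Lrb _; apply: Ls.
  have Lrd : L r' d by apply: Le; [rewrite es | local | local | local | local].
  have Lrc : L r' c by apply: Lt Lrd _; apply: Ls.
  split=> //=; by split; [apply: Ls | split; [apply: Ls|]].
Qed.

(** At [u] the common neighbour [z] is lifted with [s], and the path leaves by the private neighbour
    [t], which cannot recur beyond [v]; the side of [v] is left to [choose_side]. Adjacency of [t]
    to [z] suffices in the last condition, as the lifted edge links [z] with [s]. *)
Lemma case44_1_lift J u v z s t y1 y2 : join J -> J u v ->
  nbrs u [:: v; z; s; t] -> nbrs v [:: u; z; y1; y2] -> uniq [:: u; v; z; s; t; y1; y2] ->
  ~~ e z s -> (J u t -> J u z -> e t z) -> (J u t -> J u s -> e t s || e t z) -> halvable e V.
Proof.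
move=> HJ Juv nu nv U zs k1 k2; have [Js Je Jo] := HJ.
have [r' [c [d [pe' sd']]]] := choose_side (join_parity clsV HJ nv (etrans (Js v u) Juv)).
have {}nv : nbrs v [:: u; r'; c; d] by apply: nbrs_perm nv; rewrite perm_cons.
have {}nu : nbrs u [:: v; t; z; s] by apply: nbrs_perm nu; perm_tac.
have zin : z \in [:: r'; c; d] by rewrite -(perm_mem pe') mem_head.
have {}U : uniq [:: u; v; s; t; r'; c; d].
  have pU : perm_eq ([:: u; v; s; t] ++ [:: z; y1; y2]) ([:: u; v; s; t] ++ [:: r'; c; d]).
    by rewrite perm_cat2l.
  apply: (uniq_perm_eq pU); apply: uniq_perm_eq U; perm_tac.
have euv := Je _ _ Juv; have ut : e u t by apply: nbrs_in nu _; local.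
have vr : e v r' by apply: nbrs_in nv _; local.
have zU : [/\ z != u, z != v, z != s & z != t].
  by get_neq U; move: zin; rewrite !inE => /or3P[] /eqP->; split; use_neq.
case: zU => zu zv z_s z_t; get_neq U.
have lu L : eqrel L -> L z s -> (forall w, w \in [:: s; z] -> e t w -> L t w) -> pair_linked J L u t z s.
  move=> [Lr Ls Lt] Lzs Le; split=> J1 J2; first by apply: Le; [local | apply: k1].
  case/orP: (k2 J1 J2) => h; first by apply: Le; [local|].
  by apply: Lt Lzs; apply: Le; [local|].
have dis : ~~ ei z s c d by local.
case: sd' => [[cd h1' h2']|[cd cr dr]].
  apply: (@reduce44s _ _ _ clsV IH u v J HJ Juv t z s r' c d nu nv) => //.
  move=> L eqL Lab Lcd Le; split.
    apply: lu => // w; rewrite !inE => /orP[] /eqP-> h; apply: Le => //; by local.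
  split=> J1 J2; [apply: Le; [exact: h1' | |] | apply: Le; [exact: h2' | |]]; by local.
apply: (@reduce44 _ _ _ clsV IH u v J HJ Juv t z s r' c d [::] [:: c; d] nu nv) => //.
- by local.
- by rewrite /= es ut euv vr es cr cd.
- by rewrite (negbTE zs).
- by local.
move=> L eqL Lab Lcd Le; have [Lr Ls Lt] := eqL.
have Lrd : L r' d by apply: Le; [rewrite es | local | local | local | local].
have Lrc : L r' c by apply: Lt Lrd _; apply: Ls.
split=> //=; apply: lu => // w; rewrite !inE => /orP[] /eqP-> h; apply: Le => //; by local.
Qed.

(** The path [x2 u v z x1] takes up the edge [z x1], which is lifted at [u]; the kept edge [z x2]
    links the third vertex. At [v] nothing has to be linked with [z], since [vz] is not in [J]. *)
Lemma case44_1_cover J u v z x1 x2 y1 y2 : join J -> J u v ->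
  nbrs u [:: v; z; x1; x2] -> nbrs v [:: u; z; y1; y2] -> uniq [:: u; v; z; x1; x2; y1; y2] ->
  e z x1 -> e z x2 -> ~~ e y1 y2 -> ~~ J v z -> halvable e V.
Proof.
move=> HJ Juv nu nv U zx1 zx2 y12 Jvz; have [Js Je Jo] := HJ.
have euv := Je _ _ Juv; have ux2 : e u x2 by apply: nbrs_in nu _; local.
have vz : e v z by apply: nbrs_in nv _; local.
have {}nu : nbrs u [:: v; x2; z; x1] by apply: nbrs_perm nu; perm_tac.
get_neq U.
apply: (@reduce44 _ _ _ clsV IH u v J HJ Juv x2 z x1 z y1 y2 [::] [:: x1] nu nv) => //.
- by local.
- by rewrite /= es ux2 euv vz zx1.
- by local.
- by rewrite (negbTE y12).
- by local.
move=> L [Lr Ls Lt] Lab Lcd Le.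
have L2 : L x2 z by apply: Le; [rewrite es | local | local | local | local].
split=> //=; first by split=> // _ _; apply: Lt L2 _.
by split=> h; rewrite h in Jvz.
Qed.

(** Kept as a disjunction because it is used a second time after a switch of the join, where the new
    parities rule the obstruction out. *)
Lemma case44_1_or J u v z x1 x2 y1 y2 : join J -> J u v ->
  nbrs u [:: v; z; x1; x2] -> nbrs v [:: u; z; y1; y2] -> uniq [:: u; v; z; x1; x2; y1; y2] ->
  halvable e V \/ [/\ [&& J u x1, J u x2, ~~ e x1 x2, ~~ e z x1 & ~~ e z x2]
                & [&& J v y1, J v y2, ~~ e y1 y2, ~~ e z y1 & ~~ e z y2]].
Proof.
move=> HJ Juv nu nv U; have [Js Je Jo] := HJ; have Jvu := etrans (Js v u) Juv.
have side u' v' x1' x2' y1' y2' : J u' v' -> nbrs u' [:: v'; z; x1'; x2'] ->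
    nbrs v' [:: u'; z; y1'; y2'] -> uniq [:: u'; v'; z; x1'; x2'; y1'; y2'] ->
    halvable e V \/ (e z x1' && e z x2') ||
       [&& J u' x1', J u' x2', ~~ e x1' x2', ~~ e z x1' & ~~ e z x2'].
  move=> Juv' nu' nv' U'.
  have try s t : nbrs u' [:: v'; z; s; t] -> uniq [:: u'; v'; z; s; t; y1'; y2'] ->
     [&& ~~ e z s, J u' t ==> J u' z ==> e t z & J u' t ==> J u' s ==> (e t s || e t z)] -> halvable e V.
    move=> nst Ust /and3P[h1 h2 h3]; apply: (case44_1_lift HJ Juv' nst nv' Ust h1).
      by move=> j1 j2; move: h2; rewrite j1 j2.
    by move=> j1 j2; move: h3; rewrite j1 j2.
  have t1 := try _ _ nu' U'.
  have t2 : [&& ~~ e z x2', J u' x1' ==> J u' z ==> e x1' z &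
                J u' x1' ==> J u' x2' ==> (e x1' x2' || e x1' z)] -> halvable e V.
    apply: try; first by apply: nbrs_perm nu'; perm_tac.
    apply: uniq_perm_eq U'; perm_tac.
  have := join_parity clsV HJ nu' Juv'; move: t1 t2; rewrite (es x2' x1') !(es _ z).
  case: (e z x1'); case: (e z x2'); case: (e x1' x2'); case: (J u' z); case: (J u' x1');
    case: (J u' x2') => //= t1 t2 _; by [right | left; apply: t1 | left; apply: t2].
have U' : uniq [:: v; u; z; y1; y2; x1; x2].
  apply: uniq_perm_eq U; perm_tac.
have [|hu] := side _ _ _ _ _ _ Juv nu nv U; first by left.
have [|hv] := side _ _ _ _ _ _ Jvu nv nu U'; first by left.
have zero w' w r a b : J w w' -> nbrs w [:: w'; r; a; b] -> J w a -> J w b -> ~~ J w r.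
  by move=> jw nw ja jb; have := join_parity clsV HJ nw jw; rewrite ja jb; case: (J w r).
case/orP: hu => [/andP[zx1 zx2]|hu]; case/orP: hv => [/andP[zy1 zy2]|hv].
(* [z] would be adjacent to [u], [v] and all four private neighbours, against the degree bound 5. *)
- have zu : e z u by rewrite es; apply: nbrs_in nu _; local.
  have zv : e z v by rewrite es; apply: nbrs_in nv _; local.
  have [||t nt st] := @nbrs_extend z [:: u; v; x1; x2; y1; y2].
  + have : uniq (z :: [:: u; v; x1; x2; y1; y2]) by apply: uniq_perm_eq U; perm_tac.
    by case/andP.
  + by rewrite /= zu zv zx1 zx2 zy1 zy2.
  by have [_ _ /(_ z)] := clsV; rewrite -st.
- left; case/and5P: hv => j1 j2 y12 _ _.
  by apply: (case44_1_cover HJ Juv nu nv U) => //; apply: zero Jvu nv j1 j2.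
- left; case/and5P: hu => j1 j2 x12 _ _.
  by apply: (case44_1_cover HJ Jvu nv nu U') => //; apply: zero Juv nu j1 j2.
by right.
Qed.

(** In the obstruction [uz] and [vz] lie outside [J]. An odd [z] gives the triangle. For even [z]
    the join is switched and [u], [z] is the new pair, with [v] as its only common neighbour because
    [z] sees neither [x1] nor [x2]; the obstruction cannot recur, as just one further neighbour of
    [z] is joined to it. *)
Lemma case44_1 J u v z x1 x2 y1 y2 : join J -> J u v ->
  nbrs u [:: v; z; x1; x2] -> nbrs v [:: u; z; y1; y2] -> uniq [:: u; v; z; x1; x2; y1; y2] ->
  halvable e V.
Proof.
move=> HJ Juv nu nv U; have [Js Je Jo] := HJ; have Jvu := etrans (Js v u) Juv.
have [//|[/and5P[jx1 jx2 x12 zx1 zx2] /and5P[jy1 jy2 y12 zy1 zy2]]] := case44_1_or HJ Juv nu nv U.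
have Juz : ~~ J u z.
  by have := join_parity clsV HJ nu Juv; rewrite jx1 jx2; case: (J u z).
have Jvz : ~~ J v z.
  by have := join_parity clsV HJ nv Jvu; rewrite jy1 jy2; case: (J v z).
get_neq U.
have [oz|ez] := boolP (odd (deg (nrel e) z)).
  by apply: (triangle44 clsV IH HJ Juv nu nv) => //; local.
have uz : e u z by apply: nbrs_in nu _; local.
have vz : e v z by apply: nbrs_in nv _; local.
have [J' [a [b [HJ' nz Juz' par Jsame]]]] := even_common HJ Juv uz vz Juz Jvz ez.
have nu' : nbrs u [:: z; v; x1; x2] by apply: nbrs_perm nu; perm_tac.
have za : e z a by apply: nbrs_in nz _; local.
have zb : e z b by apply: nbrs_in nz _; local.
have ne w : ~~ e z w -> (a != w) /\ (b != w).
  by move=> zw; split; apply: contraNneq zw => <-.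
have [ax1 bx1] := ne _ zx1; have [ax2 bx2] := ne _ zx2.
have za' := edge_neq za; have zb' := edge_neq zb.
have [uz' _] := nz; get_neq uz'.
have [|//|[_ /and5P[h1 h2 _ _ _]]] := case44_1_or HJ' Juz' nu' nz.
  by local.
by rewrite h1 h2 in par.
Qed.

(** Lifting [x z2] at [u] and [z1 z2] at [v] links [x], [z1] and [z2], so only [y] imposes a
    condition. The path is [z1 u v y], preceded by [z2] if [z1 z2] is an edge. *)
Lemma case44_2_lift J u v z1 z2 x y : join J -> J u v ->
  nbrs u [:: v; z1; z2; x] -> nbrs v [:: u; z1; z2; y] -> uniq [:: u; v; z1; z2; x; y] ->
  ~~ e x z2 -> (J v y -> e y z1 || e y z2) -> halvable e V.
Proof.
move=> HJ Juv nu nv U xz2 hy; have [Js Je Jo] := HJ.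
have euv := Je _ _ Juv; have uz1 : e u z1 by apply: nbrs_in nu _; local.
have vy : e v y by apply: nbrs_in nv _; local.
have {}nu : nbrs u [:: v; z1; x; z2] by apply: nbrs_perm nu; perm_tac.
have {}nv : nbrs v [:: u; y; z1; z2] by apply: nbrs_perm nv; perm_tac.
get_neq U.
have ly L : eqrel L -> L z1 z2 -> (e y z1 -> L y z1) -> (e y z2 -> L y z2) -> pair_linked J L v y z1 z2.
  move=> [Lr Ls Lt] L12 h1 h2; split=> /hy /orP[] h _; auto.
    by apply: Lt (h2 h) _; apply: Ls.
  by apply: Lt (h1 h) _.
have [z12|z12] := boolP (e z1 z2).
  apply: (@reduce44 _ _ _ clsV IH u v J HJ Juv z1 x z2 y z1 z2 [:: z2] [::] nu nv).
  - by local.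
  - by rewrite /= (es z2) z12 es uz1 euv vy.
  - by rewrite (negbTE xz2).
  - by local.
  - by local.
  move=> L eqL Lab Lcd Le; have [Lr Ls Lt] := eqL; split=> //=.
  + by split; [apply: Ls|].
  + by split=> // _ _; apply: Lt Lcd _; apply: Ls.
  by apply: ly => // h; apply: Le => //; local.
apply: (@reduce44s _ _ _ clsV IH u v J HJ Juv z1 x z2 y z1 z2 nu nv) => //; first by local.
move=> L eqL Lab Lcd Le; have [Lr Ls Lt] := eqL; split.
  by split=> // _ _; apply: Lt Lcd _; apply: Ls.
by apply: ly => // h; apply: Le => //; local.
Qed.

(** The lifted pairs are again [x z2] and [z1 z2]; now [x z2] is an edge, and the path
    [z2 x z1 u v y] takes it up. *)
Lemma case44_2_full J u v z1 z2 x y : join J -> J u v ->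
  nbrs u [:: v; z1; z2; x] -> nbrs v [:: u; z1; z2; y] -> uniq [:: u; v; z1; z2; x; y] ->
  ~~ e z1 z2 -> e x z1 -> e x z2 -> e y z1 -> halvable e V.
Proof.
move=> HJ Juv nu nv U z12 xz1 xz2 yz1; have [Js Je Jo] := HJ.
have euv := Je _ _ Juv; have uz1 : e u z1 by apply: nbrs_in nu _; local.
have vy : e v y by apply: nbrs_in nv _; local.
have {}nu : nbrs u [:: v; z1; x; z2] by apply: nbrs_perm nu; perm_tac.
have {}nv : nbrs v [:: u; y; z1; z2] by apply: nbrs_perm nv; perm_tac.
get_neq U.
apply: (@reduce44 _ _ _ clsV IH u v J HJ Juv z1 x z2 y z1 z2 [:: z2; x] [::] nu nv).
- by local.
- by rewrite /= (es z2) xz2 xz1 es uz1 euv vy.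
- by local.
- by rewrite (negbTE z12).
- by local.
move=> L eqL Lab Lcd Le; have [Lr Ls Lt] := eqL.
have L1x : L z1 x by apply: Lt Lcd _; apply: Ls.
have Ly1 : L y z1 by apply: Le => //; local.
split=> //=; first by split; [apply: Ls | split; [apply: Ls|]].
by split=> // _ _; apply: Lt Ly1 _.
Qed.

(** If [z1 z2] is an edge, it is kept and links everything. Otherwise parity gives each of [u] and
    [v] exactly one [J]-neighbour among [z1] and [z2], and these may differ or agree. *)
Lemma case44_2_empty J u v z1 z2 x y : join J -> J u v ->
  nbrs u [:: v; z1; z2; x] -> nbrs v [:: u; z1; z2; y] -> uniq [:: u; v; z1; z2; x; y] ->
  ~~ e x z1 -> ~~ e x z2 -> ~~ e y z1 -> ~~ e y z2 -> J u x -> J v y -> halvable e V.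
Proof.
move=> HJ Juv nu nv U x1 x2 y1 y2 Jux Jvy; have [Js Je Jo] := HJ.
have Jvu := etrans (Js v u) Juv.
have [z12|z12] := boolP (e z1 z2).
  have nu' : nbrs u [:: v; z1; x; z2] by apply: nbrs_perm nu; perm_tac.
  have nv' : nbrs v [:: u; z2; y; z1] by apply: nbrs_perm nv; perm_tac.
  get_neq U.
  apply: (@reduce44s _ _ _ clsV IH u v J HJ Juv z1 x z2 z2 y z1 nu' nv') => //; first by local.
  move=> L eqL Lab Lcd Le; have [Lr Ls Lt] := eqL.
  have L12 : L z1 z2 by apply: Le => //; local.
  split; split=> // _ _; last by apply: Ls.
    by apply: Lt L12 _; apply: Ls.
  by apply: Lt (Ls _ _ L12) _; apply: Ls.
(* Different [J]-neighbours: the path [b u v a] leaves each end by an edge outside [J], so the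
   lifted pairs link all that is needed. *)
have cross a b : perm_eq [:: z1; z2] [:: a; b] -> J u a -> ~~ J u b -> J v b -> ~~ J v a -> halvable e V.
  move=> pe ua ub vb va.
  have nu' : nbrs u [:: v; b; x; a].
    apply: nbrs_perm nu; rewrite perm_cons.
    apply: (@perm_trans _ ([:: z1; z2] ++ [:: x])) => //.
    apply: (@perm_trans _ ([:: a; b] ++ [:: x])); last by perm_tac.
    by rewrite perm_cat2r.
  have nv' : nbrs v [:: u; a; y; b].
    apply: nbrs_perm nv; rewrite perm_cons.
    apply: (@perm_trans _ ([:: z1; z2] ++ [:: y])) => //.
    apply: (@perm_trans _ ([:: a; b] ++ [:: y])); last by perm_tac.
    by rewrite perm_cat2r.
  have ain : a \in [:: z1; z2] by rewrite (perm_mem pe) mem_head.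
  have bin : b \in [:: z1; z2] by rewrite (perm_mem pe) !inE eqxx orbT.
  have [uu _] := nu'; have [uv' _] := nv'; get_neq U; get_neq uu; get_neq uv'.
  have xa : ~~ e x a by move: ain; rewrite !inE => /orP[] /eqP->.
  have yb : ~~ e y b by move: bin; rewrite !inE => /orP[] /eqP->.
  apply: (@reduce44s _ _ _ clsV IH u v J HJ Juv b x a a y b nu' nv') => //.
  - by local.
  move=> L eqL Lab Lcd Le; split; split=> h; [by rewrite h in ub.. | by rewrite h in va | by rewrite h in va].
(* Equal [J]-neighbours: the other vertex [b] forms the triangle. If it is even, [ub] replaces [uv]
   after a switch, and [v] is the only common neighbour of [u] and [b]. *)
have tri a b : perm_eq [:: z1; z2] [:: a; b] -> ~~ e b a -> ~~ J u b -> ~~ J v b -> halvable e V.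
  move=> pe ba ub vb.
  have nu' : nbrs u [:: v; b; a; x].
    apply: nbrs_perm nu; rewrite perm_cons.
    apply: (@perm_trans _ ([:: z1; z2] ++ [:: x])) => //.
    apply: (@perm_trans _ ([:: a; b] ++ [:: x])); last by perm_tac.
    by rewrite perm_cat2r.
  have nv' : nbrs v [:: u; b; a; y].
    apply: nbrs_perm nv; rewrite perm_cons.
    apply: (@perm_trans _ ([:: z1; z2] ++ [:: y])) => //.
    apply: (@perm_trans _ ([:: a; b] ++ [:: y])); last by perm_tac.
    by rewrite perm_cat2r.
  have ain : a \in [:: z1; z2] by rewrite (perm_mem pe) mem_head.
  have bin : b \in [:: z1; z2] by rewrite (perm_mem pe) !inE eqxx orbT.
  have ub' : e u b by apply: nbrs_in nu' _; local.
  have vb' : e v b by apply: nbrs_in nv' _; local.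
  have ax : ~~ e a x by rewrite es; move: ain; rewrite !inE => /orP[] /eqP->.
  have ay : ~~ e a y by rewrite es; move: ain; rewrite !inE => /orP[] /eqP->.
  have bx : ~~ e b x by rewrite es; move: bin; rewrite !inE => /orP[] /eqP->.
  have [uu _] := nu'; have [uv' _] := nv'.
  have euv := Je _ _ Juv.
  have ux : e u x by apply: nbrs_in nu _; local.
  have ua : e u a by apply: nbrs_in nu' _; local.
  have nuv := edge_neq euv; have nux := edge_neq ux; have nua := edge_neq ua.
  have nub := edge_neq ub'.
  have [ob|eb] := boolP (odd (deg (nrel e) b)).
    get_neq U; get_neq uu; get_neq uv'.
    by apply: (triangle44 clsV IH HJ Juv nu' nv') => //; local.
  have [J' [c [d [HJ' nz Jub' par Jsame]]]] := even_common HJ Juv ub' vb' ub vb eb.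
  have nu2 : nbrs u [:: b; v; a; x] by apply: nbrs_perm nu'; perm_tac.
  have bc : e b c by apply: nbrs_in nz _; local.
  have bd : e b d by apply: nbrs_in nz _; local.
  have ne w : ~~ e b w -> (c != w) /\ (d != w).
    by move=> zw; split; apply: contraNneq zw => <-.
  have [ca da] := ne _ ba; have [cx dx] := ne _ bx.
  have nbc := edge_neq bc; have nbd := edge_neq bd.
  have [un _] := nz; get_neq un; get_neq uu.
  have [|//|[_ /and5P[h1 h2 _ _ _]]] := case44_1_or HJ' Jub' nu2 nz.
    by local.
  by rewrite h1 h2 in par.
have := join_parity clsV HJ nu Juv; have := join_parity clsV HJ nv Jvu; rewrite Jux Jvy.
case Ju1: (J u z1); case Ju2: (J u z2); case Jv1: (J v z1); case Jv2: (J v z2) => // _ _.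
- by apply: (tri z1 z2) => //; rewrite ?Ju2 ?Jv2 // es.
- by apply: (cross z1 z2); rewrite ?Ju1 ?Ju2 ?Jv1 ?Jv2.
- by apply: (cross z2 z1); rewrite ?Ju1 ?Ju2 ?Jv1 ?Jv2 //; perm_tac.
- by apply: (tri z2 z1) => //; rewrite ?Ju1 ?Jv1 //; perm_tac.
Qed.

Lemma case44_2 J u v z1 z2 x y : join J -> J u v ->
  nbrs u [:: v; z1; z2; x] -> nbrs v [:: u; z1; z2; y] -> uniq [:: u; v; z1; z2; x; y] ->
  halvable e V \/ [&& e z1 z2, e x z1, e x z2, e y z1 & e y z2].
Proof.
move=> HJ Juv nu nv U; have [Js Je Jo] := HJ; have Jvu := etrans (Js v u) Juv.
have nu' : nbrs u [:: v; z2; z1; x] by apply: nbrs_perm nu; perm_tac.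
have nv' : nbrs v [:: u; z2; z1; y] by apply: nbrs_perm nv; perm_tac.
have U1 : uniq [:: u; v; z2; z1; x; y] by apply: uniq_perm_eq U; perm_tac.
have U2 : uniq [:: v; u; z1; z2; y; x] by apply: uniq_perm_eq U; perm_tac.
have U3 : uniq [:: v; u; z2; z1; y; x] by apply: uniq_perm_eq U; perm_tac.
have tb : (~~ e x z1 || ~~ e x z2) && (J v y ==> (e y z1 || e y z2)) -> halvable e V.
  case/andP=> /orP[] h1 /implyP h2.
    by apply: (case44_2_lift HJ Juv nu' nv' U1 h1); rewrite orbC.
  exact: (case44_2_lift HJ Juv nu nv U h1).
have ta : (~~ e y z1 || ~~ e y z2) && (J u x ==> (e x z1 || e x z2)) -> halvable e V.
  case/andP=> /orP[] h1 /implyP h2.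
    by apply: (case44_2_lift HJ Jvu nv' nu' U3 h1); rewrite orbC.
  exact: (case44_2_lift HJ Jvu nv nu U2 h1).
have te := case44_2_empty HJ Juv nu nv U.
have tf := case44_2_full HJ Juv nu nv U.
move: ta tb te tf; case: (e z1 z2); case: (e x z1); case: (e x z2); case: (e y z1); case: (e y z2);
  case: (J u x); case: (J v y) => //= ta tb te tf;
  by [right | left; apply: ta | left; apply: tb | left; apply: te | left; apply: tf].
Qed.

(** If [c] sees neither [a] nor [b], the lifted edges [bc] and [ac] link all three. If only [ac] is
    missing, it is lifted at [v], and the path [c u v b a] takes up [ab], which is lifted at [u]. *)
Lemma case44_3 J u v z1 z2 z3 : join J -> J u v ->
  nbrs u [:: v; z1; z2; z3] -> nbrs v [:: u; z1; z2; z3] ->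
  halvable e V \/ [&& e z1 z2, e z1 z3 & e z2 z3].
Proof.
move=> HJ Juv nu nv; have [Js Je Jo] := HJ; have euv := Je _ _ Juv.
have none a b c : perm_eq [:: z1; z2; z3] [:: a; b; c] -> ~~ e c a -> ~~ e c b -> halvable e V.
  move=> pe ca cb.
  have nu' : nbrs u [:: v; a; b; c] by apply: nbrs_perm nu; rewrite perm_cons.
  have nv' : nbrs v [:: u; b; a; c].
    have : nbrs v [:: u; a; b; c] by apply: nbrs_perm nv; rewrite perm_cons.
    by apply: nbrs_perm; perm_tac.
  have [uu _] := nu'; get_neq uu.
  apply: (@reduce44s _ _ _ clsV IH u v J HJ Juv a b c b a c nu' nv') => //; try by rewrite es.
    by local.
  move=> L [Lr Ls Lt] L1 L2 Le; have Lab : L a b by apply: Lt L2 _; apply: Ls.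
  by split; split=> // _ _; apply: Ls.
have one a b c : perm_eq [:: z1; z2; z3] [:: a; b; c] -> ~~ e a c -> e a b -> e b c -> halvable e V.
  move=> pe ac ab bc.
  have nu' : nbrs u [:: v; c; a; b].
    have : nbrs u [:: v; a; b; c] by apply: nbrs_perm nu; rewrite perm_cons.
    by apply: nbrs_perm; perm_tac.
  have nv' : nbrs v [:: u; b; a; c].
    have : nbrs v [:: u; a; b; c] by apply: nbrs_perm nv; rewrite perm_cons.
    by apply: nbrs_perm; perm_tac.
  have [uu _] := nu'; have [uv' _] := nv'.
  have n1 := edge_neq euv.
  have uc : e u c by apply: nbrs_in nu' _; local.
  have ua : e u a by apply: nbrs_in nu' _; local.
  have ub : e u b by apply: nbrs_in nu' _; local.
  have vb : e v b by apply: nbrs_in nv' _; local.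
  have n2 := edge_neq uc; have n3 := edge_neq ua; have n4 := edge_neq ub.
  get_neq uu; get_neq uv'.
  apply: (@reduce44 _ _ _ clsV IH u v J HJ Juv c a b b a c [::] [:: a] nu' nv').
  - by local.
  - by rewrite /= es uc euv vb es ab.
  - by local.
  - by rewrite (negbTE ac).
  - by local.
  move=> L [Lr Ls Lt] L1 L2 Le; split=> //=; first by split; [apply: Ls|].
    by split=> _ _; [apply: Ls | apply: Lt (Ls _ _ L2) _].
  by split=> _ _; [apply: Ls | apply: Lt (Ls _ _ L1) _].
have n1 := none z1 z2 z3 (perm_refl _); have n2 := none z1 z3 z2 ltac:(perm_tac).
have n3 := none z2 z3 z1 ltac:(perm_tac).
have o1 := one z1 z2 z3 (perm_refl _); have o2 := one z1 z3 z2 ltac:(perm_tac).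
have o3 := one z2 z1 z3 ltac:(perm_tac).
move: n1 n2 n3 o1 o2 o3; rewrite !(es z2 z1) !(es z3 z1) !(es z3 z2).
case: (e z1 z2); case: (e z1 z3); case: (e z2 z3) => //= n1 n2 n3 o1 o2 o3;
  by [right | left; apply: n1 | left; apply: n2 | left; apply: n3 |
      left; apply: o1 | left; apply: o2 | left; apply: o3].
Qed.

(** * Near-cliques: deleting four vertices *)

Definition strip (S : seq T) (o : option (T * T)) : rel T :=
  fun p q => [&& e p q, p \notin S & q \notin S] || oedge o p q.

(** Four deleted vertices pay for two further paths. The ends [a] and [b] of the optional new edge
    lose their edges to [u] and [w], so degrees do not grow. All outside neighbours of [S] must end
    up connected, as [fill_delete] links them across different vertices of [S]. *)
Lemma delete4 (S : seq T) (o : option (T * T)) u w : uniq S -> size S = 4 ->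
  u \in S -> w \in S -> u != w -> {in S, forall s, exists t, e s t} ->
  (if o is Some (a, b) then [/\ a != b, a \notin S, b \notin S, e a u & e b w] else True) ->
  (forall s t p q, s \in S -> t \in S -> e s p -> e t q -> p \notin S -> q \notin S ->
     connect (strip S o) p q) ->
  exists2 D, dec (nrel (strip S o)) D & 2 * size D + 4 <= #|V|.
Proof.
move=> uS sS uinS winS uw nonempty ho att; set e' := strip S o in att *.
have oV p q : oedge o p q -> [/\ p \notin S, q \notin S, p != q & p \in V].
  case: o ho {att} @e' => //= -[a b] [ab aS bS au bw] /orP[] /andP[/eqP-> /eqP->].
    by split=> //; apply: eV au.
  by split=> //; [rewrite eq_sym | apply: eV bw].
have es' : symmetric e'.
  by move=> p q; rewrite /e' /strip es oedge_sym; congr (_ || _); rewrite [X in _ && X]andbC.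
have e0' : irreflexive e'.
  by move=> p; rewrite /e' /strip e0 /=; apply/negP => /oV[]; rewrite eqxx.
have dle p : deg (nrel e') p + (p \in S) * deg (nrel e) p <= deg (nrel e) p.
  have [pS|pS] := boolP (p \in S).
    rewrite deg_set0 ?mul1n // => q; rewrite /e' /strip pS andbF /=.
    by apply/negP => /oV[]; rewrite pS.
  rewrite mul0n addn0; apply: (@leq_trans (deg (fun p q => [&& e p q, p \notin S & q \notin S]) p
     + deg (fun p q => oedge o p q) p)).
    rewrite /deg -big_split; apply: leq_sum => q _; rewrite /nrel /e' /strip.
    by case: [&& _, _ & _]; case: (oedge _ _ _).
  apply: (@leq_trans (deg (fun p q => [&& e p q, p \notin S & q \notin S]) p + (e p u + e p w))).
    rewrite leq_add2l; case: o ho {att e' oV es' e0'} => [[a b]|_]; last by rewrite /deg big1.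
    move=> [ab aS bS au bw]; rewrite /deg /= sum_ei //.
    have [->|_] := eqVneq p a; first by rewrite (negbTE ab) au.
    by have [->|_] := eqVneq p b => //; rewrite bw; case: (e b u).
  rewrite -{1}(sum_delta u (fun y => e p y)) -(sum_delta w (fun y => e p y)) -!big_split /=.
  apply: leq_sum => q _; rewrite /nrel pS /=.
  have [->|qu] := eqVneq q u; first by rewrite uinS (negbTE uw) andbF mul1n mul0n addn0.
  have [->|qw] := eqVneq q w; first by rewrite winS andbF mul1n mul0n.
  by rewrite !mul0n !addn0; case: (e p q) => //; apply: leq_b1.
have SV : [set:: S] \subset V.
  by apply/subsetP => s; rewrite inE => /nonempty[t /eV].
have cS : #|[set:: S]| = 4 by rewrite cardsE (card_uniqP uS).
have cV : #|V :\: [set:: S]| + 4 = #|V|.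
  by rewrite -(cardsID [set:: S] V) (setIidPr SV) cS addnC.
have cl : joinable e' (V :\: [set:: S]).
  split=> // [p|p q|].
  - by have [_ _ h _ _] := clsV; apply: leq_trans (h p); apply: leq_trans (dle p); rewrite leq_addr.
  - rewrite !inE => /orP[/and3P[/eV -> -> //]|/oV[-> _ _ ->]] //.
  - have [_ _ _ _ [J HJ]] := clsV; have [Js Je Jo] := HJ.
    have := @fill_delete _ e e' V [set:: S] J HJ e0 es' e0' SV; rewrite cS => /(_ isT) h.
    apply: fill_ext (h _ _) _ => [p q Jpq||p]; last by rewrite !inE andbC.
      by rewrite !inE => pS qS; apply: connect1; rewrite /e' /strip pS qS Je.
    by move=> s t p q; rewrite !inE => sS' tS' /Je sp /Je tq; apply: att sp tq.
have lt : esize e' < esize e.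
  apply: (@esize_lt _ _ _ u) => [y|]; first by apply: leq_trans (dle y); rewrite leq_addr.
  apply: leq_trans (dle u); rewrite uinS mul1n -addn1 leq_add2l.
  by have [t ut] := nonempty u uinS; apply: deg_gt0 ut.
by have [D dD sz] := IH lt cl; exists D => //; rewrite -cV leq_add2r.
Qed.

Lemma rows_eq (F G : T -> T -> nat) (S : seq T) :
  (forall p q, F p q = F q p) -> (forall p q, G p q = G q p) ->
  {in S, forall s q, F s q = G s q} ->
  (forall p q, p \notin S -> q \notin S -> F p q = G p q) -> forall p q, F p q = G p q.
Proof.
move=> Fs Gs h1 h2 p q; have [/h1 //|pS] := boolP (p \in S).
by have [/h1 h|qS] := boolP (q \in S); [rewrite Fs h Gs | apply: h2].
Qed.

(** By the degree bound [z1] and [z2] see nothing beyond these six vertices, so only [x] and [y]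
    have to be linked, which the new edge [xy] does. *)
Lemma clique_pair u v z1 z2 x y :
  nbrs u [:: v; z1; z2; x] -> nbrs v [:: u; z1; z2; y] -> uniq [:: u; v; z1; z2; x; y] ->
  e z1 z2 -> e x z1 -> e x z2 -> e y z1 -> e y z2 -> halvable e V.
Proof.
move=> nu nv U z12 xz1 xz2 yz1 yz2.
have uv : e u v by apply: nbrs_in nu _; local.
have uz1 : e u z1 by apply: nbrs_in nu _; local.
have uz2 : e u z2 by apply: nbrs_in nu _; local.
have ux : e u x by apply: nbrs_in nu _; local.
have vz1 : e v z1 by apply: nbrs_in nv _; local.
have vz2 : e v z2 by apply: nbrs_in nv _; local.
have vy : e v y by apply: nbrs_in nv _; local.
have full z z' : uniq [:: u; v; z'; x; y] -> e u z -> e v z -> e z z' -> e x z -> e y z ->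
    nbrs z [:: u; v; z'; x; y].
  move=> U' uz vz zz xz yz; have [|t nt st] := @nbrs_extend z [:: u; v; z'; x; y] U'.
    by rewrite /= es uz es vz zz es xz es yz.
  have [_ _ /(_ z) h _ _] := clsV; rewrite -st size_cat /= in h.
  by case: t h {st} nt => //; rewrite cats0.
have nz1 : nbrs z1 [:: u; v; z2; x; y].
  by apply: full => //; get_neq U; local.
have nz2 : nbrs z2 [:: u; v; z1; x; y].
  by apply: full => //; [get_neq U; local | rewrite es].
get_neq U.
pose S := [:: u; v; z1; z2].
have xS : x \notin S by local.
have yS : y \notin S by local.
have [||||||||D dD sz] := @delete4 S (Some (x, y)) u v.
- by local.
- by [].
- by local.
- by local.
- by [].
- move=> s; rewrite !inE => /or4P[] /eqP->.
  + by exists v.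
  + by exists u; rewrite es.
  + by exists u; rewrite es.
  + by exists u; rewrite es.
- by split=> //; rewrite es.
- have attS s p : s \in S -> e s p -> p \notin S -> (p == x) || (p == y).
    rewrite !inE => /or4P[] /eqP->; rewrite ?nu.2 ?nv.2 ?nz1.2 ?nz2.2 !inE;
    by case: (p == u); case: (p == v); case: (p == z1); case: (p == z2);
       case: (p == x); case: (p == y).
  have cxy : connect (strip S (Some (x, y))) x y by apply: connect1; rewrite /strip /= ei_self orbT.
  have cyx : connect (strip S (Some (x, y))) y x.
    by apply: connect1; rewrite /strip /= eiC ei_self orbT.
  move=> s t p q sS tS sp tq pS qS; have := attS _ _ sS sp pS; have := attS _ _ tS tq qS.
  by case/orP=> /eqP-> /orP[] /eqP->.
pose f p q : bool := [&& e p q, p \notin S, q \notin S & ~~ ei x y p q].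
have stripE p q : nrel (strip S (Some (x, y))) p q = f p q + ei x y p q.
  rewrite /nrel /strip /f /=; case E: (ei x y p q); last by rewrite andbT orbF addn0.
  by rewrite orbT !andbF.
have [||||D2 d2 s2] := @dec_sub _ _ (fun p q => f p q + ec [:: x; z1; z2; y] p q) D x y [:: z1; z2] dD.
- by rewrite stripE ei_self addn1.
- by local.
- move=> w; rewrite !inE => /orP[] /eqP-> q; rewrite stripE /f; by local.
- by move=> p q; rewrite stripE [rcons _ _]/=; natlia.
(* The twelve edges at the four vertices form [x z1 z2 y], which replaces the new edge, and the
   paths [P1] and [P2]. If [xy] was an edge of [e], it coincided with the new one and is restored at
   the start of [P2]. *)
pose P1 := [:: z1; u; x; z2; v; y].
pose P2 := if e x y then [:: x; y; z1; v; u; z2] else [:: y; z1; v; u; z2].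
have d3 := @dec_add _ _ _ D2 P1 d2 _ _ (fun _ _ => erefl).
have d4 := @dec_add _ _ (nrel e) (P1 :: D2) P2 (d3 _ _).
have sz4 : 2 * size (P2 :: P1 :: D2) <= #|V|.
  by apply: leq_trans sz; rewrite /= s2; clear; lia.
exists (P2 :: P1 :: D2) => //; apply: d4 => //; [by local | | | ].
- by rewrite /P2; case: ifP => _; local.
- by rewrite /P2; case: ifP.
have P2E p q : ec P2 p q = (e x y && ei x y p q) + ec [:: y; z1; v; u; z2] p q.
  by rewrite /P2; case: ifP => // _; rewrite ec_cons2.
have row s q : s \in S ->
    nrel e s q = f s q + ec [:: x; z1; z2; y] s q + ec P1 s q + ec P2 s q.
  move=> sS; rewrite P2E /f sS andbF /= /nrel /P1.
  move: sS; rewrite !inE => /or4P[] /eqP->; rewrite ?nu.2 ?nv.2 ?nz1.2 ?nz2.2;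
  (have [->|qu] := eqVneq q u; [by local|]);
  (have [->|qv] := eqVneq q v; [by local|]);
  (have [->|qz1] := eqVneq q z1; [by local|]);
  (have [->|qz2] := eqVneq q z2; [by local|]);
  (have [->|qx] := eqVneq q x; [by local|]);
  (have [->|qy] := eqVneq q y; [by local|]); by local.
apply: (@rows_eq _ _ S) => [p q|p q|s sS q|p q pS qS].
- by rewrite /nrel es.
- rewrite !(ec_sym _ p) /f (es p) (ei_sym _ _ p); congr (_ + _ + _ + _).
  by congr (nat_of_bool (_ && _)); rewrite andbCA.
- exact: row.
rewrite P2E /nrel /f pS qS /= /P1 !ec_cons2 !ec_seq1.
have out a b : (a \in S) || (b \in S) -> ei a b p q = false.
  move=> ab; apply/negP => /orP[] /andP[/eqP pa /eqP qb]; rewrite pa in pS; rewrite qb in qS;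
  by move: ab; rewrite (negbTE pS) (negbTE qS).
set E := ei x y p q; rewrite !out; try by local.
rewrite /= !addn0 /E; have [/orP[]|] := boolP (ei x y p q); last by rewrite andbT andbF addn0.
  by case/andP=> /eqP-> /eqP->; rewrite /= andbF andbT.
by case/andP=> /eqP-> /eqP->; rewrite /= andbF andbT es.
Qed.

(** Five odd degrees of [J] within these five vertices would have an odd sum. *)
Lemma clique5_closed u v z1 z2 z3 :
  nbrs u [:: v; z1; z2; z3] -> nbrs v [:: u; z1; z2; z3] -> nbrs z1 [:: u; v; z2; z3] ->
  nbrs z2 [:: u; v; z1; z3] -> nbrs z3 [:: u; v; z1; z2] -> False.
Proof.
move=> nu nv n1 n2 n3; have [_ _ _ _ [J HJ]] := clsV; have [Js Je Jo] := HJ.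
have o w w' (t : seq T) : nbrs w (w' :: t) -> odd (\sum_(y <- w' :: t) J w y).
  move=> nw; have wV : w \in V by apply: (@eV w w'); apply: nbrs_in nw (mem_head _ _).
  by rewrite -(join_deg HJ nw.1 nw.2) Jo.
have := o _ _ _ nu; have := o _ _ _ nv; have := o _ _ _ n1; have := o _ _ _ n2; have := o _ _ _ n3.
rewrite !big_cons !big_nil !(Js v u) !(Js z1 u) !(Js z1 v) !(Js z2 u) !(Js z2 v) !(Js z2 z1).
rewrite !(Js z3 u) !(Js z3 v) !(Js z3 z1) !(Js z3 z2).
move: (nat_of_bool (J u v)) (nat_of_bool (J u z1)) (nat_of_bool (J u z2)) (nat_of_bool (J u z3))
  (nat_of_bool (J v z1)) (nat_of_bool (J v z2)) (nat_of_bool (J v z3))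
  (nat_of_bool (J z1 z2)) (nat_of_bool (J z1 z3)) (nat_of_bool (J z2 z3)); clear; lia.
Qed.

(** No vertex is deleted: some join avoids [uv], after switching along the triangle if necessary,
    and once [uv] is removed the fan at [u] restores it, [v] having become odd. *)
Lemma odd_neighbours_reduction u v z : e u v -> e u z -> e v z -> ~~ odd (deg (nrel e) v) ->
  (forall w, e u w -> w != v -> odd (deg (nrel e) w)) -> halvable e V.
Proof.
move=> euv uz vz ev ow; have [_ _ deg5 _ [J0 HJ0]] := clsV.
have uv := edge_neq euv; have u_z := edge_neq uz; have v_z := edge_neq vz.
have [J HJ nJ] : exists2 J, join J & ~~ J u v.
  have [j|j] := boolP (J0 u v); last by exists J0.
  exists (fun x y => J0 x y (+) ei u v x y (+) ei v z x y (+) ei u z x y).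
    exact: join_toggle.
  by rewrite j; local.
have [Js Je Jo] := HJ.
pose e' : rel T := fun x y => e x y && ~~ ei u v x y.
have eE x y : nrel e x y = nrel e' x y + ei u v x y.
  rewrite /nrel /e'; have [|_] := boolP (ei u v x y); last by rewrite andbT addn0.
  by case/orP=> /andP[/eqP-> /eqP->]; rewrite ?[e v u]es euv.
have dE x : deg (nrel e) x = deg (nrel e') x + ((x == u) + (x == v)).
  by rewrite -(sum_ei x uv); apply: (@deg_add _ _ _ (fun x y => ei u v x y)) => y; apply: eE.
have c' : joinable e' V.
  split=> // [x y|x|x|x y /andP[/eV]//|].
  - by rewrite /e' es ei_sym.
  - by rewrite /e' e0.
  - by apply: leq_trans (deg5 x); rewrite dE leq_addr.
  exists J; split=> // x y Jxy; rewrite /e' Je //=; apply: contra nJ.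
  by case/orP=> /andP[/eqP <- /eqP <-] //; rewrite Js.
have lt' : esize e' < esize e.
  apply: (@esize_lt _ _ _ u) => [w|]; first by rewrite (dE w) leq_addr.
  by rewrite (dE u) eqxx; clear; lia.
have [D dD sz] := IH lt' c'.
have tv : 0 < tok D v.
  apply: (dec_odd_tok dD); move: ev; rewrite (dE v) eqxx eq_sym (negbTE uv).
  by move: (deg _ _); clear; lia.
have [|||||W' [D2 [W'W cW' dD2 sD2 _]]] := @fan _ u (nrel e') D [set v] 1 dD.
- by move=> y; rewrite /nrel; case: (e' _ _).
- by rewrite inE.
- by move=> y; rewrite inE => /eqP->; rewrite /nrel /e' ei_self andbF.
- move=> w; rewrite /nrel; case: (boolP (e' u w)) => // /andP[uw nuw] _.
  have wv : w != v by apply: contraNneq nuw => ->; rewrite ei_self.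
  apply: (dec_odd_tok dD); have := ow _ uw wv; rewrite (dE w) (negbTE wv).
  by rewrite eq_sym (negbTE (edge_neq uw)) addn0.
- by rewrite cards1.
have W'E : W' = [set v] by apply/eqP; rewrite eqEcard W'W cards1 cW'.
exists D2; last by rewrite sD2.
apply: dec_eq dD2 _ => a b; rewrite eE W'E !inE eiE //; congr (_ + (_ + _)).
exact: mulnC.
Qed.

Lemma strip_none S p q : strip S None p q = [&& e p q, p \notin S & q \notin S].
Proof. by rewrite /strip /= orbF. Qed.

(* In the complete graph on 1, ..., 5, removing the path 12345 leaves the paths 31425 and 153. *)
Lemma clique5_pendant u v z1 z2 z3 a (E : bool) :
  nbrs u [:: v; z1; z2; z3] -> nbrs v [:: u; z1; z2; z3] -> nbrs z1 [:: u; v; z2; z3; a] ->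
  (forall y, e z2 y = (y \in [:: u; v; z1; z3]) || (E && (y == a))) ->
  nbrs z3 [:: u; v; z1; z2] -> halvable e V.
Proof.
move=> nu nv n1 n2 n3.
have uv : e u v by apply: nbrs_in nu _; local.
have uz1 : e u z1 by apply: nbrs_in nu _; local.
have uz2 : e u z2 by apply: nbrs_in nu _; local.
have uz3 : e u z3 by apply: nbrs_in nu _; local.
have vz1 : e v z1 by apply: nbrs_in nv _; local.
have vz2 : e v z2 by apply: nbrs_in nv _; local.
have vz3 : e v z3 by apply: nbrs_in nv _; local.
have z1a : e z1 a by apply: nbrs_in n1 _; local.
have z2z3 : e z2 z3 by rewrite es; apply: nbrs_in n3 _; local.
have h1 := edge_neq uv; have h2 := edge_neq uz1; have h3 := edge_neq uz2.
have h4 := edge_neq uz3; have h5 := edge_neq vz1; have h6 := edge_neq vz2.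
have h7 := edge_neq vz3; have h8 := edge_neq z1a; have h9 := edge_neq z2z3.
have [k1 _] := nu; have [k2 _] := n1; get_neq k1; get_neq k2.
pose S := [:: u; v; z2; z3].
have z1S : z1 \notin S by local.
have aS : a \notin S by local.
have st1 q : strip S None z1 q = (q == a).
  rewrite strip_none z1S n1.2 !inE.
  have [->|qa] := eqVneq q a; first by local.
  by case: (q == u); case: (q == v); case: (q == z2); case: (q == z3).
have [||||||||D dD sz] := @delete4 S None u v.
- by local.
- by [].
- by local.
- by local.
- by [].
- move=> s; rewrite !inE => /or4P[] /eqP->.
  + by exists v.
  + by exists u; rewrite es.
  + by exists u; rewrite es.
  + by exists u; rewrite es.
- by [].
- have attS s p : s \in S -> e s p -> p \notin S -> (p == z1) || (p == a).
    rewrite !inE => /or4P[] /eqP->; rewrite ?nu.2 ?nv.2 ?n3.2 ?n2 !inE;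
    by case: (p == u); case: (p == v); case: (p == z1); case: (p == z2);
       case: (p == z3); case: (p == a);
       rewrite ?andbF.
  have c1 : connect (strip S None) z1 a by apply: connect1; rewrite st1.
  have c2 : connect (strip S None) a z1.
    by apply: connect1; rewrite strip_none es z1a z1S aS.
  move=> s t p q sS tS sp tq pS qS; have := attS _ _ sS sp pS; have := attS _ _ tS tq qS.
  by case/orP=> /eqP-> /orP[] /eqP->.
(* Only [a] is still adjacent to [z1], so a path ends there. *)
have t1 : 0 < tok D z1.
  apply: (dec_odd_tok dD); rewrite /deg; under eq_bigr => q _ do rewrite /nrel st1.
  by rewrite sum_delta1.
have [||||D2 d2 s2] := @dec_ext _ _ (fun p q => nrel (strip S None) p q + ec [:: z1; u; z2; v; z3] p q)
    D z1 [:: u; z2; v; z3] dD t1.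
- by local.
- by local.
- move=> w; rewrite !inE => /or4P[] /eqP-> q; rewrite /nrel strip_none; by local.
- by [].
(* The vertices 1 to 5 are [z1], [u], [z2], [v], [z3]. [E] tells whether [z2] is adjacent to [a] as
   well; then [a z2] is put in front. *)
pose P1 := if E then [:: a; z2; z1; v; u; z3] else [:: z2; z1; v; u; z3].
pose P2 := [:: z1; z3; z2].
have d3 := @dec_add _ _ _ D2 P1 d2 _ _ (fun _ _ => erefl).
have d4 := @dec_add _ _ (nrel e) (P1 :: D2) P2 (d3 _ _).
exists (P2 :: P1 :: D2); last by apply: leq_trans sz; rewrite /= s2; clear; lia.
apply: d4 => //; [by rewrite /P1; case: ifP => _; local | by rewrite /P1; case: ifP | by local | ].
have P1E p q : ec P1 p q = (E && ei a z2 p q) + ec [:: z2; z1; v; u; z3] p q.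
  by rewrite /P1; case: ifP => // _; rewrite ec_cons2.
have row s q : s \in S ->
    nrel e s q = nrel (strip S None) s q + ec [:: z1; u; z2; v; z3] s q + ec P1 s q + ec P2 s q.
  move=> sS; rewrite P1E /nrel strip_none sS andbF /= /P2.
  move: sS; rewrite !inE => /or4P[] /eqP->; rewrite ?nu.2 ?nv.2 ?n3.2 ?n2;
  (have [->|qu] := eqVneq q u; [by local|]);
  (have [->|qv] := eqVneq q v; [by local|]);
  (have [->|qz1] := eqVneq q z1; [by local|]);
  (have [->|qz2] := eqVneq q z2; [by local|]);
  (have [->|qz3] := eqVneq q z3; [by local|]);
  (have [->|qa] := eqVneq q a; [by local; case: (E)|]); by local.
apply: (@rows_eq _ _ S) => [p q|p q|s sS q|p q pS qS].
- by rewrite /nrel es.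
- rewrite !(ec_sym _ p) /nrel !strip_none (es p); congr (_ + _ + _ + _).
  by rewrite [X in _ && X]andbC.
- exact: row.
rewrite P1E /nrel strip_none pS qS andbT /P2 !ec_cons2 !ec_seq1.
have out b c : (b \in S) || (c \in S) -> ei b c p q = false.
  move=> bc; apply/negP => /orP[] /andP[/eqP pa /eqP qb]; rewrite pa in pS; rewrite qb in qS;
  by move: bc; rewrite (negbTE pS) (negbTE qS).
rewrite !out; try by local.
by rewrite ?andbT ?andbF ?addn0 /= ?andbT ?addn0.
Qed.

(** As [a] and [b] differ, [z1 b] is not an edge. Adding it links the neighbours of the deleted
    vertices; afterwards it is expanded to a path through all five. *)
Lemma clique5_two u v z1 z2 z3 a b :
  nbrs u [:: v; z1; z2; z3] -> nbrs v [:: u; z1; z2; z3] -> nbrs z1 [:: u; v; z2; z3; a] ->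
  nbrs z2 [:: u; v; z1; z3; b] -> nbrs z3 [:: u; v; z1; z2] -> a != b -> halvable e V.
Proof.
move=> nu nv n1 n2 n3 ab.
have uv : e u v by apply: nbrs_in nu _; local.
have uz1 : e u z1 by apply: nbrs_in nu _; local.
have uz2 : e u z2 by apply: nbrs_in nu _; local.
have uz3 : e u z3 by apply: nbrs_in nu _; local.
have vz1 : e v z1 by apply: nbrs_in nv _; local.
have vz2 : e v z2 by apply: nbrs_in nv _; local.
have vz3 : e v z3 by apply: nbrs_in nv _; local.
have z1a : e z1 a by apply: nbrs_in n1 _; local.
have z2b : e z2 b by apply: nbrs_in n2 _; local.
have z2z3 : e z2 z3 by rewrite es; apply: nbrs_in n3 _; local.
have h1 := edge_neq uv; have h2 := edge_neq uz1; have h3 := edge_neq uz2.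
have h4 := edge_neq uz3; have h5 := edge_neq vz1; have h6 := edge_neq vz2.
have h7 := edge_neq vz3; have h8 := edge_neq z1a; have h9 := edge_neq z2z3.
have h10 := edge_neq z2b.
have [k1 _] := nu; have [k2 _] := n1; have [k3 _] := n2; get_neq k1; get_neq k2; get_neq k3.
pose S := [:: u; v; z2; z3].
have z1S : z1 \notin S by local.
have bS : b \notin S by local.
have nz1b : ~~ e z1 b by rewrite n1.2; local.
have [||||||||D dD sz] := @delete4 S (Some (z1, b)) u z2.
- by local.
- by [].
- by local.
- by local.
- by [].
- move=> s; rewrite !inE => /or4P[] /eqP->.
  + by exists v.
  + by exists u; rewrite es.
  + by exists u; rewrite es.
  + by exists u; rewrite es.
- by split=> //; rewrite es.
- have attS s p : s \in S -> e s p -> p \notin S -> (p == z1) || (p == b).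
    rewrite !inE => /or4P[] /eqP->; rewrite ?nu.2 ?nv.2 ?n3.2 ?n2.2 !inE;
    by case: (p == u); case: (p == v); case: (p == z1); case: (p == z2);
       case: (p == z3); case: (p == b).
  have c1 : connect (strip S (Some (z1, b))) z1 b by apply: connect1; rewrite /strip /= ei_self orbT.
  have c2 : connect (strip S (Some (z1, b))) b z1.
    by apply: connect1; rewrite /strip /= eiC ei_self orbT.
  move=> s t p q sS tS sp tq pS qS; have := attS _ _ sS sp pS; have := attS _ _ tS tq qS.
  by case/orP=> /eqP-> /orP[] /eqP->.
pose f p q : bool := [&& e p q, p \notin S & q \notin S].
have stripE p q : nrel (strip S (Some (z1, b))) p q = f p q + ei z1 b p q.
  rewrite /nrel /strip /f /=; case E: (ei z1 b p q); last by rewrite orbF addn0.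
  by case/orP: E => /andP[/eqP-> /eqP->]; rewrite ?[e b z1]es (negbTE nz1b).
have [||||D2 d2 s2] := @dec_sub _ _ (fun p q => f p q + ec [:: z1; u; v; z3; z2; b] p q) D z1 b
    [:: u; v; z3; z2] dD.
- by rewrite stripE ei_self addn1.
- by local.
- move=> w; rewrite !inE => /or4P[] /eqP-> q; rewrite stripE /f; by local.
- by move=> p q; rewrite stripE [rcons _ _]/=; natlia.
(* Again the path 12345 is removed from the complete graph, now with [z1], [u], [v], [z3], [z2] as 1
   to 5. *)
pose P1 := [:: v; z1; z3; u; z2].
pose P2 := [:: z1; z2; v].
have d3 := @dec_add _ _ _ D2 P1 d2 _ _ (fun _ _ => erefl).
have d4 := @dec_add _ _ (nrel e) (P1 :: D2) P2 (d3 _ _).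
exists (P2 :: P1 :: D2); last by apply: leq_trans sz; rewrite /= s2; clear; lia.
apply: d4 => //; [by local | by local | ].
have row s q : s \in S ->
    nrel e s q = f s q + ec [:: z1; u; v; z3; z2; b] s q + ec P1 s q + ec P2 s q.
  move=> sS; rewrite /nrel /f sS andbF /= /P1 /P2.
  move: sS; rewrite !inE => /or4P[] /eqP->; rewrite ?nu.2 ?nv.2 ?n3.2 ?n2.2;
  (have [->|qu] := eqVneq q u; [by local|]);
  (have [->|qv] := eqVneq q v; [by local|]);
  (have [->|qz1] := eqVneq q z1; [by local|]);
  (have [->|qz2] := eqVneq q z2; [by local|]);
  (have [->|qz3] := eqVneq q z3; [by local|]);
  (have [->|qb] := eqVneq q b; [by local|]); by local.
apply: (@rows_eq _ _ S) => [p q|p q|s sS q|p q pS qS].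
- by rewrite /nrel es.
- rewrite !(ec_sym _ p) /f (es p); congr (_ + _ + _ + _).
  by rewrite [X in _ && X]andbC.
- exact: row.
rewrite /nrel /f pS qS andbT /P1 /P2 !ec_cons2 !ec_seq1.
have out c d : (c \in S) || (d \in S) -> ei c d p q = false.
  move=> bc; apply/negP => /orP[] /andP[/eqP pa /eqP qb]; rewrite pa in pS; rewrite qb in qS;
  by move: bc; rewrite (negbTE pS) (negbTE qS).
rewrite !out; try by local.
by rewrite ?andbT ?addn0 /= ?andbT ?addn0.
Qed.

(** Each of [z1], [z2], [z3] has at most one neighbour outside the five vertices, and the number of
    those with one decides: none is excluded by parity, one or two allow the deletion of four
    vertices, and with three all neighbours of [u] but [v] are odd. *)
Lemma clique5 u v z1 z2 z3 : nbrs u [:: v; z1; z2; z3] -> nbrs v [:: u; z1; z2; z3] ->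
  e z1 z2 -> e z1 z3 -> e z2 z3 -> halvable e V.
Proof.
move=> nu nv z12 z13 z23.
have uv : e u v by apply: nbrs_in nu _; local.
have uz1 : e u z1 by apply: nbrs_in nu _; local.
have uz2 : e u z2 by apply: nbrs_in nu _; local.
have uz3 : e u z3 by apply: nbrs_in nu _; local.
have vz1 : e v z1 by apply: nbrs_in nv _; local.
have vz2 : e v z2 by apply: nbrs_in nv _; local.
have vz3 : e v z3 by apply: nbrs_in nv _; local.
have ev : ~~ odd (deg (nrel e) v) by rewrite (nbrs_deg nv).
have ext z z' z'' : e u z -> e v z -> e z z' -> e z z'' -> e u z' -> e u z'' -> e v z' -> e v z'' ->
    e z' z'' -> nbrs z [:: u; v; z'; z''] \/ exists a, nbrs z [:: u; v; z'; z''; a].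
  move=> uz vz zz' zz'' uz' uz'' vz' vz'' z'z''.
  have n1 := edge_neq uv; have n2 := edge_neq uz'; have n3 := edge_neq uz''.
  have n4 := edge_neq vz'; have n5 := edge_neq vz''; have n6 := edge_neq z'z''.
  have [||t nt st] := @nbrs_extend z [:: u; v; z'; z''].
  - by local.
  - by rewrite /= es uz es vz zz' zz''.
  have [_ _ /(_ z) h _ _] := clsV; rewrite -st size_cat /= in h.
  by case: t h {st} nt => [|a []] // _ nt; [left | right; exists a].
have perm3 w a b c (z' z'' z''' : T) : perm_eq [:: z1; z2; z3] [:: a; b; c] ->
    nbrs w [:: z'; z1; z2; z3] -> nbrs w [:: z'; a; b; c].
  by move=> pe nw; apply: nbrs_perm nw; rewrite perm_cons.
have one a b c x : perm_eq [:: z1; z2; z3] [:: a; b; c] ->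
    nbrs a [:: u; v; b; c; x] -> nbrs b [:: u; v; a; c] -> nbrs c [:: u; v; a; b] -> halvable e V.
  move=> pe na nb nc.
  apply: (clique5_pendant (E := false) (perm3 u a b c v a b pe nu) (perm3 v a b c u a b pe nv) na _ nc).
  by move=> y; rewrite nb.2 orbF.
have two a b c x y : perm_eq [:: z1; z2; z3] [:: a; b; c] ->
    nbrs a [:: u; v; b; c; x] -> nbrs b [:: u; v; a; c; y] -> nbrs c [:: u; v; a; b] -> halvable e V.
  move=> pe na nb nc; have [xy|xy] := eqVneq x y; last first.
    exact: (clique5_two (perm3 u a b c v a b pe nu) (perm3 v a b c u a b pe nv) na nb nc xy).
  subst y.
  apply: (clique5_pendant (E := true) (perm3 u a b c v a b pe nu) (perm3 v a b c u a b pe nv) na _ nc).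
  by move=> y; rewrite nb.2 !inE -!orbA.
have sw z a b : nbrs z [:: u; v; a; b] -> nbrs z [:: u; v; b; a].
  by apply: nbrs_perm; perm_tac.
have sw' z a b c : nbrs z [:: u; v; a; b; c] -> nbrs z [:: u; v; b; a; c].
  by apply: nbrs_perm; perm_tac.
have z21 : e z2 z1 by rewrite es.
have z31 : e z3 z1 by rewrite es.
have z32 : e z3 z2 by rewrite es.
have [n1|[a n1]] := ext z1 z2 z3 uz1 vz1 z12 z13 uz2 uz3 vz2 vz3 z23;
have [n2|[b n2]] := ext z2 z1 z3 uz2 vz2 z21 z23 uz1 uz3 vz1 vz3 z13;
have [n3|[c n3]] := ext z3 z1 z2 uz3 vz3 z31 z32 uz1 uz2 vz1 vz2 z12.
- by case: (clique5_closed nu nv n1 n2 n3).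
- apply: (one z3 z1 z2 c) => //; first [perm_tac | exact: sw | exact: sw'].
- apply: (one z2 z1 z3 b) => //; first [perm_tac | exact: sw | exact: sw'].
- apply: (two z2 z3 z1 b c) => //; first [perm_tac | exact: sw | exact: sw'].
- by apply: (one z1 z2 z3 a).
- apply: (two z1 z3 z2 a c) => //; first [perm_tac | exact: sw | exact: sw'].
- by apply: (two z1 z2 z3 a b).
apply: (odd_neighbours_reduction uv uz1 vz1 ev) => w; rewrite nu.2 !inE => /or4P[] /eqP->.
- by rewrite eqxx.
- by rewrite (nbrs_deg n1).
- by rewrite (nbrs_deg n2).
- by rewrite (nbrs_deg n3).
Qed.
End Configurations.

(** * Conclusion *)

Section Main.
Variable T : finType.
Implicit Types (e J : rel T) (V : {set T}) (u v x y z : T).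

Lemma case44 e V J u v x1 x2 x3 y1 y2 y3 : joinable e V ->
  (forall (e' : rel T) (V' : {set T}), esize e' < esize e -> joinable e' V' -> halvable e' V') ->
  join_of e (fun x => x \in V) J -> J u v ->
  nbrs e u [:: v; x1; x2; x3] -> nbrs e v [:: u; y1; y2; y3] -> halvable e V.
Proof.
move=> clsV IH HJ Juv nu nv; have [_ Je _] := HJ; have euv := Je _ _ Juv.
have [es e0 _ _ _] := clsV.
set X := [:: x1; x2; x3] in nu; set Y := [:: y1; y2; y3] in nv.
have uX : uniq X by case: nu => /andP[].
have uY' : uniq Y by case: nv => /andP[].
(* Both neighbourhoods are reordered to begin with the same list [Z] of common neighbours, as the
   four cases expect. *)
pose Z := [seq x <- X | x \in Y]; pose X' := [seq x <- X | x \notin Y].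
pose Y' := [seq y <- Y | y \notin X].
have pX : perm_eq X (Z ++ X') by rewrite perm_sym /Z /X' perm_filterC.
have pY : perm_eq Y (Z ++ Y').
  rewrite perm_sym; apply: perm_trans (_ : perm_eq _ ([seq y <- Y | y \in X] ++ Y')) _.
    rewrite perm_cat2r; apply: uniq_perm; rewrite ?filter_uniq // => y.
    by rewrite !mem_filter andbC.
  by rewrite /Y' perm_filterC.
have {}nu : nbrs e u (v :: Z ++ X') by apply: nbrs_perm nu; rewrite perm_cons.
have {}nv : nbrs e v (u :: Z ++ Y') by apply: nbrs_perm nv; rewrite perm_cons.
have U : uniq (u :: v :: Z ++ X' ++ Y').
  have nuu : u \notin Z ++ X' by apply/negP => h; have := e0 u; rewrite nu.2 inE h orbT.
  have nvv : v \notin Z ++ Y' by apply/negP => h; have := e0 v; rewrite nv.2 inE h orbT.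
  have uv : u != v by apply: contraTneq euv => ->; rewrite e0.
  have /andP[vZ u1] : (v \notin Z ++ X') && uniq (Z ++ X') by rewrite -cons_uniq; case: nu.
  have /andP[uZ u2] : (u \notin Z ++ Y') && uniq (Z ++ Y') by rewrite -cons_uniq; case: nv.
  move: nuu nvv vZ uZ; rewrite !mem_cat !negb_or => /andP[a1 a2] /andP[a3 a4] /andP[a5 a6] /andP[a7 a8].
  rewrite !cons_uniq !mem_cat !inE !mem_cat !negb_or uv a1 a2 a8 a5 a6 a4 /= catA cat_uniq u1.
  have [_ -> _] : [/\ true, uniq Y' & true] by rewrite filter_uniq.
  rewrite andbT; apply/hasPn => y; rewrite /= /Y' mem_filter => /andP[yX _].
  by rewrite -(perm_mem pX).
have sX : size Z + size X' = 3 by rewrite -size_cat -(perm_size pX).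
have sY : size Z + size Y' = 3 by rewrite -size_cat -(perm_size pY).
move: Z X' Y' sX sY nu nv U {pX pY} => Z X' Y' sX sY nu nv U.
case: Z sX sY nu nv U => [|z1 [|z2 [|z3 [|z4 Z]]]] //= sX sY nu nv U.
- case: X' sX nu U => [|a1 [|a2 [|a3 [|]]]] // _ nu U.
  case: Y' sY nv U => [|b1 [|b2 [|b3 [|]]]] // _ nv U.
  exact: (case44_0 clsV IH HJ Juv nu nv U).
- case: X' sX nu U => [|a1 [|a2 [|]]] // _ nu U.
  case: Y' sY nv U => [|b1 [|b2 [|]]] // _ nv U.
  exact: (case44_1 clsV IH HJ Juv nu nv U).
- case: X' sX nu U => [|a1 [|]] // _ nu U.
  case: Y' sY nv U => [|b1 [|]] // _ nv U.
  have [//|/and5P[h1 h2 h3 h4 h5]] := case44_2 clsV IH HJ Juv nu nv U.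
  exact: (clique_pair clsV IH nu nv U).
- case: X' sX nu U => // _ nu U; case: Y' sY nv U => // _ nv U.
  have [//|/and3P[h1 h2 h3]] := case44_3 clsV IH HJ Juv nu nv.
  exact: (clique5 clsV IH nu nv).
Qed.

Lemma even_nbrs e u v : e u v -> deg (nrel e) u = 2 -> exists x, nbrs e u [:: v; x].
Proof.
move=> euv d; have [||t nt st] := @nbrs_extend _ e u [:: v]; rewrite ?d //=; first by rewrite euv.
by rewrite d in st; case: t st nt => [|x []] //= _ nt; exists x.
Qed.

Lemma even_nbrs4 e u v : e u v -> deg (nrel e) u = 4 ->
  exists x1 x2 x3, nbrs e u [:: v; x1; x2; x3].
Proof.
move=> euv d; have [||t nt st] := @nbrs_extend _ e u [:: v]; rewrite ?d //=; first by rewrite euv.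
by rewrite d in st; case: t st nt => [|x1 [|x2 [|x3 []]]] //= _ nt; exists x1, x2, x3.
Qed.

Theorem joinable_halvable e V : joinable e V -> halvable e V.
Proof.
move: {2}(esize e).+1 (ltnSn (esize e)) => n; elim: n e V => // n IHn e V en clsV.
have IH (e' : rel T) (V' : {set T}) : esize e' < esize e -> joinable e' V' -> halvable e' V'.
  by move=> lt; apply: IHn; apply: leq_trans lt _; rewrite -ltnS.
have [es e0 _ eV _] := clsV.
have [/existsP[u /existsP[v /and3P[euv eu ev]]]|] :=
  boolP [exists u, exists v, [&& e u v, ~~ odd (deg (nrel e) u) & ~~ odd (deg (nrel e) v)]].
  have [//|[J HJ Juv]] := join_through clsV IH euv eu.
  have evu : e v u by rewrite es.
  have Jvu : J v u by have [Js _ _] := HJ; rewrite Js.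
  have [du|du] := even_deg clsV euv eu; have [dv|dv] := even_deg clsV evu ev.
  - have [x nu] := even_nbrs euv du; have [y nv] := even_nbrs evu dv.
    exact: (case22 clsV IH HJ Juv nu nv).
  - have [x nu] := even_nbrs euv du; have [y1 [y2 [y3 nv]]] := even_nbrs4 evu dv.
    exact: (case24 clsV IH HJ Juv nu nv).
  - have [x1 [x2 [x3 nu]]] := even_nbrs4 euv du; have [y nv] := even_nbrs evu dv.
    exact: (case24 clsV IH HJ Jvu nv nu).
  - have [x1 [x2 [x3 nu]]] := even_nbrs4 euv du; have [y1 [y2 [y3 nv]]] := even_nbrs4 evu dv.
    exact: (case44 clsV IH HJ Juv nu nv).
rewrite negb_exists => /forallP indep.
have [|D [dD _ sz]] := independent_even_dec es e0.
  move=> x y exy; have := indep x; rewrite negb_exists => /forallP/(_ y).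
  by rewrite exy /=; case: odd; case: odd.
exists D => //; apply: leq_trans sz _; apply: subset_leq_card; apply/subsetP => x.
rewrite inE => dx; have [/existsP[y /eV //]|] := boolP [exists y, e x y].
rewrite negb_exists => /forallP no.
by rewrite deg_set0 in dx.
Qed.

(** For even [#|T|] the complete graph on [T] has all degrees odd, and connectedness transfers its
    parities to [e]. *)
Lemma connected_fill e : symmetric e -> irreflexive e -> Defs.connected e -> ~~ odd #|T| ->
  fill e (fun x => x \in [set: T]).
Proof.
move=> es e0 co ev; apply: fill_ext (fill_connect es e0 (J := fun x y => x != y) _ _ _) _ => [x y|x|x y _|x].
- by rewrite eq_sym.
- by rewrite eqxx.
- exact: co.
rewrite inE; have : #|T| = deg (nrel (fun x y => x != y)) x + 1.
  rewrite -(sum_delta1 x) -big_split /= -sum1_card; apply: eq_bigr => y _.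
  by rewrite /nrel eq_sym; case: eqVneq.
by move: ev => /[swap] ->; rewrite addn1 /= negbK => ->.
Qed.

(** * From edge counts to sets of subgraphs *)

Lemma degE e x : deg (nrel e) x = degree e x.
Proof.
rewrite /degree -sum1_card big_mkcond; apply: eq_bigr => y _.
by rewrite inE /nrel; case: (e x y).
Qed.

Definition path_graph (p : seq T) : {set T} * {set {set T}} :=
  ([set:: p], if p is x :: s then [set:: pairmap (fun a b => [set a; b]) x s] else set0).

Lemma path_graph_edge p a b : ([set a; b] \in (path_graph p).2) = (0 < ec p a b).
Proof.
have ei_set c d : ([set a; b] == [set c; d]) = ei c d a b.
  apply/eqP/orP => [h|[/andP[/eqP-> /eqP->]|/andP[/eqP-> /eqP->]]] //; last by rewrite setUC.
  have a1 : a \in [set c; d] by rewrite -h !inE eqxx.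
  have b1 : b \in [set c; d] by rewrite -h !inE eqxx orbT.
  have c1 : c \in [set a; b] by rewrite h !inE eqxx.
  have d1 : d \in [set a; b] by rewrite h !inE eqxx orbT.
  move: a1 b1 c1 d1; rewrite !inE (eq_sym c a) (eq_sym c b) (eq_sym d a) (eq_sym d b).
  by case: (a == c); case: (a == d); case: (b == c); case: (b == d) => //= *; first [by left | by right].
case: p => [|x s]; first by rewrite inE.
elim: s x => [|c s IHs] x; first by rewrite inE.
by rewrite ec_cons2 addn_gt0 -IHs /= !inE ei_set lt0b.
Qed.

Lemma path_graph_sub p f : f \in (path_graph p).2 ->
  exists a b, f = [set a; b] /\ 0 < ec p a b.
Proof.
case: p => [|x s]; first by rewrite inE.
rewrite inE; elim: s x => // c s IHs x /=; rewrite inE => /predU1P[->|/IHs[a [b [-> h]]]].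
  by exists x, c; rewrite ec_cons2 ei_self.
by exists a, b; rewrite ec_cons2 addn_gt0 h orbT.
Qed.

(** An edge on two different paths of [D] would be counted twice, which gives uniqueness. Different
    lists may describe the same subgraph, so the set is possibly smaller than the list. *)
Lemma dec_path_decomposition e D : dec (nrel e) D ->
  exists2 D' : {set {set T} * {set {set T}}}, path_decomposition e D' & #|D'| <= size D.
Proof.
move=> [w E]; exists [set:: map path_graph D]; last first.
  by rewrite cardsE (leq_trans (card_size _)) // size_map.
have ec1 p a b : p \in D -> 0 < ec p a b -> e a b.
  move=> pD h; have := E a b; rewrite /eD (big_rem p) //= /nrel.
  by case: (e a b) => // /eqP; rewrite addn_eq0 => /andP[/eqP h0]; rewrite h0 in h.
split=> [H|f].
  rewrite inE => /mapP[p pD ->]; have /andP[up sp] := allP w _ pD; split.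
    split=> [|f /path_graph_sub[a [b [-> /ec_gt0_in/andP[ap bp]]]]].
      apply/subsetP => f /path_graph_sub[a [b [-> h]]].
      by rewrite inE; apply/existsP; exists a; apply/existsP; exists b; rewrite (ec1 p) /=.
    by apply/subsetP => y; rewrite !inE => /orP[] /eqP->.
  by case: p up sp {pD} => // x s up _; exists x, s.
rewrite inE => /existsP[a /existsP[b /andP[eab /eqP->]]].
have [p pD hp] : exists2 p, p \in D & 0 < ec p a b.
  apply/hasP; apply: contraTT eab => /hasPn h.
  have := E a b; rewrite /eD big_seq big1 => [|p /h]; first by rewrite /nrel; case: (e a b).
  by rewrite -eqn0Ngt => /eqP.
exists (path_graph p); split=> [|H' [H'D]].
  by rewrite inE map_f // path_graph_edge.
move: H'D; rewrite inE => /mapP[q qD ->]; rewrite path_graph_edge => hq.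
have [->//|pq] := eqVneq p q.
have qr : q \in rem p D by rewrite (perm_mem (perm_to_rem pD)) inE eq_sym (negbTE pq) in qD.
have := E a b; rewrite /eD (big_rem p) //= (big_rem q) //= /nrel eab.
by move: hp hq; move: (ec p a b) (ec q a b); clear; lia.
Qed.
End Main.

(** * The pendant vertex *)

Section Pendant.
Variables (T : finType) (e : rel T) (r : T).

Definition pendant : rel (option T) := fun x y =>
  match x, y with
  | Some a, Some b => e a b
  | None, Some b => b == r
  | Some a, None => a == r
  | None, None => false
  end.

Lemma sum_option (F : option T -> nat) : \sum_y F y = F None + \sum_y F (Some y).
Proof.
rewrite (bigD1 None) //=; congr (_ + _).
rewrite (reindex_onto Some (odflt r)) /=; first by apply: eq_bigl => y; rewrite eqxx.
by case.
Qed.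

Lemma pmap_ec (p : seq (option T)) x y : None \notin p -> ec (pmap id p) x y = ec p (Some x) (Some y).
Proof.
elim: p => // -[a|] p IHp; last by rewrite inE.
rewrite inE /= => Np; case: p IHp Np => [|[b|] p] IHp Np; last by rewrite inE in Np.
  by rewrite !ec_seq1.
by rewrite [pmap _ _]/= !ec_cons2 -IHp.
Qed.

Lemma uniq_pmap (p : seq (option T)) : uniq p -> uniq (pmap id p).
Proof.
elim: p => // -[a|] p IHp /andP[ap /IHp h] //=; rewrite h andbT.
by rewrite mem_pmap map_id.
Qed.

(** The new vertex [None] has degree one, so it is an end of each path containing it, and its
    removal leaves a path or nothing; empty remainders are filtered out. *)
Lemma pendant_dec D : irreflexive e -> dec (nrel pendant) D ->
  exists2 D', dec (nrel e) D' & size D' <= size D.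
Proof.
move=> e0 [w E]; have nz p : p \in D -> None \in p -> 0 < nend p None.
  move=> pD Np; have /andP[up sp] := allP w _ pD; have := sum_ec None up sp.
  have : \sum_y ec p None y <= 1.
    apply: (@leq_trans (\sum_y nrel pendant None y)).
      by apply: leq_sum => y _; rewrite -E /eD (big_rem p) //= leq_addr.
    by rewrite sum_option /= add0n -(sum_delta1 r).
  by rewrite Np; move: (\sum_y _) (nend _ _); clear; lia.
have pe p x y : p \in D -> ec (pmap id p) x y = ec p (Some x) (Some y).
  move=> pD; have [Np|] := boolP (None \in p); last exact: pmap_ec.
  have := nz p pD Np; have /andP[up sp] := allP w _ pD.
  case: p up sp {pD Np} => // a p up _; case/lastP: p up => [|p b] up /=.
    by case: a up => //= *; rewrite ?ec_nil ?ec_seq1.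
  rewrite last_rcons; case: a up => [a|] up /=; last first.
    move=> _; move: up => /andP[Np _].
    by rewrite pmap_ec //; case: p Np => [|c p] /= _; rewrite ec_cons2 /ei andbF.
  case: b up => // up _; move: up; rewrite -rcons_cons rcons_uniq => /andP[Np _].
  have -> : pmap id (rcons p None) = pmap id p by rewrite -cats1 pmap_cat cats0.
  rewrite -[a :: _]/(pmap id (Some a :: p)) pmap_ec //.
  case/lastP: p Np => [|p c] Np; first by rewrite ec_cons2 /ei andbF !ec_seq1.
  by rewrite -!rcons_cons ec_rcons2 /ei !andbF addn0.
pose D' := [seq q <- map (pmap id) D | 0 < size q].
exists D'; last by rewrite /D' size_filter (leq_trans (count_size _ _)) // size_map.
split.
  apply/allP => q; rewrite mem_filter => /andP[sq /mapP[p pD qE]]; rewrite sq andbT qE.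
  by apply: uniq_pmap; case/andP: (allP w _ pD).
move=> x y; have -> : eD D' x y = \sum_(p <- D) ec (pmap id p) x y.
  rewrite /eD big_filter big_map [in RHS](bigID (fun p => 0 < size (pmap id p))) /=.
  by rewrite [X in _ + X]big1 ?addn0 // => p; case: (pmap id p).
have := E (Some x) (Some y); rewrite /nrel /= => <-; rewrite /eD big_seq [RHS]big_seq.
by apply: eq_bigr => p pD; apply: pe.
Qed.
End Pendant.

Theorem theorem3 (T : finType) (e : rel T)
    (e_sym : symmetric e) (e_irr : irreflexive e)
    (e_conn : connected e) (e_deg : max_degree e <= 5) :
  exists D : {set {set T} * {set {set T}}},
    path_decomposition e D /\ #|D| <= uphalf #|T|.
Proof.
have d5 x : deg (nrel e) x <= 5.
  by rewrite degE; apply: leq_trans e_deg; apply: (leq_bigmax x).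
suff [D dD sz] : exists2 D, dec (nrel e) D & size D <= uphalf #|T|.
  have [D' pd sD'] := dec_path_decomposition dD.
  by exists D'; split=> //; apply: leq_trans sz.
have [oT|eT] := boolP (odd #|T|); last first.
  have [|D dD] := @joinable_halvable T e [set: T]; last by rewrite cardsT => sz; exists D => //; lia.
  by split=> //; apply: connected_fill.
(* A 5-regular graph has an even number of vertices, so some vertex can take the pendant edge
   without exceeding degree 5. *)
have [/existsP[r dr]|] := boolP [exists r, deg (nrel e) r <= 4]; last first.
  rewrite negb_exists => /forallP all5.
  have := handshake (enum T) e_sym e_irr; rewrite big_enum /=.
  have -> : \sum_(x in T) \sum_(y <- enum T) e x y = \sum_(x : T) 5.
    apply: eq_bigr => x _; rewrite big_enum /=; have := all5 x; have := d5 x.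
    rewrite /deg /nrel (eq_bigl [in T]) //; move: (\sum_(y in T) _); clear; lia.
  by rewrite sum_nat_const oddM oT.
have pend_sym : symmetric (pendant e r) by case=> [x|] [y|] //=.
have pend_irr : irreflexive (pendant e r) by case=> [x|] /=.
have pend_conn : connected (pendant e r).
  have up x y : connect (pendant e r) (Some x) (Some y).
    have /connectP[p pp ->] := e_conn x y; elim: p x pp => [|c p IHp] x //= /andP[xc /IHp].
    by apply: connect_trans; apply: connect1.
  have cN : connect (pendant e r) (Some r) None by apply: connect1; rewrite /= eqxx.
  have Nc : connect (pendant e r) None (Some r) by apply: connect1; rewrite /= eqxx.
  move=> [x|] [y|] //; first by apply: connect_trans (up x r) cN.
  by apply: connect_trans Nc (up r y).
(* The extended graph has [#|T| + 1] vertices, and half of this even number is [uphalf #|T|]. *)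
have [|D dD] := @joinable_halvable _ (pendant e r) [set: option T].
  split=> // [[x|]|].
  + rewrite /deg (sum_option r) /nrel /=; have := d5 x; rewrite /deg /nrel.
    by have [->|_] := eqVneq x r; [move: dr; rewrite /deg /nrel; move: (\sum_y _); clear; lia |].
  + by rewrite /deg (sum_option r) /nrel /= sum_delta1.
  + by apply: connected_fill => //; rewrite card_option /= negbK.
rewrite cardsT card_option => sz; have [D' dD' sD'] := pendant_dec e_irr dD.
by exists D' => //; lia.
Qed.
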